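(* Consider the model $Y_{i,j}=\mu(x_{i,j})+Z_i(x_{i,j})+\epsilon_{i,j}$, $1\le i\le n$, $1\le j\le p$, with asynchronous design points, under the error assumption (E) and the design assumption (D), and the estimator $$\hat\Gamma^{\mathrm a}_{n,p}(x,y;h)=\frac1n\sum_{i=1}^n\sum_{1\le j<k\le p}w_{i;j,k}(x,y;h)\big(Y_{i,j}-\hat\mu(x_{i,j})\big)\big(Y_{i,k}-\hat\mu(x_{i,k})\big)$$ of the covariance kernel $\Gamma$, with a pre-estimation $\hat\mu=\hat\mu^{(i)}$ of the mean function $\mu$ leaving out the $i$-th curve. Let $\gamma>0$ and assume that the weights $w_{i;j,k}(x,y;h)$ satisfy (W1)--(W4) uniformly for all $i=1,\dots,n$ with $\zeta=\lfloor\gamma\rfloor$ and $h\in(c/p,h_0]$. Then for $0<\beta_0\le1$ and $L,C_Z>0$, $$\sup_{h\in(c/p,h_0]}\ \sup_{Z\in\mathcal P(\gamma;L,\beta_0,C_Z)}\mathbb E\big[a_{n,p,h}^{-1}\|\hat\Gamma^{\mathrm a}_{n,p}(\cdot;h)-\Gamma\|_\infty\big]=\mathcal O(1)$$ with $$a_{n,p,h}=\max\Big(\mathbb E\big[\|\hat\mu-\mu\|_\infty^2\big],\ \mathbb E\big[\|\hat\mu-\mu\|_\infty\big]\Big(\sqrt{\tfrac{\log(1/h)}{p\,h}}\vee1\Big),\ h^\gamma,\ \sqrt{\tfrac{\log(h^{-1})}{n\,p\,h}},\ n^{-1/2}\Big).$$ If the pre-estimation $\hat\mu$ is assumed to be fully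 independent of the data $Y_{i,j}$, $i=1,\dots,n$, $j=1,\dots,p$, used for the covariance kernel estimation (e.g. by sample splitting), then the rate of convergence is upper bounded by $$a_{n,p,h}=\max\Big(\mathbb E\big[\|\hat\mu-\mu\|_\infty^2\big],\ h^\gamma,\ \Big(1+\sqrt{\mathbb E\big[\|\hat\mu-\mu\|_\infty^2\big]}\Big)\sqrt{\tfrac{\log(h^{-1})}{n\,p\,h}},\ n^{-1/2}\Big).$$
   Context: Model. $Y_{i,j}=\mu(x_{i,j})+Z_i(x_{i,j})+\epsilon_{i,j}$ with known non-random design points $x_{i,1}<\dots<x_{i,p}$ in $[0,1]$, possibly different for each $i$ (and depending on $n$ and $p=p_n$); $\mu:[0,1]\to\mathbb R$ is unknown; $Z_1,\dots,Z_n$ are i.i.d. copies of a centered square-integrable process $Z$ on $[0,1]$ with covariance kernel $\Gamma(x,y)=\mathbb E[Z(x)Z(y)]$. Let $T=\{(x,y)\in[0,1]^2:x\le y\}$; the estimator is defined by the formula for $(x,y)\in T$ and extended symmetrically, and $\|\cdot\|_\infty$ is the supremum norm (on $[0,1]$ or $[0,1]^2$). $\mathcal O(1)$ refers to $n,p\to\infty$. (E) The $\epsilon_{i,j}$ are independent, centered, independent of $Z_1,\dots,Z_n$, and sub-Gaussian; with $\sigma_{ij}^2=\mathbb E[\epsilon_{i,j}^2]$ one has $\sigma^2:=\sup_n\max_{i,j}\sigma_{ij}^2<\infty$, and there is $\kappa\ge1$ such that $\kappa^2\sigma_{ij}^2$ is an upper bound for the squared sub-Gaussian norm of $\epsilon_{i,j}$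 (i.e. $\mathbb E[e^{\lambda\epsilon_{i,j}}]\le e^{\lambda^2\kappa^2\sigma_{ij}^2/2}$ for all $\lambda\in\mathbb R$). (D) There is a constant $C_3>0$ such that for each $i$, each $x\in[0,1]$ and $h>0$, $\operatorname{card}\{j\in\{1,\dots,p\}: x_{i,j}\in[x-h,x+h]\}\le C_3\,p\,h$. Weight conditions. The weights $w_{i;j,k}(x,y;h)$ are deterministic and depend on $x_{i,1},\dots,x_{i,p}$. There are $c>0$ and $h_0>0$ such that for all sufficiently large $p$, all $i$, and all $h\in(c/p,h_0]$ the following holds, with constants $C_1,C_2>0$ independent of $i,n,p,h$ and of points of $T$: (W1) for $(x,y)\in T$: $\sum_{j<k}w_{i;j,k}(x,y;h)=1$ and $\sum_{j<k}(x_{i,j}-x)^{r_1}(x_{i,k}-y)^{r_2}w_{i;j,k}(x,y;h)=0$ for all $r_1,r_2\in\mathbb N_0$ with $1\le r_1+r_2\le\zeta$; (W2) $w_{i;j,k}(x,y;h)=0$ if $\max(|x_{i,j}-x|,|x_{i,k}-y|)>h$, $(x,y)\in T$; (W3) $\max_{j<k}|w_{i;j,k}(x,y;h)|\le C_1(ph)^{-2}$, $(x,y)\in T$; (W4) $|w_{i;j,k}(x,y;h)-w_{i;j,k}(x',y';h)|\le\frac{C_2}{(ph)^2}\min\big(\frac{\max(|x-x'|,|y-y'|)}{h},1\big)$ for $(x,y),(x',y')\in T$. Classes. $\lfloor\gamma\rfloor:=\max\{k\in\mathbb N_0:k<\gamma\}$ (strict inequality). With $k=\lfloor\gamma\rfloor$,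 $\|f\|_{\mathcal H,\gamma;T}=\max_{|s|\le k}\sup_{v\in T}|D^sf(v)|+\max_{|s|=k}\sup_{v\ne w\in T}\frac{|D^sf(v)-D^sf(w)|}{\|v-w\|_\infty^{\gamma-k}}$, $s\in\mathbb N_0^2$; $\mathcal H_T(\gamma,L)=\{f:T\to\mathbb R:\|f\|_{\mathcal H,\gamma;T}\le L\}$. $\mathcal P(\gamma;L,\beta_0,C_Z)$ is the set of centered processes $Z$ on $[0,1]$ for which there exist $\beta\in[\beta_0,1]$ and a random variable $M>0$ with $\mathbb E[M^4]+\mathbb E[Z(0)^4]\le C_Z$, $|Z(x)-Z(y)|\le M|x-y|^\beta$ for all $x,y\in[0,1]$ almost surely, and $\Gamma|_T\in\mathcal H_T(\gamma,L)$.
   Formalization: O(1) is claimed as n,p→∞ with log p = O(n) for the first rate and log p = O(√n) for the second, since it fails in general without these growth conditions; (D) is required only for h ≥ 1/p, because no design satisfies it for all h > 0. *)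

(* Defs.v *)
From HB Require Import structures.
From mathcomp Require Import all_boot all_order all_algebra.
From mathcomp Require Import all_classical all_reals all_analysis.

Set Implicit Arguments.
Unset Strict Implicit.
Unset Printing Implicit Defensive.

Import Order.TTheory GRing.Theory Num.Theory.
Import numFieldNormedType.Exports.

Local Open Scope classical_set_scope.
Local Open Scope ring_scope.

Section Hoelder.
Variable R : realType.

Definition tri : set (R * R) := [set v | 0 <= v.1 /\ v.1 <= v.2 /\ v.2 <= 1].

Definition tri_int : set (R * R) :=
  [set v | 0 < v.1 /\ v.1 < v.2 /\ v.2 < 1].

(* The strict floor max {k : k < gamma}, which differs from the usual floor at
   the integers. *)
Definition sfloor (gamma : R) : nat :=
  \max_(k < (Num.truncn gamma).+1 | (k%:R : R) < gamma) k.

(* [D s] is the partial derivative of order s = (s1, s2) on the closed triangle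
   for |s| <= k. One-sided difference quotients are not available at all
   boundary points (at (0,0) the triangle contains no other point of the line
   y = 0), hence the derivatives are taken in the interior and extended
   continuously; the extension is unique. *)
Definition derivatives_on_tri (k : nat) (f : R * R -> R)
    (D : nat * nat -> R * R -> R) : Prop :=
  [/\ forall v, tri v -> D (0%N, 0%N) v = f v,
      forall s, (s.1 + s.2 <= k)%N -> {within tri, continuous (D s)},
      forall s v, (s.1 + s.2 < k)%N -> tri_int v ->
        is_derive (v.1 : R) 1 (fun t : R => D s (t, v.2)) (D (s.1.+1, s.2) v) &
      forall s v, (s.1 + s.2 < k)%N -> tri_int v ->
        is_derive (v.2 : R) 1 (fun t : R => D s (v.1, t)) (D (s.1, s.2.+1) v)].

Definition hoelder_norm (gamma : R) (D : nat * nat -> R * R -> R) : \bar R :=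
  (ereal_sup [set `|D sv.1 sv.2|%:E | sv in
     [set sv : (nat * nat) * (R * R) |
        (sv.1.1 + sv.1.2 <= sfloor gamma)%N /\ tri sv.2]]
   + ereal_sup [set (`|D svw.1 svw.2.1 - D svw.1 svw.2.2|
        / Num.max `|svw.2.1.1 - svw.2.2.1| `|svw.2.1.2 - svw.2.2.2|
            `^ (gamma - (sfloor gamma)%:R))%:E | svw in
     [set svw : (nat * nat) * ((R * R) * (R * R)) |
        (svw.1.1 + svw.1.2 = sfloor gamma)%N /\
        [/\ tri svw.2.1, tri svw.2.2 & svw.2.1 <> svw.2.2]]])%E.

Definition hoelder_class (gamma L : R) : set (R * R -> R) :=
  [set f | exists D, derivatives_on_tri (sfloor gamma) f D /\
                     (hoelder_norm gamma D <= L%:E)%E].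

End Hoelder.

Section Independence.
Context (d : measure_display) (T : measurableType d) (R : realType).
Variable P : probability T R.

Definition sigma_gen (J : Type) (X : J -> T -> R) : set (set T) :=
  <<s \bigcup_j preimage_set_system setT (X j) measurable >>.

Definition mutually_independent (I : finType) (G : I -> set (set T)) : Prop :=
  forall (J : {set I}) (A : I -> set T), (forall i, i \in J -> G i (A i)) ->
    P (\bigcap_(i in [set` J]) A i) = (\prod_(i in J) P (A i))%E.

Definition independent2 (G H : set (set T)) : Prop :=
  forall A B, G A -> H B -> P (A `&` B) = (P A * P B)%E.

End Independence.

Section Processes.
Variable R : realType.

(* Random functions are only ever evaluated at arguments in [0,1]. *)
Record process := Process {
  pdisp : measure_display;
  pspace : measurableType pdisp;
  plaw : probability pspace R;
  pval :> R -> pspace -> R }.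

Definition cov_kernel (Z : process) (v : R * R) : R :=
  fine ('E_(plaw Z)[(fun a => Z v.1 a * Z v.2 a)%R])%E.

Definition centered_sq_integrable (Z : process) : Prop :=
  forall t : R, 0 <= t <= 1 ->
    [/\ measurable_fun setT (Z t),
        ('E_(plaw Z)[Z t] = 0)%E &
        ('E_(plaw Z)[(fun a => Z t a ^+ 2)%R] < +oo)%E].

Definition process_class (gamma L beta0 CZ : R) (Z : process) : Prop :=
  [/\ centered_sq_integrable Z,
     exists (beta : R) (M : {RV (plaw Z) >-> R}),
       [/\ beta0 <= beta <= 1,
           forall a, 0 < M a,
           ('E_(plaw Z)[(fun a => M a ^+ 4)%R]
              + 'E_(plaw Z)[(fun a => Z 0 a ^+ 4)%R] <= CZ%:E)%E &
           {ae plaw Z, forall a, forall s t : R, 0 <= s <= 1 -> 0 <= t <= 1 ->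
              `|Z s a - Z t a| <= M a * `|s - t| `^ beta}] &
     hoelder_class gamma L (cov_kernel Z)].

End Processes.

Section Model.
Variable R : realType.

Definition design := forall n p : nat, 'I_n -> 'I_p -> R.

(* [w n p i j k x y h] is the weight w_{i;j,k}(x,y;h). *)
Definition weights :=
  forall n p : nat, 'I_n -> 'I_p -> 'I_p -> R -> R -> R -> R.

Definition design_points (x : design) : Prop :=
  forall n p (i : 'I_n),
    (forall j : 'I_p, 0 <= x n p i j <= 1) /\
    (forall j k : 'I_p, (j < k)%N -> x n p i j < x n p i k).

(* The bound is required down to the scale h = 1/p only: an interval around a
   design point contains a design point however small h is, so that no design
   satisfies it for all h > 0. *)
Definition design_density (x : design) : Prop :=
  exists2 C3 : R, 0 < C3 &
    forall n p (i : 'I_n) (t h : R), 0 <= t <= 1 -> 0 < h -> p%:R^-1 <= h ->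
      #|[pred j : 'I_p | t - h <= x n p i j <= t + h]|%:R <= C3 * p%:R * h.

Definition sum_lt (p : nat) (F : 'I_p -> 'I_p -> R) : R :=
  \sum_(j < p) \sum_(k < p | (j < k)%N) F j k.

Definition weight_conditions (x : design) (w : weights) (zeta : nat)
    (C1 C2 : R) (n p : nat) (i : 'I_n) (h : R) : Prop :=
  [/\ forall u v : R, tri (u, v) ->
        sum_lt (fun j k => w n p i j k u v h) = 1 /\
        forall r1 r2 : nat, (1 <= r1 + r2 <= zeta)%N ->
          sum_lt (fun j k => (x n p i j - u) ^+ r1 * (x n p i k - v) ^+ r2
                             * w n p i j k u v h) = 0,
      forall (u v : R) (j k : 'I_p), tri (u, v) -> (j < k)%N ->
        h < Num.max `|x n p i j - u| `|x n p i k - v| ->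
        w n p i j k u v h = 0,
      forall (u v : R) (j k : 'I_p), tri (u, v) -> (j < k)%N ->
        `|w n p i j k u v h| <= C1 / (p%:R * h) ^+ 2 &
      forall (u v u' v' : R) (j k : 'I_p), tri (u, v) -> tri (u', v') ->
        (j < k)%N ->
        `|w n p i j k u v h - w n p i j k u' v' h| <=
          C2 / (p%:R * h) ^+ 2
          * Num.min (Num.max `|u - u'| `|v - v'| / h) 1].

Definition admissible_weights (x : design) (w : weights) (zeta : nat)
    (c h0 : R) : Prop :=
  exists (C1 C2 : R) (p1 : nat), [/\ 0 < C1, 0 < C2 &
    forall n p (i : 'I_n) (h : R), (p1 <= p)%N -> c / p%:R < h <= h0 ->
      weight_conditions x w zeta C1 C2 p i h].

(* One probability space carrying the n processes, the errors and the
   pre-estimators muhat^{(i)}, i = 1, ..., n. *)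
Record experiment (n p : nat) := Experiment {
  edisp : measure_display;
  espace : measurableType edisp;
  elaw : probability espace R;
  curve : 'I_n -> R -> espace -> R;
  err : 'I_n -> 'I_p -> espace -> R;
  muhat : 'I_n -> R -> espace -> R }.
Arguments curve {n p} E : rename.
Arguments err {n p} E : rename.
Arguments muhat {n p} E : rename.

Section Experiment.
Variables (n p : nat) (E : experiment n p).

Definition iid_copies (Z : process R) : Prop :=
  forall i : 'I_n,
    (forall t : R, 0 <= t <= 1 -> measurable_fun setT (curve E i t)) /\
    forall (m : nat) (t : 'I_m -> R) (B : 'I_m -> set R),
      (forall l, 0 <= t l <= 1) -> (forall l, measurable (B l)) ->
      elaw E (\bigcap_l (curve E i (t l) @^-1` B l)) =
      plaw Z (\bigcap_l (Z (t l) @^-1` B l)).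

(* Mutual independence of the n + n * p sources of randomness: independence of
   the processes, of the errors, and of the former from the latter. *)
Definition sources_independent : Prop :=
  mutually_independent (elaw E)
    (fun s : 'I_n + 'I_n * 'I_p =>
       match s with
       | inl i => sigma_gen (fun t : {t : R | 0 <= t <= 1} =>
                               curve E i (sval t))
       | inr ij => sigma_gen (fun _ : unit => err E ij.1 ij.2)
       end).

Definition error_conditions (sigma2 kappa : R) : Prop :=
  forall (i : 'I_n) (j : 'I_p),
    [/\ measurable_fun setT (err E i j),
        ('E_(elaw E)[err E i j] = 0)%E,
        ('E_(elaw E)[(fun a => err E i j a ^+ 2)%R] <= sigma2%:E)%E &
        forall lambda : R,
          ('E_(elaw E)[(fun a => expR (lambda * err E i j a))%R] <=
           (expR (lambda ^+ 2 * kappa ^+ 2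
             * fine 'E_(elaw E)[(fun a => err E i j a ^+ 2)%R] / 2))%:E)%E].

Variables (mu : R -> R) (x : design).

Definition obs (i : 'I_n) (j : 'I_p) (a : espace E) : R :=
  mu (x i j) + curve E i (x i j) a + err E i j a.

(* muhat^{(i)} is a function of the observations of the curves i' <> i. *)
Definition leave_one_out : Prop :=
  forall (i : 'I_n) (t : R), 0 <= t <= 1 -> forall B : set R, measurable B ->
    sigma_gen (fun q : {q : 'I_n * 'I_p | q.1 != i} =>
                 obs (sval q).1 (sval q).2) (muhat E i t @^-1` B).

Definition independent_of_data : Prop :=
  (forall (i : 'I_n) (t : R), 0 <= t <= 1 -> measurable_fun setT (muhat E i t)) /\
  independent2 (elaw E)
    (sigma_gen (fun q : 'I_n * {t : R | 0 <= t <= 1} =>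
                  muhat E q.1 (sval q.2)))
    (sigma_gen (fun q : 'I_n * 'I_p => obs q.1 q.2)).

Variables (w : weights) (h : R).

Definition gamma_hat_tri (u v : R) (a : espace E) : R :=
  n%:R^-1 * \sum_(i < n) sum_lt (fun j k => w i j k u v h
    * (obs i j a - muhat E i (x i j) a) * (obs i k a - muhat E i (x i k) a)).

Definition gamma_hat (u v : R) (a : espace E) : R :=
  if u <= v then gamma_hat_tri u v a else gamma_hat_tri v u a.

Definition cov_error (Z : process R) (a : espace E) : \bar R :=
  ereal_sup [set `|gamma_hat v.1 v.2 a - cov_kernel Z v|%:E
            | v in [set v : R * R | 0 <= v.1 <= 1 /\ 0 <= v.2 <= 1]].

Definition mean_error (i : 'I_n) (a : espace E) : \bar R :=
  ereal_sup [set `|muhat E i t a - mu t|%:E | t in [set t : R | 0 <= t <= 1]].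

(* The q-th moment of || muhat - mu ||, uniformly over muhat = muhat^{(i)}. *)
Definition mean_risk (q : nat) : \bar R :=
  ereal_sup [set (\int[elaw E]_a (mean_error i a) ^+ q)%E | i in @setT 'I_n].

Variable gamma : R.

Definition rate_leave_one_out : \bar R :=
  maxe (mean_risk 2)
 (maxe (mean_risk 1 * (Num.max (Num.sqrt (ln h^-1 / (p%:R * h))) 1)%:E)%E
 (maxe (h `^ gamma)%:E
 (maxe (Num.sqrt (ln h^-1 / (n%:R * p%:R * h)))%:E
       ((Num.sqrt n%:R)^-1)%:E))).

Definition rate_independent : \bar R :=
  maxe (mean_risk 2)
 (maxe (h `^ gamma)%:E
 (maxe ((1 + sqrte (mean_risk 2))
          * (Num.sqrt (ln h^-1 / (n%:R * p%:R * h)))%:E)%E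
       ((Num.sqrt n%:R)^-1)%:E)).

End Experiment.

(* E[a^{-1} || Gamma_hat - Gamma ||]; the inverse of +oo is 0. *)
Definition scaled_risk (n p : nat) (E : experiment n p) (mu : R -> R)
    (x : design) (w : weights) (h : R) (Z : process R) (rate : \bar R) :
    \bar R :=
  (\int[elaw E]_a (rate^-1 * cov_error mu x w h Z a))%E.

End Model.

(* Main.v *)
Require Import Defs.
From HB Require Import structures.
From mathcomp Require Import all_boot all_order all_algebra.
From mathcomp Require Import all_classical all_reals all_analysis.
From mathcomp Require Import measurable_realfun ring lra zify.
Set Implicit Arguments.
Unset Strict Implicit.
Unset Printing Implicit Defensive.
Import Order.TTheory GRing.Theory Num.Theory.
Import numFieldNormedType.Exports.
Local Open Scope classical_set_scope.
Local Open Scope ring_scope.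

(** Why the theorem holds. Let [b] be the error of the pre-estimation at the
    design points, [W] the sum of the curve and the errors, and [e = W - b]. At a
    point [t] of the triangle the estimator is the mean over the curves of the
    forms with kernel [w] in [e] and [e]. Expanding the product and subtracting
    the smoothed covariance leaves: the centred products of the curves; forms
    linear and quadratic in the errors; the cross terms between [b] and [W]; the
    form in [b] and [b]; and the bias.

    The bias is of order [h `^ gamma] because the weights reproduce the Taylor
    polynomial of the covariance ([kernel_bias]); the expansion is made in the
    interior of the triangle, along an axis-parallel path, and extended to the
    boundary by continuity ([taylor_tri]). The form in [b] and [b] is bounded by the
    mean squared norm of [b], since the kernels have bounded mass ([kernel_mass]).

    All other terms are suprema of random fields over the triangle. Such a
    supremum is bounded by chaining along dyadic grids ([chaining]); the final grid
    is so fine that the weights hardly vary below it ([risk_bound]). A grid and its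
    refinements require two maximal inequalities. For a mean of independent
    centred curves, Nemirovski's inequality is obtained from the softmax potential
    ([softmax_add], [nemirovski]) and needs second moments only. For forms linear
    in the errors with coefficients from the past, the exponential compensated by
    the quadratic variation is a supermartingale ([subgaussian_sum],
    [max_of_exponential]). The quadratic form in the errors is covered too: the
    weights are supported on [j < k], so that the first factor is known before the
    second one is revealed, and the quadratic variation is a sum of squared errors
    over a window, which concentrates ([sqr_windows_mean]).

    The origin of the chaining decides about the logarithms. The products of the
    curves inherit the Hoelder continuity of the paths, with a square-integrable
    constant, at all scales ([kernel_form_hoelder]); the chaining starts at the
    diameter and yields [1 / sqrt n] ([curve_products]). Forms in the errors are
    regular below the bandwidth only, thanks to the weights; the chaining starts
    there with an entropy of order [ln h^-1] and a variance of order
    [1 / (n * p * h)] ([error_terms]). As [h] exceeds [c / p], that entropy is at most of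
    order [ln p] ([start_level_log]), and the growth conditions on [ln p] bound
    its ratio to [n * p * h], and for the second rate make its ratio to [n] of
    order [1 / sqrt n].

    In the cross terms [b] is frozen by Fubini's theorem ([Ex_fubini_le]), which
    requires independence. A pre-estimation independent of the data is frozen as a
    whole, and the cross terms profit from the average over all curves
    ([independent_cross]). Leaving one curve out, the pre-estimation can only be
    frozen for one curve at a time, and a single curve gives the factor
    [sqrt (ln h^-1 / (p * h))] in front of the mean of the norm of [b]
    ([leave_one_out_cross]).

    Suprema over the continuum, as in the error of the covariance and in the risk
    of the pre-estimation, may fail to be measurable. Their integrals are lower
    integrals, hence monotone ([lower_integral_le]), and only compared with those of
    maxima over finite sets. *)

(** * Expectations of nonnegative functions, and freezing of independent variables *)

Section Integral.
Context (d : measure_display) (T : measurableType d) (R : realType).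

(** The integral of a non-measurable function is a lower integral, a supremum
    over the simple functions below it, hence still monotone. *)
Lemma lower_integral_le (mu : {measure set T -> \bar R}) (f g : T -> \bar R) :
  (forall a, 0 <= f a)%E -> (forall a, f a <= g a)%E ->
  (\int[mu]_a f a <= \int[mu]_a g a)%E.
Proof.
move=> f0 fg; have g0 a : (0 <= g a)%E by exact: le_trans (f0 a) (fg a).
rewrite !ge0_integralTE//; apply: le_ereal_sup => _ [h hf <-].
by exists h => // a; exact: le_trans (hf a) (fg a).
Qed.

Context (P : probability T R).
Implicit Types f g : T -> R.

Definition Ex f : \bar R := (\int[P]_a (f a)%:E)%E.

Lemma Ex_ge0 f : (forall a, 0 <= f a) -> (0 <= Ex f)%E.
Proof. by move=> f0; apply: integral_ge0 => a _; rewrite lee_fin. Qed.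

Lemma Ex_le f g : (forall a, 0 <= f a) -> (forall a, f a <= g a) ->
  (Ex f <= Ex g)%E.
Proof. by move=> f0 fg; apply: lower_integral_le => a; rewrite lee_fin. Qed.

Lemma Ex_add f g : (forall a, 0 <= f a) -> (forall a, 0 <= g a) ->
  measurable_fun setT f -> measurable_fun setT g ->
  Ex (fun a => f a + g a) = (Ex f + Ex g)%E.
Proof.
move=> f0 g0 mf mg; rewrite /Ex; under eq_integral do rewrite EFinD.
by apply: ge0_integralD => //; (try by move=> a _; rewrite lee_fin);
  exact/measurable_EFinP.
Qed.

Lemma Ex_scale (k : R) f : 0 <= k -> (forall a, 0 <= f a) ->
  measurable_fun setT f -> Ex (fun a => k * f a) = (k%:E * Ex f)%E.
Proof.
move=> k0 f0 mf; rewrite /Ex; under eq_integral do rewrite EFinM.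
apply: ge0_integralZl_EFin => //; first by move=> a _; rewrite lee_fin.
exact/measurable_EFinP.
Qed.

Lemma Ex_sum (I : Type) (s : seq I) (f : I -> T -> R) :
  (forall i a, 0 <= f i a) -> (forall i, measurable_fun setT (f i)) ->
  Ex (fun a => \sum_(i <- s) f i a) = (\sum_(i <- s) Ex (f i))%E.
Proof.
move=> f0 mf; rewrite /Ex; under eq_integral do rewrite -sumEFin.
apply: ge0_integral_sum => //; last by move=> i a _; rewrite lee_fin.
by move=> i; exact/measurable_EFinP.
Qed.

Lemma Ex_cst (k : R) : Ex (fun=> k) = k%:E.
Proof.
rewrite /Ex integral_cst// [X in (_ * X)%E](_ : _ = 1%E) ?mule1//.
exact: probability_setT.
Qed.

End Integral.

Section Diagonal.
Context (d : measure_display) (T : measurableType d) (R : realType).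
Context (P : probability T R) (G H : set (set T)).
Hypothesis mG : <<s G >> `<=` measurable.
Hypothesis mH : <<s H >> `<=` measurable.
Hypothesis GH : independent2 P <<s G >> <<s H >>.

Let TG := g_sigma_algebraType G.
Let TH := g_sigma_algebraType H.
Let toG : T -> TG := id.
Let toH : T -> TH := id.
Let diag : T -> TG * TH := fun a => (a, a).

Let mtoG : measurable_fun setT toG.
Proof. by move=> _ A mA; rewrite setTI; exact: mG. Qed.

Let mtoH : measurable_fun setT toH.
Proof. by move=> _ A mA; rewrite setTI; exact: mH. Qed.

Let mdiag : measurable_fun setT diag.
Proof. exact: measurable_fun_pair. Qed.

HB.instance Definition _ := @isMeasurableFun.Build _ _ _ _ toG mtoG.
HB.instance Definition _ := @isMeasurableFun.Build _ _ _ _ toH mtoH.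
HB.instance Definition _ := @isMeasurableFun.Build _ _ _ _ diag mdiag.

(** The law of the pair of two independent observers of the same point [a] is
    the product law, so that an expectation along the diagonal can be computed
    with the first argument frozen. *)
Lemma independent_fubini (f : TG * TH -> \bar R) :
  measurable_fun setT f -> (forall z, 0 <= f z)%E ->
  (\int[P]_a f (a, a) = \int[P]_a \int[P]_b f (a, b))%E.
Proof.
move=> mf f0.
have E1 : forall X : set (TG * TH), measurable X ->
    (distribution P toG \x distribution P toH)%E X = distribution P diag X.
  apply: product_measure_unique => A B mA mB.
  by rewrite /distribution /pushforward /=; exact: GH.
transitivity (\int[distribution P diag]_z f z)%E.
  by rewrite ge0_integral_distribution.
transitivity (\int[(distribution P toG \x distribution P toH)%E]_z f z)%E.
  by apply: eq_measure_integral => X mX _; first [exact: E1|exact: esym (E1 X mX)].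
rewrite fubini_tonelli1// ge0_integral_distribution//; last 2 first.
- exact: measurable_fun_fubini_tonelli_F.
- by move=> y; apply: integral_ge0.
apply: eq_integral => a _; rewrite /fubini_F /= ge0_integral_distribution//.
by apply: measurableT_comp => //; exact: measurable_pair1.
Qed.

End Diagonal.

(** * Independence of disjoint groups of sources *)

Section PiSystem.
Context (d : measure_display) (T : measurableType d) (R : realType).
Context (P : probability T R).

Lemma independent_of_pi_system (G : set (set T)) (Y : set T) :
  G `<=` measurable -> setI_closed G -> G setT -> measurable Y ->
  (forall X, G X -> P (X `&` Y) = (P X * P Y)%E) ->
  forall X, <<s G >> X -> P (X `&` Y) = (P X * P Y)%E.
Proof.
move=> mG GI GT mY GY X sX.
have PY : P Y = (fine (P Y))%:E by rewrite fineK// fin_num_measure.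
have PY0 : 0 <= fine (P Y) by rewrite fine_ge0.
have := @g_sigma_algebra_measure_unique _ _ _ G mG (fun=> setT) (fun=> GT)
  _ (mrestr P mY) (mscale (NngNum PY0) P) GI _ _ X sX.
rewrite /mrestr /mscale /= => H; rewrite [RHS]muleC [in RHS]PY; apply: H.
- by rewrite bigcup_const.
- by move=> A GA; have := GY A GA; rewrite muleC [in X in _ = X -> _]PY.
- move=> _; apply: (@le_lt_trans _ _ 1%E); last exact: ltry.
  by apply: probability_le1; exact: measurableI.
Qed.

Lemma independent2_pi_system (G H : set (set T)) :
  G `<=` measurable -> setI_closed G -> G setT ->
  H `<=` measurable -> setI_closed H -> H setT ->
  independent2 P G H -> independent2 P <<s G >> <<s H >>.
Proof.
move=> mG GI GT mH HI HT GH X Y sX sY.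
have sm K : K `<=` measurable -> <<s K >> `<=` @measurable _ T.
  by move=> mK; apply: smallest_sub => //; exact: sigma_algebra_measurable.
apply: (independent_of_pi_system mG) => // [|X' GX'].
  exact: sm sY.
rewrite setIC muleC; apply: (independent_of_pi_system mH) => //; first exact: mG.
by move=> Y' HY'; rewrite setIC muleC; exact: GH.
Qed.

Lemma independent2_sub (G H G' H' : set (set T)) :
  independent2 P G H -> G' `<=` G -> H' `<=` H -> independent2 P G' H'.
Proof. by move=> GH G'G H'H X Y /G'G GX /H'H HY; exact: GH. Qed.

End PiSystem.

Section Sources.
Context (d : measure_display) (T : measurableType d) (R : realType).
Context (P : probability T R) (S : finType) (G : S -> set (set T)).
Hypothesis sG : forall s, sigma_algebra setT (G s).
Hypothesis mG : forall s, G s `<=` measurable.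
Hypothesis indG : mutually_independent P G.

(** Only generators: the union is not a sigma-algebra. *)
Definition sources (A : {set S}) : set (set T) := \bigcup_(s in [set` A]) G s.

Lemma sources_measurable A : <<s sources A >> `<=` measurable.
Proof.
apply: smallest_sub; first exact: sigma_algebra_measurable.
by move=> X [s _]; exact: mG.
Qed.

Lemma sources_mono (A B : {set S}) : A \subset B -> <<s sources A >> `<=` <<s sources B >>.
Proof.
move=> /fintype.subsetP AB; apply: sub_sigma_algebra2.
by move=> X [s /= sA GX]; exists s => //=; exact: AB.
Qed.

Let cyl (A : {set S}) : set (set T) :=
  [set X | exists2 E : S -> set T, (forall s, s \in A -> G s (E s)) &
     X = \bigcap_(s in [set` A]) E s].

Let GT s : G s setT.
Proof. by have [G0 GC _] := sG s; rewrite -(setD0 setT); exact: GC. Qed.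

Let GIc s : setI_closed (G s).
Proof.
have [G0 GC GU] := sG s; move=> X Y GX GY.
rewrite -[X `&` Y]setCK setCI -[~` _ `|` _](@bigcup2E T) -setTD.
apply: (GC); apply: GU => -[|[|n]]; rewrite /bigcup2 //=; rewrite -setTD; exact: GC.
Qed.

Let cyl_measurable A : cyl A `<=` measurable.
Proof.
move=> _ [E GE ->]; apply: fin_bigcap_measurable.
  exact: finite_finset.
by move=> s sA; apply: mG; exact: GE.
Qed.

Let cylI A : setI_closed (cyl A).
Proof.
move=> _ _ [E GE ->] [F GF ->]; exists (fun s => E s `&` F s).
  by move=> s sA; apply: GIc; [exact: GE|exact: GF].
by rewrite bigcapI.
Qed.

Let cylT A : cyl A setT.
Proof. by exists (fun=> setT) => // ; rewrite bigcapT. Qed.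

Let sources_cyl A : sources A `<=` cyl A.
Proof.
move=> X [s /= sA GX]; exists (fun r => if r == s then X else setT).
  by move=> r _; case: eqP => [->|_].
apply/seteqP; split=> [a Xa r /= rA|a /(_ s sA)]; last by rewrite eqxx.
by case: eqP.
Qed.

(** Disjoint groups of sources are independent: the cylinders over each group
    form a pi-system on which the product rule is the hypothesis. *)
Lemma sources_independent2 (A B : {set S}) :
  (forall s, s \in A -> s \notin B) ->
  independent2 P <<s sources A >> <<s sources B >>.
Proof.
move=> AB.
have cylind : independent2 P (cyl A) (cyl B).
  move=> _ _ [E GE ->] [F GF ->].
  pose K s := if s \in A then E s else F s.
  have KA : \bigcap_(s in [set` A]) E s = \bigcap_(s in [set` A]) K s.
    by apply: eq_bigcapr => s /= sA; rewrite /K sA.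
  have BA s : s \in B -> s \notin A.
    by move=> sB; apply: contraL sB; exact: AB.
  have KB : \bigcap_(s in [set` B]) F s = \bigcap_(s in [set` B]) K s.
    by apply: eq_bigcapr => s /= /BA sA; rewrite /K (negbTE sA).
  have GK s : s \in (A :|: B)%SET -> G s (K s).
    rewrite inE /K; case: ifPn => [sA _|sA /= sB]; first exact: GE.
    exact: GF.
  have -> : (\bigcap_(s in [set` A]) E s) `&` (\bigcap_(s in [set` B]) F s) =
            \bigcap_(s in [set` (A :|: B)%SET]) K s.
    rewrite KA KB -bigcap_setU; congr (\bigcap_(s in _) K s).
    by apply/seteqP; split=> s /=; rewrite inE => /orP.
  rewrite KA KB indG// indG => [|s sA]; last by apply: GK; rewrite inE sA.
  rewrite indG => [|s sB]; last by apply: GK; rewrite inE sB orbT.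
  rewrite (eq_bigl [predU A & B]) ?bigU//=.
    by rewrite disjoint_subset; apply/fintype.subsetP => s; exact: AB.
  by move=> s; rewrite !inE.
have sub C : <<s sources C >> `<=` <<s cyl C >>.
  by apply: sub_sigma_algebra2; exact: sources_cyl.
apply: (@independent2_sub _ _ _ P _ _ _ _ _ (sub A) (sub B)).
exact: independent2_pi_system.
Qed.

End Sources.

(** * The softmax potential *)

Section Softmax.
Context (R : realType).
Implicit Types (x y z : R).

Lemma expR_le_quad x : x <= 1 -> expR x <= 1 + x + 2 * x ^+ 2.
Proof.
move=> x1; have [x0|x0] := leP x 0.
  have h := expR_ge1Dx (- x); have p := expR_gt0 x.
  have := expRxMexpNx_1 x.
  move=> E; have : expR x * (1 - x) <= 1 by rewrite -[leRHS]E ler_pM2l.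
  move=> H; have : (1 - x) * (1 + x + 2 * x ^+ 2) >= 1.
    have -> : (1 - x) * (1 + x + 2 * x ^+ 2) = 1 + x ^+ 2 * (1 - 2 * x) by ring.
    by rewrite lerDl mulr_ge0 ?sqr_ge0//; lra.
  move=> H2; have q0 : 0 < 1 - x by lra.
  by rewrite -(ler_pM2l q0) [leLHS]mulrC (le_trans H).
have h := expR_ge1Dx (- (x / 2)); have p := expR_gt0 (x / 2).
have := expRxMexpNx_1 (x / 2).
set u := expR (x / 2) in p *; set v := expR _ in h *; move=> E.
have -> : expR x = u ^+ 2 by rewrite expr2 -expRD; congr expR; field.
have uv : u * (1 - x / 2) <= 1 by rewrite -[leRHS]E ler_pM2l//; lra.
have q0 : 0 < 1 - x / 2 by lra.
have : u ^+ 2 * (1 - x / 2) ^+ 2 <= 1.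
  by rewrite -exprMn expr_le1// mulr_ge0// ltW.
have : (1 - x / 2) ^+ 2 * (1 + x + 2 * x ^+ 2) >= 1.
  have -> : (1 - x / 2) ^+ 2 * (1 + x + 2 * x ^+ 2) =
    1 + x ^+ 2 * ((1 - x) * (5 - 2 * x) / 4) by field.
  by rewrite lerDl mulr_ge0 ?sqr_ge0// mulr_ge0 ?mulr_ge0//; lra.
move=> H1 H2; rewrite -(@ler_pM2r _ ((1 - x / 2) ^+ 2)) ?exprn_gt0//.
by rewrite (le_trans H2)// [leRHS]mulrC.
Qed.

(** An exponential exceeds its linear part by no more than a Gaussian factor,
    without any restriction on the size of [x]. *)
Lemma expR_le_gauss x : expR x <= x + expR (2 * x ^+ 2).
Proof.
have h := expR_ge1Dx (2 * x ^+ 2).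
have [x1|x1] := leP x 1; first by have := expR_le_quad x1; lra.
have : expR x <= expR (2 * x ^+ 2) by rewrite ler_expR; nra.
lra.
Qed.

(** A crude form of Hoeffding's lemma: after centring, the first-order term of
    [expR_le_gauss] averages to zero. *)
Lemma hoeffding_finite (J : finType) (p y : J -> R) (B : R) :
  (forall j, 0 <= p j) -> \sum_j p j = 1 -> (forall j, `|y j| <= B) ->
  \sum_j p j * expR (y j) <= expR (\sum_j p j * y j + 8 * B ^+ 2).
Proof.
move=> p0 p1 yB; set m := \sum_j p j * y j.
have mB : `|m| <= B.
  rewrite (le_trans (ler_norm_sum _ _ _))//.
  rewrite [leRHS](_ : B = \sum_j p j * B); last by rewrite -mulr_suml p1 mul1r.
  by apply: ler_sum => j _; rewrite normrM ger0_norm// ler_wpM2l.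
have e j : expR (y j) = expR m * expR (y j - m).
  by rewrite -expRD addrC subrK.
under eq_bigr do rewrite e mulrCA; rewrite -mulr_sumr expRD ler_pM2l ?expR_gt0//.
have -> : expR (8 * B ^+ 2) = \sum_j p j * (y j - m + expR (8 * B ^+ 2)).
  under eq_bigr do rewrite !mulrDr mulrN; rewrite !big_split/= sumrN.
  by rewrite -!mulr_suml p1 !mul1r subrr add0r.
apply: ler_sum => j _; rewrite ler_wpM2l// (le_trans (expR_le_gauss _))//.
rewrite lerD2l ler_expR (_ : 8 * B ^+ 2 = 2 * (B + B) ^+ 2); last by ring.
rewrite ler_wpM2l// -real_normK ?num_real// ler_pXn2r ?nnegrE ?normr_ge0//.
  by rewrite (le_trans (ler_normB _ _))// lerD.
by have := le_trans (normr_ge0 _) mB; lra.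
Qed.

Variable I : finType.
Implicit Types u v : I -> R.

(** A smooth majorant of the maximum of the absolute values, whence both signs. *)
Definition softmax u : R := ln (\sum_s (expR (u s) + expR (- u s))).

Let two u s : 2 <= expR (u s) + expR (- u s).
Proof. by have := expR_ge1Dx (u s); have := expR_ge1Dx (- u s); lra. Qed.

Let sum_ge u s : expR (u s) + expR (- u s)
  <= \sum_s (expR (u s) + expR (- u s)).
Proof.
by rewrite (bigD1 s)//= lerDl sumr_ge0// => t _; rewrite addr_ge0 ?expR_ge0.
Qed.

Lemma softmax_ge u s : `|u s| <= softmax u.
Proof.
have Z0 : 0 < \sum_s (expR (u s) + expR (- u s)).
  by apply: lt_le_trans (sum_ge u s); have := two u s; lra.
rewrite -[leLHS]expRK /softmax ler_ln ?posrE ?expR_gt0//.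
apply: le_trans (sum_ge u s).
have [u0|u0] := leP 0 (u s).
  by rewrite ger0_norm// lerDl expR_ge0.
by rewrite ltr0_norm// lerDr expR_ge0.
Qed.

Lemma softmax_0 : (0 < #|I|)%N -> softmax (fun=> 0) = ln (2 * #|I|%:R).
Proof.
move=> I0; rewrite /softmax oppr0 expR0 big_const iter_addr addr0.
by rewrite -mulr_natr; congr ln; ring.
Qed.

Definition softmax_grad u s : R :=
  (expR (u s) - expR (- u s)) / \sum_s (expR (u s) + expR (- u s)).

(** The Hessian of the softmax in a direction [v] is at most the square of the
    supremum norm of [v], however many coordinates there are. *)
Lemma softmax_add u v (B : R) : (0 < #|I|)%N -> (forall s, `|v s| <= B) ->
  softmax (fun s => u s + v s)
    <= softmax u + \sum_s softmax_grad u s * v s + 8 * B ^+ 2.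
Proof.
move=> /card_gt0P[s0 _] vB; rewrite /softmax.
set Z := \sum_s (expR (u s) + expR (- u s)).
have Z0 : 0 < Z by apply: lt_le_trans (sum_ge u s0); have := two u s0; lra.
have W0 : 0 < \sum_s (expR (u s + v s) + expR (- (u s + v s))).
  apply: lt_le_trans (sum_ge (fun s => u s + v s) s0).
  by have := two (fun s => u s + v s) s0; rewrite /=; lra.
pose p (j : I * bool) := expR (if j.2 then u j.1 else - u j.1) / Z.
pose y (j : I * bool) := if j.2 then v j.1 else - v j.1.
have big2 (g : I * bool -> R) : \sum_j g j = \sum_s (g (s, true) + g (s, false)).
  have -> : \sum_j g j = \sum_s \sum_(b : bool) g (s, b).
    by rewrite pair_bigA; apply: eq_bigr => -[].
  by apply: eq_bigr => s _; rewrite big_bool.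
have p1 : \sum_j p j = 1.
  rewrite big2 /p /=; under eq_bigr do rewrite -mulrDl.
  by rewrite -mulr_suml mulfV// gt_eqF.
have := @hoeffding_finite _ p y B _ p1 _.
rewrite !big2 /p /y /=; move=> H.
rewrite -addrA -[X in _ <= _ + X]expRK -lnM ?posrE ?expR_gt0// ler_ln ?posrE//.
  have -> : \sum_s (expR (u s + v s) + expR (- (u s + v s))) =
    Z * \sum_s (expR (u s) / Z * expR (v s) + expR (- u s) / Z * expR (- v s)).
    rewrite mulr_sumr; apply: eq_bigr => s _; rewrite opprD !expRD.
    by field; rewrite gt_eqF.
  rewrite ler_pM2l//; apply: le_trans (H _ _) _.
  - by move=> j; rewrite divr_ge0// ?expR_ge0// ltW.
  - by move=> [s []]/=; rewrite ?normrN.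
  rewrite ler_expR lerD2r le_eqVlt; apply/orP; left; apply/eqP.
  apply: eq_bigr => s _; rewrite /softmax_grad -/Z.
  by field; rewrite gt_eqF.
by rewrite mulr_gt0 ?expR_gt0.
Qed.

End Softmax.

(** * Maximal inequalities along a filtration *)

Section MeasurableWrt.
Context (d : measure_display) (T : measurableType d) (R : realType).
Implicit Types (G H K : set (set T)) (f : T -> R).

Definition measurable_wrt G f :=
  measurable_fun [set: g_sigma_algebraType G] (f : g_sigma_algebraType G -> R).

(** Joint measurability in two copies of the same point, one observed through
    [G] and the other through [H]. *)
Definition measurable_wrt2 G H (f : T -> T -> R) :=
  measurable_fun [set: g_sigma_algebraType G * g_sigma_algebraType H]
    (fun z : g_sigma_algebraType G * g_sigma_algebraType H => f z.1 z.2).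

Lemma measurable_wrt_sub G H f : <<s G >> `<=` <<s H >> ->
  measurable_wrt G f -> measurable_wrt H f.
Proof. by move=> GH mf mT B mB; apply: GH; exact: mf. Qed.

Lemma measurable_wrt_fun G f : <<s G >> `<=` measurable ->
  measurable_wrt G f -> measurable_fun setT f.
Proof. by move=> GH mf mT B mB; apply: GH; exact: mf. Qed.

Lemma measurable_wrt2_l G H f :
  measurable_wrt G f -> measurable_wrt2 G H (fun a _ => f a).
Proof. by move=> mf; exact: measurableT_comp mf measurable_fst. Qed.

Lemma measurable_wrt2_r G H f :
  measurable_wrt H f -> measurable_wrt2 G H (fun _ b => f b).
Proof. by move=> mf; exact: measurableT_comp mf measurable_snd. Qed.

Lemma measurable_wrt2_diag G H K y : <<s G >> `<=` <<s K >> ->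
  <<s H >> `<=` <<s K >> -> measurable_wrt2 G H y ->
  measurable_wrt K (fun a => y a a).
Proof.
move=> GK HK mf.
pose diag (a : g_sigma_algebraType K) :
  g_sigma_algebraType G * g_sigma_algebraType H := (a, a).
have mdiag : measurable_fun setT diag.
  by apply: measurable_fun_pair => mT B mB; rewrite setTI;
    [exact: GK|exact: HK].
exact: measurableT_comp mf mdiag.
Qed.

Lemma measurable_wrt2_slice G H y a :
  measurable_wrt2 G H y -> measurable_wrt H (y a).
Proof.
move=> mf.
exact: (measurableT_comp mf (@measurable_pair1 _ _
  (g_sigma_algebraType G) (g_sigma_algebraType H) a)).
Qed.

Lemma measurable_bigmax d' (U : measurableType d') (I : Type) (r : seq I)
    (p : pred I) (h : I -> U -> R) : (forall i, measurable_fun setT (h i)) ->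
  measurable_fun setT (fun a => \big[Num.max/0]_(i <- r | p i) h i a).
Proof.
move=> mh; elim: r => [|i r IH].
  by under eq_fun do rewrite big_nil; exact: measurable_cst.
under eq_fun do rewrite big_cons; case: (p i) => //.
exact: measurable_maxr.
Qed.

Lemma measurable_sum_pred d' (U : measurableType d') (I : Type) (r : seq I)
    (p : pred I) (h : I -> U -> R) : (forall i, measurable_fun setT (h i)) ->
  measurable_fun setT (fun a => \sum_(i <- r | p i) h i a).
Proof.
move=> mh; under eq_fun do rewrite big_mkcond.
by apply: measurable_sum => i; case: (p i) => //; exact: measurable_cst.
Qed.

Lemma measurable_norm d' (U : measurableType d') (f : U -> R) :
  measurable_fun setT f -> measurable_fun setT (fun a => `|f a|).
Proof. by move=> mf; exact: measurableT_comp. Qed.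

Lemma measurable_opp d' (U : measurableType d') (f : U -> R) :
  measurable_fun setT f -> measurable_fun setT (fun a => - f a).
Proof. by move=> mf; exact: measurableT_comp. Qed.

Lemma measurable_exp d' (U : measurableType d') (f : U -> R) :
  measurable_fun setT f -> measurable_fun setT (fun a => expR (f a)).
Proof. by move=> mf; exact: measurableT_comp. Qed.

End MeasurableWrt.

Ltac meas := repeat first
  [ assumption
  | match goal with H : forall i, measurable_fun _ _ |- _ => solve [exact: H] end
  | match goal with H : forall i j, measurable_fun _ _ |- _ => solve [exact: H] end
  | exact: measurable_cst
  | match goal with |- measurable_fun _ (fun _ => ?e) => exact: (@measurable_cst _ _ _ _ e) end
  | apply: measurable_funD | apply: measurable_funM | apply: measurable_funB
  | apply: measurable_opp | apply: measurable_norm | apply: measurable_exp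
  | apply: measurable_maxr
  | apply: measurable_funX
  | apply: measurable_sum_pred => ? | apply: measurable_bigmax => ?
  | solve [auto] ].

Section Filtration.
Context (d : measure_display) (T : measurableType d) (R : realType).
Context (P : probability T R).

Lemma Ex_fubini (G H : set (set T)) (f : T -> T -> R) :
  <<s G >> `<=` measurable -> <<s H >> `<=` measurable ->
  independent2 P <<s G >> <<s H >> ->
  measurable_wrt2 G H f -> (forall a b, 0 <= f a b) ->
  Ex P (fun a => f a a) = (\int[P]_a Ex P (f a))%E.
Proof.
move=> mG mH GH mf f0.
apply: (independent_fubini mG mH GH (f := fun z => (f z.1 z.2)%:E)).
  exact/measurable_EFinP.
by move=> z; rewrite lee_fin.
Qed.

Lemma Ex_fubini_le (G H : set (set T)) (f : T -> T -> R) (g : T -> R) :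
  <<s G >> `<=` measurable -> <<s H >> `<=` measurable ->
  independent2 P <<s G >> <<s H >> ->
  measurable_wrt2 G H f -> (forall a b, 0 <= f a b) ->
  (forall a, Ex P (f a) <= (g a)%:E)%E -> (Ex P (fun a => f a a) <= Ex P g)%E.
Proof.
move=> mG mH GH mf f0 fg; rewrite (Ex_fubini mG mH GH)//.
by apply: lower_integral_le => // a; exact: Ex_ge0.
Qed.

(** The past [F] grows by the innovations [e], both given by generators. *)
Definition filtration (F e : nat -> set (set T)) (N : nat) :=
  forall k, (k < N)%N ->
  [/\ <<s F k >> `<=` measurable, <<s e k >> `<=` measurable,
      independent2 P <<s F k >> <<s e k >>,
      <<s F k >> `<=` <<s F k.+1 >> & <<s e k >> `<=` <<s F k.+1 >> ].

Variables (F e : nat -> set (set T)) (N : nat).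
Hypothesis FeN : filtration F e N.

Lemma supermartingale (y : nat -> T -> T -> R) :
  (forall k a b, 0 <= y k a b) ->
  (forall k, (k < N)%N -> measurable_wrt2 (F k) (e k) (y k)) ->
  (forall k a, (k < N)%N -> (Ex P (y k a) <= 1)%E) ->
  (Ex P (fun a => \prod_(k < N) y k a a)%R <= 1)%E.
Proof.
move=> y0 my y1.
suff H m : (m <= N)%N -> measurable_wrt (F m) (fun a => \prod_(k < m) y k a a) /\
    (Ex P (fun a => \prod_(k < m) y k a a)%R <= 1)%E by have [] := H N (leqnn N).
elim: m => [_|m IH mN].
  under eq_fun do rewrite big_ord0.
  by split; [exact: measurable_cst|rewrite Ex_cst].
have [mm le1] := IH (ltnW mN); have [mF me ind FF eF] := FeN mN.
under eq_fun do rewrite big_ord_recr /=.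
pose f a b := (\prod_(k < m) y k a a) * y m a b.
have prod0 a : 0 <= \prod_(k < m) y k a a by rewrite prodr_ge0.
have mf : measurable_wrt2 (F m) (e m) f.
  apply: measurable_funM; last exact: my mN.
    exact: (measurable_wrt2_l (H := e m) mm).
split; first exact: measurable_wrt2_diag mf.
apply: le_trans le1; apply: (Ex_fubini_le mF me ind mf).
  by move=> a b; rewrite mulr_ge0.
move=> a; rewrite Ex_scale//; last first.
  exact: measurable_wrt_fun me (measurable_wrt2_slice a (my _ mN)).
rewrite -[leRHS]mule1; apply: lee_wpmul2l; rewrite ?lee_fin//.
exact: y1.
Qed.

Variables (I : finType).
Hypothesis I0 : (0 < #|I|)%N.

Lemma measurable_softmax d' (U : measurableType d') (h : I -> U -> R) :
  (forall s, measurable_fun setT (h s)) ->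
  measurable_fun setT (fun a => softmax (fun s => h s a)).
Proof.
move=> mh; apply: measurableT_comp; first exact: measurable_ln.
by meas.
Qed.


(** If the exponential moments of every coordinate, compensated by a common
    random [v], are at most one, the maximum costs only the logarithm of the
    number of coordinates; [v] is allowed to be random because only its mean
    enters. *)
Lemma max_of_exponential (X : I -> T -> R) (v : T -> R) (lam : R) :
  0 < lam -> (forall s, measurable_fun setT (X s)) -> measurable_fun setT v ->
  (forall a, 0 <= v a) ->
  (forall s, (Ex P (fun a => expR (lam * X s a - v a))%R <= 1)%E) ->
  (forall s, (Ex P (fun a => expR (- (lam * X s a) - v a))%R <= 1)%E) ->
  (Ex P (fun a => \big[Num.max/0]_s `|X s a|)%R <=
    (lam^-1)%:E * (Ex P v + (ln (2 * #|I|%:R) + 1)%:E))%E.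
Proof.
move=> lam0 mX mv v0 ep en; set K : R := 2 * #|I|%:R.
have K0 : 0 < K by rewrite mulr_gt0// ltr0n.
have lnK0 : 0 <= ln K.
  by rewrite ln_ge0// /K -natrM ler1n muln_gt0.
pose w a := \sum_s (expR (lam * X s a - v a) + expR (- (lam * X s a) - v a)).
have w0 a : 0 <= w a by rewrite sumr_ge0// => s _; rewrite addr_ge0// expR_ge0.
have mw : measurable_fun setT w by rewrite /w; meas.
have Ew : (Ex P w <= K%:E)%E.
  rewrite /w Ex_sum; last by move=> s; meas.
    have -> : K = \sum_(s : I) (1 + 1) by rewrite /K sumr_const mulr_natr.
    rewrite -sumEFin; apply: lee_sum => s _.
    rewrite Ex_add; [|by move=> a; exact: expR_ge0..|by meas|by meas].
    by rewrite EFinD leeD.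
  by move=> s a; rewrite addr_ge0// expR_ge0.
have tang y : y <= ln K + expR y / K.
  have := expR_ge1Dx (y - ln K); rewrite expRB lnK ?posrE//; lra.
have bound a : \big[Num.max/0]_s `|X s a| <=
    lam^-1 * (v a + (ln K + K^-1 * w a)).
  apply: bigmax_le => [|s _].
    rewrite mulr_ge0 ?invr_ge0 ?(ltW lam0)// addr_ge0// addr_ge0// mulr_ge0//.
    by rewrite invr_ge0 ltW.
  rewrite -(ler_pM2l lam0) mulrA mulfV ?gt_eqF// mul1r -lerBlDl.
  apply: le_trans (tang _) _; rewrite lerD2l mulrC ler_wpM2l ?invr_ge0 ?(ltW K0)//.
  rewrite /w (bigD1 s)//=.
  apply: (@le_trans _ _ (expR (lam * X s a - v a) + expR (- (lam * X s a) - v a))).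
    have [x0|x0] := leP 0 (X s a).
      by rewrite ger0_norm// lerDl expR_ge0.
    by rewrite ltr0_norm// mulrN lerDr expR_ge0.
  rewrite lerDl sumr_ge0// => t _; by rewrite addr_ge0// expR_ge0.
have max0 a : 0 <= \big[Num.max/0]_s `|X s a| by rewrite bigmax_ge_id.
apply: le_trans (Ex_le P max0 bound) _.
have g0 a : 0 <= ln K + K^-1 * w a by rewrite addr_ge0// mulr_ge0// invr_ge0 ltW.
have mg : measurable_fun setT (fun a => ln K + K^-1 * w a) by meas.
rewrite Ex_scale ?invr_ge0 ?(ltW lam0)//; [|by move=> a; rewrite addr_ge0|by meas].
apply: lee_wpmul2l; rewrite ?lee_fin ?invr_ge0 ?(ltW lam0)//.
rewrite Ex_add// leeD2l// Ex_add//; [|by move=> a; rewrite mulr_ge0// invr_ge0 ltW|by meas].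
rewrite Ex_cst EFinD leeD2l// Ex_scale ?invr_ge0 ?(ltW K0)//.
apply: (@le_trans _ _ ((K^-1)%:E * K%:E)%E).
  by apply: lee_wpmul2l; rewrite ?lee_fin ?invr_ge0 ?(ltW K0).
by rewrite -EFinM mulVf ?gt_eqF.
Qed.

(** Nemirovski's inequality: along independent centred steps the softmax gains
    in mean only the second-order term of [softmax_add]. *)
Lemma nemirovski (xi : nat -> I -> T -> R) (f : nat -> T -> R) (V : nat -> R)
    (lam : R) : 0 < lam ->
  (forall k s, (k < N)%N -> measurable_wrt (e k) (xi k s)) ->
  (forall k, (k < N)%N -> measurable_fun setT (f k)) ->
  (forall k s a, (k < N)%N -> `|xi k s a| <= f k a) ->
  (forall k s, (k < N)%N -> P.-integrable setT (fun a => (xi k s a)%:E) /\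
     \int[P]_a (xi k s a)%:E = 0)%E ->
  (forall k, (k < N)%N -> (Ex P (fun a => f k a ^+ 2)%R <= (V k)%:E)%E) ->
  (Ex P (fun a => \big[Num.max/0]_s `|\sum_(k < N) xi k s a|)%R <=
    (ln (2 * #|I|%:R) / lam + 8 * lam * \sum_(k < N) V k)%:E)%E.
Proof.
move=> lam0 mxi mf xif xi0 fV.
pose S m s a := lam * \sum_(k < m) xi k s a.
have lnK0 : 0 <= ln (2 * #|I|%:R : R).
  by rewrite ln_ge0// -natrM ler1n muln_gt0.
have card : exists s : I, true by case/card_gt0P: I0 => s _; exists s.
have sm0 u : 0 <= softmax (u : I -> R).
  by have [s _] := card; exact: le_trans (normr_ge0 _) (softmax_ge u s).
suff H m : (m <= N)%N ->
    (forall s, measurable_wrt (F m) (S m s)) /\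
    (Ex P (fun a => softmax (fun s => S m s a)) <=
      (ln (2 * #|I|%:R) + 8 * lam ^+ 2 * \sum_(k < m) V k)%:E)%E.
  have [mS HN] := H N (leqnn N).
  have mS' s : measurable_fun setT (S N s).
    apply: measurable_funM; first exact: measurable_cst.
    apply: measurable_sum => k; have [_ mek _ _ _] := FeN (ltn_ord k).
    by apply: measurable_wrt_fun mek _; exact: mxi.
  apply: (@le_trans _ _ (Ex P (fun a => lam^-1 * softmax (fun s => S N s a)))).
    apply: Ex_le => a; first by rewrite bigmax_ge_id.
    apply: bigmax_le => [|s _]; first by rewrite mulr_ge0// invr_ge0 ltW.
    rewrite -(ler_pM2l lam0) mulrA mulfV ?gt_eqF// mul1r.
    apply: le_trans (softmax_ge _ s).
    by rewrite /S normrM (gtr0_norm lam0).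
  rewrite Ex_scale ?invr_ge0 ?(ltW lam0)//; last exact: measurable_softmax.
  apply: (@le_trans _ _ ((lam^-1)%:E *
      (ln (2 * #|I|%:R) + 8 * lam ^+ 2 * \sum_(k < N) V k)%:E)%E).
    by apply: lee_wpmul2l; rewrite ?lee_fin ?invr_ge0 ?(ltW lam0).
  rewrite -EFinM lee_fin le_eqVlt; apply/orP; left; apply/eqP.
  by field; rewrite gt_eqF.
elim: m => [_|m IH mN].
  split=> [s|].
    by rewrite /S; under eq_fun do rewrite big_ord0 mulr0; exact: measurable_cst.
  rewrite (_ : (fun a => _) = fun=> ln (2 * #|I|%:R)); last first.
    apply/funext => a; rewrite -softmax_0//; congr softmax; apply/funext => s.
    by rewrite /S big_ord0 mulr0.
  by rewrite Ex_cst lee_fin big_ord0 mulr0 addr0.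
have [mS le1] := IH (ltnW mN); have [mF me ind FF eF] := FeN mN.
have SE s a : S m.+1 s a = S m s a + lam * xi m s a.
  by rewrite /S big_ord_recr/= mulrDr.
pose g a b := softmax (fun s => S m s a + lam * xi m s b).
have mg2 s : measurable_wrt2 (F m) (e m) (fun a b => S m s a + lam * xi m s b).
  apply: measurable_funD; first exact: (measurable_wrt2_l (H := e m) (mS s)).
  apply: measurable_funM; first exact: measurable_cst.
  exact: (measurable_wrt2_r (G := F m) (mxi m s mN)).
split=> [s|].
  rewrite (_ : S m.+1 s = fun a => S m s a + lam * xi m s a).
    exact: (measurable_wrt2_diag FF eF (mg2 s)).
  by apply/funext => a; exact: SE.
rewrite (_ : (fun a => softmax (fun s => S m.+1 s a)) = fun a => g a a); last first.
  by apply/funext => a; congr softmax; apply/funext => s; exact: SE.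
have mg : measurable_wrt2 (F m) (e m) g by exact: measurable_softmax.
have mxi' s : measurable_fun setT (xi m s).
  exact: measurable_wrt_fun me (mxi m s mN).
have Vm0 : 0 <= V m.
  rewrite -lee_fin; apply: le_trans (fV _ mN).
  by apply: Ex_ge0 => a; rewrite sqr_ge0.
have mfm := mf m mN.
have step a : (Ex P (g a) <=
    (softmax (fun s => S m s a) + 8 * lam ^+ 2 * V m)%:E)%E.
  pose q := softmax_grad (fun s => S m s a).
  pose c s := q s * lam.
  pose l b := \sum_s c s * xi m s b.
  pose r b := softmax (fun s => S m s a) + 8 * lam ^+ 2 * f m b ^+ 2.
  have r0 b : 0 <= r b by rewrite addr_ge0// mulr_ge0 ?sqr_ge0// mulr_ge0 ?sqr_ge0.
  have mr : measurable_fun setT r by rewrite /r; meas.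
  have Er : (Ex P r <= (softmax (fun s => S m s a) + 8 * lam ^+ 2 * V m)%:E)%E.
    rewrite /r Ex_add//; [|by move=> b; rewrite mulr_ge0 ?sqr_ge0// mulr_ge0 ?sqr_ge0|by meas].
    rewrite Ex_cst EFinD leeD2l// Ex_scale; [|by rewrite mulr_ge0 ?sqr_ge0|by move=> b; rewrite sqr_ge0|by meas].
    rewrite [leRHS]EFinM; apply: lee_wpmul2l; first by rewrite lee_fin mulr_ge0 ?sqr_ge0.
    exact: fV.
  have gle b : g a b <= l b + r b.
    have vb s : `|lam * xi m s b| <= lam * f m b.
      by rewrite normrM (gtr0_norm lam0) ler_pM2l// xif.
    apply: le_trans (softmax_add _ I0 vb) _.
    rewrite /r /l addrA [X in _ <= X + _]addrC exprMn mulrA -addrA.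
    rewrite -[leRHS]addrA lerD2l lerD2r; apply: ler_sum => s _.
    by rewrite /c mulrA.
  have il : P.-integrable setT (fun b => (l b)%:E).
    rewrite /l; under eq_fun do rewrite -sumEFin.
    apply: integrable_sum => // s _; under eq_fun do rewrite EFinM.
    apply: integrableZl => //; by have [] := xi0 m s mN.
  have El : (\int[P]_b (l b)%:E = 0)%E.
    rewrite /l; under eq_integral do rewrite -sumEFin.
    rewrite integral_sum//; last first.
      move=> s; under eq_fun do rewrite EFinM.
      apply: integrableZl => //; by have [] := xi0 m s mN.
    apply: big1 => s _; under eq_integral do rewrite EFinM.
    rewrite integralZl//; last by have [] := xi0 m s mN.
    by have [_ ->] := xi0 m s mN; rewrite mule0.
  have ir : P.-integrable setT (fun b => (r b)%:E).
    apply/integrableP; split; first exact/measurable_EFinP.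
    apply: le_lt_trans (ltry (softmax (fun s => S m s a) + 8 * lam ^+ 2 * V m)).
    apply: le_trans Er; rewrite /Ex; under eq_integral do rewrite gee0_abs ?lee_fin//.
    by [].
  apply: le_trans Er.
  apply: (@le_trans _ _ (\int[P]_b ((l b)%:E + (r b)%:E))%E).
    by apply: lower_integral_le => b; rewrite lee_fin; [exact: sm0|exact: gle].
  by rewrite integralD// El add0e.
apply: le_trans (Ex_fubini_le mF me ind mg _ step) _.
  by move=> a b; exact: sm0.
rewrite Ex_add.
- by rewrite Ex_cst big_ord_recr/= mulrDr addrA [leRHS]EFinD leeD.
- by move=> a; exact: sm0.
- by move=> _; rewrite mulr_ge0// mulr_ge0 ?sqr_ge0.
- by apply: measurable_softmax => s; exact: measurable_wrt_fun mF (mS s).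
- exact: measurable_cst.
Qed.

End Filtration.

(** * Dyadic grids of the triangle and chaining *)

Section Grid.
Context (R : realType).
Implicit Types (u v : R) (f : R * R -> R).

Definition supdist (s t : R * R) : R := Num.max `|s.1 - t.1| `|s.2 - t.2|.

Lemma supdist_ge0 s t : 0 <= supdist s t.
Proof. by rewrite /supdist le_max normr_ge0. Qed.

(** Ordering the two coordinates lets every pair of indices name a point of the
    triangle, so that the index set of a grid is a full product. *)
Definition tpt (l a b : nat) : R * R :=
  ((minn a b)%:R / 2 ^+ l, (maxn a b)%:R / 2 ^+ l).

Definition gidx (l : nat) : finType := ('I_(2 ^ l).+1 * 'I_(2 ^ l).+1)%type.

Definition gpt (l : nat) (s : gidx l) : R * R := tpt l s.1 s.2.

Definition parent (l : nat) (s : gidx l.+1) : R * R := tpt l s.1./2 s.2./2.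

Let pow2_gt0 l : 0 < (2 : R) ^+ l. Proof. exact: exprn_gt0. Qed.

Lemma tpt_tri l a b : (a <= 2 ^ l)%N -> (b <= 2 ^ l)%N -> tri (tpt l a b).
Proof.
move=> al bl; split; [|split] => /=.
- by rewrite mulr_ge0 ?invr_ge0 ?(ltW (pow2_gt0 l)).
- by rewrite ler_pM2r ?invr_gt0// ler_nat; lia.
- by rewrite ler_pdivrMr// mul1r -natrX ler_nat; lia.
Qed.

Lemma gpt_tri l (s : gidx l) : tri (gpt s).
Proof. by apply: tpt_tri; rewrite -ltnS. Qed.

Lemma parent_tri l (s : gidx l.+1) : tri (parent s).
Proof.
have H (i : 'I_(2 ^ l.+1).+1) : (i./2 <= 2 ^ l)%N.
  have := ltn_ord i; rewrite ltnS [X in (_ <= X)%N]expnS => il.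
  by move: il; set q := (2 ^ l)%N; set j := nat_of_ord i; lia.
exact: tpt_tri (H _) (H _).
Qed.

Let half_dist l (a : nat) : `|a%:R / 2 ^+ l.+1 - (a./2)%:R / 2 ^+ l| <= 2^-1 ^+ l.+1 :> R.
Proof.
rewrite -{1}(odd_double_half a) -muln2 natrD natrM exprS invfM mulrDl.
rewrite [X in _ + X - _](_ : _ = a./2%:R / 2 ^+ l); last first.
  by field; rewrite gt_eqF// pow2_gt0.
rewrite addrK ger0_norm ?mulr_ge0 ?invr_ge0 ?ler0n// exprS exprVn.
by rewrite -[leRHS]mul1r ler_wpM2r ?mulr_ge0 ?invr_ge0 ?(ltW (pow2_gt0 l))// lern1; case: odd.
Qed.

Lemma parent_dist l (s : gidx l.+1) : supdist (gpt s) (parent s) <= 2^-1 ^+ l.+1.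
Proof.
have hmin (a b : nat) : minn a./2 b./2 = (minn a b)./2 by lia.
have hmax (a b : nat) : maxn a./2 b./2 = (maxn a b)./2 by lia.
by rewrite /supdist ge_max /= hmin hmax !half_dist.
Qed.

Lemma gpt_approx l t : tri t -> exists s : gidx l, supdist t (gpt s) <= 2^-1 ^+ l.
Proof.
case: t => u v [/= u0 [uv v1]].
have v0 := le_trans u0 uv; have u1 := le_trans uv v1.
have flo (x : R) : 0 <= x -> x <= 1 -> exists a : 'I_(2 ^ l).+1, a = Num.truncn (x * 2 ^+ l) :> nat.
  move=> x0 x1; have H : (Num.truncn (x * 2 ^+ l) < (2 ^ l).+1)%N.
    have xl : 0 <= x * 2 ^+ l by rewrite mulr_ge0// ltW.
    have /andP[t1 _] := truncn_itv xl.
    rewrite ltnS -(ler_nat R). apply: le_trans t1 _; rewrite natrX ler_piMl//.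
  by exists (Ordinal H).
have [a aE] := flo u u0 u1; have [b bE] := flo v v0 v1.
have ab : (a <= b)%N by rewrite aE bE le_truncn// ler_wpM2r// ltW.
have D (x : R) (c : nat) : 0 <= x -> c = Num.truncn (x * 2 ^+ l) -> `|x - c%:R / 2 ^+ l| <= 2^-1 ^+ l.
  move=> x0 ->; have xl : 0 <= x * 2 ^+ l by rewrite mulr_ge0// ltW.
  have /andP[t1 t2] := truncn_itv xl.
  rewrite -(ler_pM2r (pow2_gt0 l)) exprVn mulVf ?gt_eqF//.
  rewrite -[X in _ * X]gtr0_norm// -normrM mulrBl divfK ?gt_eqF//.
  by rewrite ger0_norm ?subr_ge0// lerBlDr addrC natr1 ltW.
exists (a, b); rewrite /supdist /gpt /tpt /= (minn_idPl ab) (maxn_idPr ab).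
by rewrite ge_max !D.
Qed.

Definition gridmax l f : R := \big[Num.max/0]_(s : gidx l) `|f (gpt s)|.

Definition incmax l f : R :=
  \big[Num.max/0]_(s : gidx l.+1) `|f (gpt s) - f (parent s)|.

Lemma gridmax_ge0 l f : 0 <= gridmax l f.
Proof. exact: bigmax_ge_id. Qed.

Lemma incmax_ge0 l f : 0 <= incmax l f.
Proof. exact: bigmax_ge_id. Qed.

Lemma gridmax_ge l f (s : gidx l) : `|f (gpt s)| <= gridmax l f.
Proof. exact: (le_bigmax _ (fun s => `|f (gpt s)|)). Qed.

Lemma gridmax_le l f (B : R) : 0 <= B ->
  (forall t, tri t -> `|f t| <= B) -> gridmax l f <= B.
Proof. by move=> B0 fB; apply: bigmax_le => // s _; apply/fB/gpt_tri. Qed.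

Lemma gridmax_leD l f g k : (forall t, `|f t| <= `|g t| + `|k t|) ->
  gridmax l f <= gridmax l g + gridmax l k.
Proof.
move=> fgk; apply: bigmax_le => [|s _]; first by rewrite addr_ge0// gridmax_ge0.
by apply: le_trans (fgk _) _; rewrite lerD// gridmax_ge.
Qed.

(** The step of the chaining: a point of the finer grid is reached from its
    parent, which lies on the coarser one. *)
Lemma gridmaxS l f : gridmax l.+1 f <= gridmax l f + incmax l f.
Proof.
apply: bigmax_le => [|s _]; first by rewrite addr_ge0 ?gridmax_ge0 ?incmax_ge0.
have -> : f (gpt s) = f (parent s) + (f (gpt s) - f (parent s)).
  by rewrite addrC subrK.
apply: le_trans (ler_normD _ _) _; apply: lerD; last first.
  exact: (le_bigmax _ (fun s => `|f (gpt s) - f (parent s)|)).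
have H (i : 'I_(2 ^ l.+1).+1) : (i./2 < (2 ^ l).+1)%N.
  have := ltn_ord i; rewrite !ltnS [X in (_ <= X)%N -> _]expnS => il.
  by move: il; set q := (2 ^ l)%N; set j := nat_of_ord i; lia.
exact: (gridmax_ge f (Ordinal (H s.1), Ordinal (H s.2))).
Qed.

Lemma gidx_gt0 l : (0 < #|gidx l|)%N.
Proof. by rewrite card_prod !card_ord. Qed.

Lemma ln_gidx l : ln (2 * #|gidx l|%:R) + 1 <= 4 * l.+1%:R :> R.
Proof.
have l2 : ln 2 <= 1 :> R.
  by have := @le_ln1Dx R 1; rewrite (_ : 1 + 1 = 2 :> R)//; apply; lra.
have le8 : 2 * #|gidx l|%:R <= 2 ^+ (3 + 2 * l) :> R.
  rewrite card_prod !card_ord -natrX -natrM ler_nat.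
  have p1 : (1 <= 2 ^ l)%N by rewrite expn_gt0.
  by rewrite expnD expnM; rewrite (expnAC 2 2 l); set q := (2 ^ l)%N in p1 *; nia.
have gt0 : 0 < 2 * #|gidx l|%:R :> R by rewrite mulr_gt0// ltr0n gidx_gt0.
have : ln (2 * #|gidx l|%:R) <= ln ((2 : R) ^+ (3 + 2 * l)).
  by rewrite ler_ln ?posrE.
rewrite lnXn// => /le_trans; rewrite -lerBrDr; apply.
rewrite -[leLHS]mulr_natr (le_trans (ler_wpM2r _ l2))//.
by have := ler0n R l; rewrite mul1r natrD natrM -(natr1 l); lra.
Qed.

End Grid.

Section Chaining.
Context (d : measure_display) (T : measurableType d) (R : realType).
Context (P : probability T R).

(** [4] for the starting grid and a geometric series for its refinements. *)
Definition chain_const (rho : R) : R := 4 + 8 / (1 - rho) ^+ 2.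

Lemma geometric_sum (rho : R) N : 0 < rho < 1 ->
  \sum_(r < N) (r.+2)%:R * rho ^+ r <= 2 / (1 - rho) ^+ 2.
Proof.
move=> /andP[r0 r1]; have q0 : 0 < 1 - rho by lra.
rewrite -mulrC ler_pdivlMl ?exprn_gt0//.
suff H : (1 - rho) ^+ 2 * \sum_(r < N) (r.+1)%:R * rho ^+ r <= 1.
  apply: le_trans (_ : 2 * ((1 - rho) ^+ 2 * \sum_(r < N) (r.+1)%:R * rho ^+ r) <= _); last by lra.
  rewrite mulrCA ler_pM2l ?exprn_gt0// mulr_sumr; apply: ler_sum => r _.
  rewrite [leRHS]mulrA; apply: ler_wpM2r; first by rewrite exprn_ge0 ?ltW.
  by rewrite -natrM ler_nat; lia.
have -> : (1 - rho) ^+ 2 * \sum_(r < N) (r.+1)%:R * rho ^+ r =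
    1 - N.+1%:R * rho ^+ N + N%:R * rho ^+ N.+1.
  elim: N => [|N IH]; first by rewrite big_ord0 expr0; ring.
  by rewrite big_ord_recr/= mulrDr IH !exprS -(natr1 N.+1) -(natr1 N); ring.
have : rho ^+ N.+1 <= rho ^+ N by rewrite exprS ler_piMl ?exprn_ge0 ?ltW.
have : 0 <= rho ^+ N by rewrite exprn_ge0 ?ltW.
have : 0 <= N%:R :> R by [].
by rewrite -(natr1 N); nra.
Qed.

(** Scaling the parameter [lam] up by [rho ^- r] at the [r]-th refinement makes
    both the entropy and the variance contributions summable. *)
Lemma chaining (X : R * R -> T -> R) (l0 : nat) (rho V lam : R) :
  0 < rho < 1 -> 0 <= V -> 0 < lam ->
  (forall t, measurable_fun setT (X t)) ->
  (forall lam', 0 < lam' -> (Ex P (fun a => gridmax l0 (X^~ a)) <=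
     (4 * l0.+1%:R / lam' + lam' * V)%:E)%E) ->
  (forall r lam', 0 < lam' -> (Ex P (fun a => incmax (l0 + r) (X^~ a)) <=
     (4 * (l0 + r).+2%:R / lam' + lam' * (rho ^+ r) ^+ 2 * V)%:E)%E) ->
  forall N, (Ex P (fun a => gridmax (l0 + N) (X^~ a)) <=
     (chain_const rho * (l0.+1%:R / lam + lam * V))%:E)%E.
Proof.
move=> rho01 V0 lam0 mX base inc N; have /andP[r0 r1] := rho01.
have q0 : 0 < 1 - rho by lra.
have mg l : measurable_fun setT (fun a => gridmax l (X^~ a)).
  by apply: measurable_bigmax => s; exact: measurable_norm.
have mi l : measurable_fun setT (fun a => incmax l (X^~ a)).
  by apply: measurable_bigmax => s; apply: measurable_norm; exact: measurable_funB.
set W := l0.+1%:R / lam + lam * V.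
have W0 : 0 <= W by rewrite addr_ge0// ?divr_ge0 ?mulr_ge0// ltW.
apply: (@le_trans _ _ (4 * W + 4 * W * \sum_(r < N) (r.+2)%:R * rho ^+ r)%:E); last first.
  rewrite lee_fin /chain_const [leRHS]mulrDl lerD2l.
  have := geometric_sum N rho01; have : 0 <= 4 * W by lra.
  move=> h1 h2; apply: le_trans (ler_wpM2l h1 h2) _.
  by rewrite (_ : 4 * W * _ = 8 / (1 - rho) ^+ 2 * W)//; ring.
elim: N => [|N IH].
  rewrite addn0 big_ord0 mulr0 addr0; apply: le_trans (base _ lam0) _.
  rewrite lee_fin /W mulrDr mulrA lerD2l.
  have : 0 <= lam * V by rewrite mulr_ge0// ltW.
  by lra.
rewrite addnS.
apply: (@le_trans _ _ (Ex P (fun a => gridmax (l0 + N) (X^~ a) + incmax (l0 + N) (X^~ a)))).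
  by apply: Ex_le => a; [exact: gridmax_ge0|exact: gridmaxS].
rewrite Ex_add; [|by move=> a; exact: gridmax_ge0|by move=> a; exact: incmax_ge0|by []|by []].
rewrite big_ord_recr/=; set A := \sum_(r < N) _; set B := _ * rho ^+ N.
rewrite (_ : 4 * W + 4 * W * (A + B) = (4 * W + 4 * W * A) + 4 * W * B); last first.
  by ring.
rewrite EFinD; apply: leeD => //; rewrite /B.
have rN0 : 0 < rho ^+ N by rewrite exprn_gt0.
have lamN : 0 < lam / rho ^+ N by rewrite divr_gt0.
apply: le_trans (inc N _ lamN) _; rewrite lee_fin.
have -> : 4 * (l0 + N).+2%:R / (lam / rho ^+ N) + lam / rho ^+ N * (rho ^+ N) ^+ 2 * V =
   (4 * (l0 + N).+2%:R / lam + lam * V) * rho ^+ N by field; rewrite !gt_eqF.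
rewrite [leRHS]mulrA; apply: ler_wpM2r; first exact: ltW.
have e1 : (l0 + N).+2%:R / lam <= l0.+1%:R / lam * N.+2%:R.
  by rewrite mulrAC ler_pM2r ?invr_gt0// -natrM ler_nat; nia.
have b0 : 0 <= lam * V by rewrite mulr_ge0// ltW.
have e2 : lam * V <= lam * V * N.+2%:R by rewrite ler_peMr// ler1n.
rewrite (_ : 4 * W * N.+2%:R =
  4 * (l0.+1%:R / lam * N.+2%:R) + 4 * (lam * V * N.+2%:R)); last first.
  by rewrite /W; ring.
by rewrite -mulrA; lra.
Qed.

End Chaining.

(** * Sub-Gaussian sums with predictable coefficients *)

Section OrdinalIndexed.
Context (d : measure_display) (T : measurableType d) (R : realType).
Context (P : probability T R) (F e : nat -> set (set T)) (N : nat).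
Hypothesis FeN : filtration P F e N.

Let at_ord (Y : Type) (y0 : Y) (y : 'I_N -> Y) (k : nat) : Y :=
  if insub k is Some i then y i else y0.

Let at_ordE Y (y0 : Y) (y : 'I_N -> Y) (i : 'I_N) : at_ord y0 y i = y i.
Proof. by rewrite /at_ord valK. Qed.

Lemma supermartingale_ord (y : 'I_N -> T -> T -> R) :
  (forall k a b, 0 <= y k a b) ->
  (forall k : 'I_N, measurable_wrt2 (F k) (e k) (y k)) ->
  (forall k a, (Ex P (y k a) <= 1)%E) ->
  (Ex P (fun a => \prod_k y k a a)%R <= 1)%E.
Proof.
move=> y0 my y1; pose z k a b := at_ord (fun _ _ => 1) y k a b.
rewrite (_ : (fun a => _) = fun a => \prod_(k < N) z k a a); last first.
  by apply/funext => a; apply: eq_bigr => i _; rewrite /z at_ordE.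
apply: (supermartingale FeN).
- by move=> k a b; rewrite /z /at_ord; case: insubP.
- by move=> k kN; have := my (Ordinal kN); rewrite /z -[k]/(val (Ordinal kN)) at_ordE.
- by move=> k a kN; have := y1 (Ordinal kN) a; rewrite /z -[k]/(val (Ordinal kN)) at_ordE.
Qed.

Lemma nemirovski_ord (I : finType) (xi : 'I_N -> I -> T -> R) (f : 'I_N -> T -> R)
    (V : 'I_N -> R) (lam : R) : (0 < #|I|)%N -> 0 < lam ->
  (forall (k : 'I_N) s, measurable_wrt (e k) (xi k s)) ->
  (forall k, measurable_fun setT (f k)) ->
  (forall k s a, `|xi k s a| <= f k a) ->
  (forall k s, P.-integrable setT (fun a => (xi k s a)%:E) /\
     \int[P]_a (xi k s a)%:E = 0)%E ->
  (forall k, (Ex P (fun a => f k a ^+ 2)%R <= (V k)%:E)%E) ->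
  (Ex P (fun a => \big[Num.max/0]_s `|\sum_k xi k s a|)%R <=
    (ln (2 * #|I|%:R) / lam + 8 * lam * \sum_k V k)%:E)%E.
Proof.
move=> I0 lam0 mxi mf xif xi0 fV.
pose z k := at_ord (fun _ _ => 0) xi k.
pose f' k := at_ord (fun _ => 0) f k.
pose V' k := at_ord 0 V k.
rewrite (_ : (fun a => _) = fun a => \big[Num.max/0]_s `|\sum_(k < N) z k s a|); last first.
  apply/funext => a; apply: eq_bigr => s _; congr (`| _ |).
  by apply: eq_bigr => i _; rewrite /z at_ordE.
rewrite (_ : \sum_k V k = \sum_(k < N) V' k); last first.
  by apply: eq_bigr => i _; rewrite /V' at_ordE.
apply: (nemirovski FeN I0 (f := f')) => //.
- move=> k s kN; rewrite /z -[k]/(val (Ordinal kN)) at_ordE; exact: mxi.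
- move=> k kN; rewrite /f' -[k]/(val (Ordinal kN)) at_ordE; exact: mf.
- move=> k s a kN; rewrite /z /f' -[k]/(val (Ordinal kN)) !at_ordE; exact: xif.
- move=> k s kN; rewrite /z -[k]/(val (Ordinal kN)) !at_ordE; exact: xi0.
- move=> k kN; rewrite /V' /f' -[k]/(val (Ordinal kN)) !at_ordE; exact: fV.
Qed.

End OrdinalIndexed.

Section SourceFiltration.
Context (d : measure_display) (T : measurableType d) (R : realType).
Context (P : probability T R) (S : finType) (G : S -> set (set T)).
Hypothesis sG : forall s, sigma_algebra setT (G s).
Hypothesis mG : forall s, G s `<=` measurable.
Hypothesis indG : mutually_independent P G.

Lemma filtration_of (F e : nat -> {set S}) N :
  (forall k s, (k < N)%N -> s \in F k -> s \notin e k) ->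
  (forall k, (k < N)%N -> (F k :|: e k)%SET \subset F k.+1) ->
  filtration P (fun k => sources G (F k)) (fun k => sources G (e k)) N.
Proof.
move=> Fe FeS k kN; have /fintype.subsetP FS := FeS _ kN.
split; [exact: sources_measurable|exact: sources_measurable| | |].
- by apply: sources_independent2 => // s; exact: Fe.
- by apply: sources_mono; apply/fintype.subsetP => s sF; apply: FS; rewrite inE sF.
- by apply: sources_mono; apply/fintype.subsetP => s sF; apply: FS; rewrite inE sF orbT.
Qed.

End SourceFiltration.

Section SubGaussian.
Context (d : measure_display) (T : measurableType d) (R : realType).
Context (P : probability T R) (S : finType) (G : S -> set (set T)).
Hypothesis sG : forall s, sigma_algebra setT (G s).
Hypothesis mG : forall s, G s `<=` measurable.
Hypothesis indG : mutually_independent P G.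
Variables (n p : nat) (src : 'I_n -> 'I_p -> S).
Hypothesis src_inj : forall i j i' j', src i j = src i' j' -> i = i' /\ j = j'.
Variables (err : 'I_n -> 'I_p -> T -> R) (tau : R).
Hypothesis merr : forall i j, measurable_wrt (sources G [set src i j]) (err i j).

Definition before (i : 'I_n) (k : nat) : {set S} :=
  [set s | [exists j : 'I_p, (j < k)%N && (s == src i j)]].

Definition row (i : 'I_n) : {set S} := before i p.

Definition rows_before (q : nat) : {set S} :=
  [set s | [exists i : 'I_n, (i < q)%N && (s \in row i)]].

Let src_before i j k : (src i j \in before i k) = (j < k)%N.
Proof.
rewrite inE; apply/existsP/idP => [[j' /andP[jk /eqP/src_inj[_ ->]]]//|jk].
by exists j; rewrite jk eqxx.
Qed.

Let row_filtration i : filtration P (fun k => sources G (before i k))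
  (fun k => sources G (if insub k is Some j then [set src i j] else finset.set0)) p.
Proof.
apply: (filtration_of sG mG indG) => [k s kp|k kp].
  rewrite inE => /existsP[j /andP[jk /eqP ->]].
  rewrite insubT /= inE; apply/eqP => /src_inj[_ jE].
  by move: jk; rewrite jE /= ltnn.
rewrite insubT /=; apply/fintype.subsetP => s; rewrite !inE => /orP[/existsP[j /andP[jk sE]]|/eqP ->].
  by apply/existsP; exists j; rewrite sE (ltn_trans jk).
by apply/existsP; exists (Ordinal kp); rewrite /= ltnSn eqxx.
Qed.

Let rows_filtration : filtration P (fun q => sources G (rows_before q))
  (fun q => sources G (if insub q is Some i then row i else finset.set0)) n.
Proof.
apply: (filtration_of sG mG indG) => [q s qn|q qn].
  rewrite inE => /existsP[i /andP[iq]]; rewrite inE => /existsP[j /andP[_ /eqP ->]].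
  rewrite insubT /= inE; apply/negP => /existsP[j' /andP[_ /eqP/src_inj[iE _]]].
  by move: iq; rewrite iE /= ltnn.
rewrite insubT /=; apply/fintype.subsetP => s.
rewrite inE => /orP[|sq].
  rewrite !inE => /existsP[i /andP[iq si]].
  by apply/existsP; exists i; rewrite si (ltn_trans iq).
by rewrite inE; apply/existsP; exists (Ordinal qn); rewrite /= ltnSn sq.
Qed.

(** The errors are revealed row by row, and from left to right in each row. *)
Lemma ordered_product (y : 'I_n -> 'I_p -> T -> T -> R) :
  (forall i k a b, 0 <= y i k a b) ->
  (forall i (k : 'I_p),
     measurable_wrt2 (sources G (before i k)) (sources G [set src i k]) (y i k)) ->
  (forall i k a, (Ex P (y i k a) <= 1)%E) ->
  (Ex P (fun a => \prod_i \prod_k y i k a a)%R <= 1)%E.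
Proof.
move=> y0 my y1.
pose Y i (a b : T) := \prod_k y i k b b.
have mY (i : 'I_n) : measurable_wrt (sources G
    (if insub (i : nat) is Some j then row j else finset.set0)) (Y i point).
  rewrite valK; apply: measurable_prod => k _.
  apply: measurable_wrt2_diag (my i k); apply: sources_mono.
    apply/fintype.subsetP => s; rewrite !inE.
    by case/existsP => j /andP[_ sE]; apply/existsP; exists j; rewrite ltn_ord.
  by rewrite finset.sub1set src_before.
apply: (supermartingale_ord rows_filtration (y := Y)).
- by move=> i a b; apply: prodr_ge0.
- move=> i; exact: (measurable_wrt2_r (G := sources G (rows_before i)) (mY i)).
move=> i a; apply: (supermartingale_ord (row_filtration i) (y := y i)) => //.
by move=> k; rewrite valK; exact: my.
Qed.

Hypothesis mgf : forall i j lam,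
  (Ex P (fun a => expR (lam * err i j a)) <= (expR (lam ^+ 2 * tau / 2))%:E)%E.

(** Conditionally on the past, [eta i k] is a constant and the compensated
    exponential has mean at most one by sub-Gaussianity. *)
Lemma subgaussian_sum (eta : 'I_n -> 'I_p -> T -> R) :
  (forall i (k : 'I_p), measurable_wrt (sources G (before i k)) (eta i k)) ->
  (Ex P (fun a => expR (\sum_i \sum_k
      (err i k a * eta i k a - tau / 2 * eta i k a ^+ 2)))%R <= 1)%E.
Proof.
move=> meta.
pose y i k a b := expR (err i k b * eta i k a - tau / 2 * eta i k a ^+ 2).
rewrite (_ : (fun a => _) = fun a => \prod_i \prod_k y i k a a); last first.
  by apply/funext => a; rewrite expR_sum; apply: eq_bigr => i _; rewrite expR_sum.
apply: ordered_product.
- by move=> i k a b; exact: expR_ge0.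
- move=> i k; apply: measurable_exp; apply: measurable_funB.
    apply: measurable_funM.
      exact: (measurable_wrt2_r (G := sources G (before i k)) (@merr i k)).
    exact: measurable_wrt2_l (meta i k).
  apply: measurable_funM; first exact: measurable_cst.
  by apply: measurable_funX; exact: measurable_wrt2_l (meta i k).
- move=> i k a.
  have -> : y i k a = fun b => expR (- (tau / 2 * eta i k a ^+ 2)) * expR (eta i k a * err i k b).
    by apply/funext => b; rewrite /y -expRD; congr expR; ring.
  have me : measurable_fun setT (err i k).
    exact: (measurable_wrt_fun (@sources_measurable _ _ _ _ mG _) (@merr i k)).
  rewrite Ex_scale ?expR_ge0//; last by meas.
  apply: (@le_trans _ _ ((expR (- (tau / 2 * eta i k a ^+ 2)))%:E *
    (expR (eta i k a ^+ 2 * tau / 2))%:E)%E).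
    by apply: lee_wpmul2l; rewrite ?lee_fin ?expR_ge0.
  by rewrite -EFinM -expRD lee_fin -(expR0 R) ler_expR le_eqVlt; apply/orP; left; apply/eqP; ring.
Qed.

End SubGaussian.

(** * Bilinear forms with localized kernels *)

Section BilinearForm.
Context (R : realType) (n p : nat).

Definition bil (K : 'I_n -> 'I_p -> 'I_p -> R) (b c : 'I_n -> 'I_p -> R) : R :=
  n%:R^-1 * \sum_i \sum_j \sum_k K i j k * b i j * c i k.

Lemma bilB K K' b c :
  bil K b c - bil K' b c = bil (fun i j k => K i j k - K' i j k) b c.
Proof.
rewrite /bil -mulrBr -sumrB; congr (_ * _); apply: eq_bigr => i _.
rewrite -sumrB; apply: eq_bigr => j _; rewrite -sumrB.
by apply: eq_bigr => k _; rewrite !mulrBl.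
Qed.

Lemma bilDr K b c c' :
  bil K b (fun i j => c i j + c' i j) = bil K b c + bil K b c'.
Proof.
rewrite /bil -mulrDr -big_split; congr (_ * _); apply: eq_bigr => i _ /=.
rewrite -big_split; apply: eq_bigr => j _ /=; rewrite -big_split.
by apply: eq_bigr => k _ /=; ring.
Qed.

Lemma bil_transpose K b c : bil K b c = bil (fun i j k => K i k j) c b.
Proof.
rewrite /bil; congr (_ * _); apply: eq_bigr => i _; rewrite exchange_big /=.
by apply: eq_bigr => j _; apply: eq_bigr => k _; ring.
Qed.

Lemma bil_right K b c : bil K b c =
  n%:R^-1 * \sum_i \sum_k c i k * \sum_j K i j k * b i j.
Proof.
rewrite /bil; congr (_ * _); apply: eq_bigr => i _; rewrite exchange_big /=.
by apply: eq_bigr => k _; rewrite mulr_sumr; apply: eq_bigr => j _; ring.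
Qed.

End BilinearForm.

Section Windows.
Context (R : realType).

Lemma sqr_sum_le (I : finType) (J : {pred I}) (a : I -> R) :
  (\sum_(j in J) a j) ^+ 2 <= #|J|%:R * \sum_(j in J) a j ^+ 2.
Proof.
rewrite expr2 mulr_suml.
apply: (@le_trans _ _ (\sum_(j in J) \sum_(k in J) (a j ^+ 2 + a k ^+ 2) / 2)).
  apply: ler_sum => j _; rewrite mulr_sumr; apply: ler_sum => k _.
  by rewrite ler_pdivlMr//; have := sqr_ge0 (a j - a k); lra.
under eq_bigr do rewrite -mulr_suml big_split /= sumr_const -[_ *+ _]mulr_natl.
rewrite -mulr_suml big_split /= sumr_const -mulr_sumr -[_ *+ _]mulr_natl.
by rewrite ler_pdivrMr//; lra.
Qed.

Context (p : nat) (xs : 'I_p -> R).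

(** Cauchy-Schwarz in the inner sum, whose terms all lie in one window; the outer
    sum runs over another window. *)
Lemma quadratic_variation (K : 'I_p -> 'I_p -> R) (b : 'I_p -> R) (u v r s M : R) :
  0 <= s -> (forall j k, `|K j k| <= s) ->
  (forall j k, K j k != 0 -> `|xs j - u| <= r /\ `|xs k - v| <= r) ->
  #|[pred j | `|xs j - u| <= r]|%:R <= M ->
  #|[pred j | `|xs j - v| <= r]|%:R <= M ->
  \sum_k (\sum_j K j k * b j) ^+ 2 <=
    (M * s) ^+ 2 * \sum_(j | `|xs j - u| <= r) b j ^+ 2.
Proof.
move=> s0 Ks supp uM vM; have M0 : 0 <= M by exact: le_trans uM.
set B := \sum_(j | _) b j ^+ 2; have B0 : 0 <= B by apply: sumr_ge0 => j _; exact: sqr_ge0.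
have inner k : (\sum_j K j k * b j) ^+ 2 <= M * (s ^+ 2 * B).
  rewrite [X in X ^+ 2](_ : _ = \sum_(j in [pred j | `|xs j - u| <= r]) K j k * b j); last first.
    rewrite [RHS]big_mkcond /=; apply: eq_bigr => j _; rewrite inE.
    case: ifPn => // out; have [->|/supp[]] := eqVneq (K j k) 0; first by rewrite mul0r.
    by rewrite (negbTE out).
  apply: le_trans (sqr_sum_le _ _) _; apply: ler_pM => //.
    by apply: sumr_ge0 => j _; exact: sqr_ge0.
  rewrite /B mulr_sumr; apply: ler_sum => j _; rewrite exprMn ler_wpM2r ?sqr_ge0//.
  by rewrite -real_normK ?num_real// ler_pXn2r ?nnegrE.
have outer k : ~~ (`|xs k - v| <= r) -> (\sum_j K j k * b j) ^+ 2 = 0.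
  move=> out; rewrite big1 ?expr0n// => j _.
  have [->|/supp[_]] := eqVneq (K j k) 0; first by rewrite mul0r.
  by rewrite (negbTE out).
rewrite (bigID [pred k | `|xs k - v| <= r])/= [X in _ + X]big1 ?addr0//.
apply: (@le_trans _ _ (\sum_(k in [pred k | `|xs k - v| <= r]) M * (s ^+ 2 * B))).
  by apply: ler_sum => k _; exact: inner.
rewrite sumr_const -mulr_natl (_ : (M * s) ^+ 2 * B = M * (M * (s ^+ 2 * B))); last by ring.
by rewrite ler_wpM2r// mulr_ge0// mulr_ge0// sqr_ge0.
Qed.

End Windows.

Section Kernels.
Context (R : realType) (n p : nat) (x : 'I_n -> 'I_p -> R) (h m A D : R).

Definition centre (b : bool) (t : R * R) : R := if b then t.1 else t.2.

(** [m] is the order of the number of design points in a window. Three bandwidths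
    leave room for the supports at neighbouring points and for the passage to
    the nodes of a grid. *)
Definition windows_card := forall i u, 0 <= u <= 1 ->
  #|[pred j | `|x i j - u| <= 3 * h]|%:R <= A * m.

(** The flag [b] tells which coordinate of the point localizes the first index;
    it makes the transposed weights satisfy the same conditions. *)
Definition kernel_conditions (b : bool) (kap : R * R -> 'I_n -> 'I_p -> 'I_p -> R) :=
  [/\ forall t i j k, tri t -> kap t i j k != 0 ->
        `|x i j - centre b t| <= h /\ `|x i k - centre (~~ b) t| <= h,
      forall t i j k, tri t -> `|kap t i j k| <= D / m ^+ 2 &
      forall t t' i j k, tri t -> tri t' ->
        `|kap t i j k - kap t' i j k| <= D / m ^+ 2 * (supdist t t' / h)].

Lemma kernel_transpose b kap : kernel_conditions b kap ->
  kernel_conditions (~~ b) (fun t i j k => kap t i k j).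
Proof.
move=> [K1 K2 K3]; split=> [t i j k tt|t i j k|t t' i j k].
- by move=> /(K1 _ _ _ _ tt)[? ?]; rewrite negbK.
- exact: K2.
- exact: K3.
Qed.

Lemma centre_itv b t : tri t -> 0 <= centre b t <= 1.
Proof.
case: t b => u v [] /= [u0 [uv v1]]; rewrite /centre /=.
  by rewrite u0 (le_trans uv).
by rewrite v1 (le_trans u0).
Qed.

Lemma centre_dist b t t' : `|centre b t - centre b t'| <= supdist t t'.
Proof. by case: b; rewrite /supdist le_max lexx ?orbT. Qed.

End Kernels.

Section ErrorProcess.
Context (d : measure_display) (T : measurableType d) (R : realType).
Context (P : probability T R) (S : finType) (G : S -> set (set T)).
Hypothesis sG : forall s, sigma_algebra setT (G s).
Hypothesis mG : forall s, G s `<=` measurable.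
Hypothesis indG : mutually_independent P G.
Variables (n p : nat) (src : 'I_n -> 'I_p -> S).
Hypothesis src_inj : forall i j i' j', src i j = src i' j' -> i = i' /\ j = j'.
Variables (err : 'I_n -> 'I_p -> T -> R) (tau : R).
Hypothesis merr : forall i j, measurable_wrt (sources G [set src i j]) (err i j).
Hypothesis tau0 : 0 <= tau.
Hypothesis mgf : forall i j lam,
  (Ex P (fun a => expR (lam * err i j a)) <= (expR (lam ^+ 2 * tau / 2))%:E)%E.
Hypothesis n0 : (0 < n)%N.
Variables (x : 'I_n -> 'I_p -> R) (h m A D : R).
Hypothesis h0 : 0 < h.
Hypothesis m0 : 0 < m.
Hypothesis D0 : 0 <= D.
Hypothesis wc : windows_card x h m A.
Variables (z : 'I_n -> 'I_p -> R) (theta : R) (Q : T -> R) (q : R).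
Hypothesis mQ : measurable_fun setT Q.
Hypothesis Q0 : forall a, 0 <= Q a.
Hypothesis EQ : (Ex P Q <= q%:E)%E.

Let b i j a := z i j + theta * err i j a.
Hypothesis bQ : forall a u, 0 <= u <= 1 ->
  \sum_i \sum_(j | `|x i j - u| <= 2 * h) b i j a ^+ 2 <= n%:R * m * Q a.

Let merr' i j : measurable_fun setT (err i j).
Proof. exact: (measurable_wrt_fun (@sources_measurable _ _ _ _ mG _) (@merr i j)). Qed.

Let variance : R := tau * A ^+ 2 * D ^+ 2 * q / (2 * n%:R * m).

Let q0 : 0 <= q.
Proof. by rewrite -lee_fin; apply: le_trans EQ; exact: Ex_ge0. Qed.

Let num0 : 0 <= tau * A ^+ 2 * D ^+ 2.
Proof. by rewrite mulr_ge0 ?sqr_ge0// mulr_ge0 ?sqr_ge0. Qed.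

Let den0 : 0 < 2 * n%:R * m.
Proof. by rewrite mulr_gt0// mulr_gt0// ltr0n. Qed.

(* the compensator of the exponential is the quadratic variation, which [Q]
   bounds through the sum of squares over one window *)
Let bil_pos_exp (I : finType) (K : I -> 'I_n -> 'I_p -> 'I_p -> R) (u v : I -> R)
    (s lam : R) : 0 <= s ->
  (forall c, 0 <= u c <= 1) -> (forall c, 0 <= v c <= 1) ->
  (forall c i j k, `|K c i j k| <= D / m ^+ 2 * s) ->
  (forall c i j k, K c i j k != 0 ->
     `|x i j - u c| <= 2 * h /\ `|x i k - v c| <= 2 * h) ->
  (theta != 0 -> forall c i (j k : 'I_p), K c i j k != 0 -> (j < k)%N) ->
  forall c, (Ex P (fun a => expR (lam * bil (K c) (fun i j => b i j a) (fun i j => err i j a)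
     - lam ^+ 2 * s ^+ 2 * (tau * A ^+ 2 * D ^+ 2 / (2 * n%:R * m)) * Q a))%R <= 1)%E.
Proof.
move=> s0 u01 v01 Ks supp pred c.
pose eta i k a := lam / n%:R * \sum_j K c i j k * b i j a.
have nR : 0 < n%:R :> R by rewrite ltr0n.
have meta i (k : 'I_p) : measurable_wrt (sources G (before src i k)) (eta i k).
  apply: measurable_funM; first exact: measurable_cst.
  apply: measurable_sum => j; have [->|Kn0] := eqVneq (K c i j k) 0.
    by under eq_fun do rewrite mul0r; exact: measurable_cst.
  apply: measurable_funM; first exact: measurable_cst.
  apply: measurable_funD; first exact: measurable_cst.
  have [->|tn0] := eqVneq theta 0.
    by under eq_fun do rewrite mul0r; exact: measurable_cst.
  apply: measurable_funM; first exact: measurable_cst.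
  refine (measurable_wrt_sub _ (@merr i j)); apply: sources_mono.
  rewrite finset.sub1set inE; apply/existsP; exists j.
  by rewrite (pred tn0 c i j k Kn0) eqxx.
apply: le_trans (subgaussian_sum sG mG indG src_inj merr mgf meta).
apply: Ex_le => a; first exact: expR_ge0.
rewrite ler_expR.
have -> : \sum_i \sum_k (err i k a * eta i k a - tau / 2 * eta i k a ^+ 2) =
    lam * bil (K c) (fun i j => b i j a) (fun i j => err i j a) -
    tau / 2 * (lam / n%:R) ^+ 2 * \sum_i \sum_k (\sum_j K c i j k * b i j a) ^+ 2.
  rewrite bil_right mulrA !mulr_sumr -sumrB; apply: eq_bigr => i _.
  rewrite !mulr_sumr -sumrB; apply: eq_bigr => k _; rewrite /eta exprMn.
  by ring.
apply: lerB => //.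
have Dm : 0 <= D / m ^+ 2 * s by rewrite mulr_ge0// divr_ge0// sqr_ge0.
have card i w : 0 <= w <= 1 -> #|[pred j | `|x i j - w| <= 2 * h]|%:R <= A * m.
  move=> w01; apply: le_trans (wc i w01); rewrite ler_nat; apply: subset_leq_card.
  by apply/fintype.subsetP => j; rewrite !inE => e; apply: le_trans e _; rewrite ler_pM2r// ler_nat.
have qv : \sum_i \sum_k (\sum_j K c i j k * b i j a) ^+ 2 <=
    (A * m * (D / m ^+ 2 * s)) ^+ 2 * (n%:R * m * Q a).
  apply: (@le_trans _ _ ((A * m * (D / m ^+ 2 * s)) ^+ 2 *
     \sum_i \sum_(j | `|x i j - u c| <= 2 * h) b i j a ^+ 2)); last first.
    by rewrite ler_wpM2l ?sqr_ge0//; exact: bQ.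
  rewrite mulr_sumr; apply: ler_sum => i _.
  exact: quadratic_variation Dm (Ks c i) (supp c i) (card _ _ (u01 c)) (card _ _ (v01 c)).
have c0 : 0 <= tau / 2 * (lam / n%:R) ^+ 2 by rewrite mulr_ge0 ?sqr_ge0 ?divr_ge0.
apply: le_trans (ler_wpM2l c0 qv) _.
rewrite le_eqVlt; apply/orP; left; apply/eqP; field.
by rewrite !gt_eqF.
Qed.

Lemma error_max (I : finType) (K : I -> 'I_n -> 'I_p -> 'I_p -> R) (u v : I -> R)
    (s lam : R) : (0 < #|I|)%N -> 0 <= s -> 0 < lam ->
  (forall c, 0 <= u c <= 1) -> (forall c, 0 <= v c <= 1) ->
  (forall c i j k, `|K c i j k| <= D / m ^+ 2 * s) ->
  (forall c i j k, K c i j k != 0 ->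
     `|x i j - u c| <= 2 * h /\ `|x i k - v c| <= 2 * h) ->
  (theta != 0 -> forall c i (j k : 'I_p), K c i j k != 0 -> (j < k)%N) ->
  (Ex P (fun a => \big[Num.max/0]_c
      `|bil (K c) (fun i j => b i j a) (fun i j => err i j a)|)%R <=
    ((ln (2 * #|I|%:R) + 1) / lam + lam * s ^+ 2 * variance)%:E)%E.
Proof.
move=> I0 s0 lam0 u01 v01 Ks supp pred.
have nR : 0 < n%:R :> R by rewrite ltr0n.
have H l := bil_pos_exp l s0 u01 v01 Ks supp pred.
set W := tau * A ^+ 2 * D ^+ 2 / (2 * n%:R * m) in H.
have W0 : 0 <= W.
  by rewrite divr_ge0// ltW.
pose V a := lam ^+ 2 * s ^+ 2 * W * Q a.
have mV : measurable_fun setT V by rewrite /V; meas.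
have ls0 : 0 <= lam ^+ 2 * s ^+ 2 * W by rewrite mulr_ge0// mulr_ge0 ?sqr_ge0.
have V0 a : 0 <= V a by rewrite /V mulr_ge0.
have EV : (Ex P V <= (lam ^+ 2 * s ^+ 2 * W * q)%:E)%E.
  by rewrite /V Ex_scale// [leRHS]EFinM; apply: lee_wpmul2l; rewrite ?lee_fin.
have mX c : measurable_fun setT
   (fun a => bil (K c) (fun i j => b i j a) (fun i j => err i j a)).
  by rewrite /bil /b; meas; exact: merr'.
apply: le_trans (max_of_exponential I0 lam0 mX mV V0 _ _) _.
- by move=> c; exact: H.
- move=> c; have := H (- lam) c; rewrite sqrrN.
  by under [X in Ex _ X]eq_fun do rewrite mulNr.
apply: (@le_trans _ _ ((lam^-1)%:E *
    ((lam ^+ 2 * s ^+ 2 * W * q)%:E + (ln (2 * #|I|%:R) + 1)%:E))%E).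
  by apply: lee_wpmul2l; rewrite ?leeD2r// lee_fin invr_ge0 ltW.
rewrite -EFinD -EFinM lee_fin le_eqVlt; apply/orP; left; apply/eqP.
by rewrite /variance /W; field; rewrite !gt_eqF.
Qed.

(** The kernel at the points of a grid is bounded, and its increments to the
    parents are smaller by the distance over [h]: the chaining can only start at
    the resolution [h], which is the origin of the logarithm. *)
Lemma error_process bb (kap : R * R -> 'I_n -> 'I_p -> 'I_p -> R) (l0 : nat) (lam : R) :
  kernel_conditions x h m D bb kap ->
  (theta != 0 -> forall t i (j k : 'I_p), tri t -> kap t i j k != 0 -> (j < k)%N) ->
  0 < lam -> 2^-1 ^+ l0 <= h ->
  forall N, (Ex P (fun a => gridmax (l0 + N)
      (fun t => bil (kap t) (fun i j => b i j a) (fun i j => err i j a)))%R <=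
    (chain_const (2^-1 : R) * (l0.+1%:R / lam + lam * variance))%:E)%E.
Proof.
move=> [K1 K2 K3] pred lam0 hl0; have hpos := h0.
have nR : 0 < n%:R :> R by rewrite ltr0n.
have V0 : 0 <= variance.
  by apply: divr_ge0; [exact: mulr_ge0|exact: ltW].
have DM : 0 <= D / m ^+ 2 by rewrite divr_ge0// sqr_ge0.
pose X t a := bil (kap t) (fun i j => b i j a) (fun i j => err i j a).
apply: (chaining (X := X)) => //.
- by apply/andP; split; lra.
- by move=> t; rewrite /X /bil /b; meas; exact: merr'.
- move=> lam' lam'0.
  have := @error_max _ (fun s : gidx l0 => kap (gpt R s)) (fun s => centre bb (gpt R s))
    (fun s => centre (~~ bb) (gpt R s)) 1 lam' (gidx_gt0 l0) ler01 lam'0.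
  move=> H; apply: le_trans (H _ _ _ _ _) _.
  + by move=> s; exact/centre_itv/gpt_tri.
  + by move=> s; exact/centre_itv/gpt_tri.
  + by move=> s i j k; rewrite mulr1; exact/K2/gpt_tri.
  + by move=> s i j k /(K1 _ _ _ _ (gpt_tri R s))[? ?]; split; lra.
  + by move=> tn0 s i j k; exact/pred/gpt_tri.
  by rewrite lee_fin expr1n mulr1 lerD2r ler_pM2r ?invr_gt0// ln_gidx.
- move=> r lam' lam'0.
  pose K (s : gidx (l0 + r).+1) i j k := kap (gpt R s) i j k - kap (parent R s) i j k.
  have dist (s : gidx (l0 + r).+1) : supdist (gpt R s) (parent R s) <= h * 2^-1 ^+ r.
    apply: le_trans (parent_dist R s) _.
    rewrite exprSr exprD; apply: (@le_trans _ _ (2^-1 ^+ l0 * 2^-1 ^+ r)).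
      by rewrite ler_piMr// ?mulr_ge0 ?exprn_ge0 ?invr_ge0//; lra.
    by rewrite ler_wpM2r// exprn_ge0// invr_ge0.
  have r1 : 2^-1 ^+ r <= 1 :> R by rewrite exprn_ile1 ?invr_ge0//; lra.
  have near c (s : gidx (l0 + r).+1) : `|centre c (gpt R s) - centre c (parent R s)| <= h.
    apply: le_trans (centre_dist _ _ _) _; apply: le_trans (dist s) _.
    by rewrite ler_piMr// ltW.
  have supp (s : gidx (l0 + r).+1) i j k : K s i j k != 0 ->
      kap (gpt R s) i j k != 0 \/ kap (parent R s) i j k != 0.
    rewrite /K; have [->|] := eqVneq (kap (gpt R s) i j k) 0; last by left.
    by rewrite sub0r oppr_eq0; right.
  have := @error_max _ K (fun s => centre bb (gpt R s))
    (fun s => centre (~~ bb) (gpt R s)) (2^-1 ^+ r) lam' (gidx_gt0 _) _ lam'0.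
  move=> H; apply: (@le_trans _ _ (Ex P (fun a => \big[Num.max/0]_s
      `|bil (K s) (fun i j => b i j a) (fun i j => err i j a)|)%R)); last first.
    apply: le_trans (H _ _ _ _ _ _) _.
    + by rewrite exprn_ge0// invr_ge0.
    + by move=> s; exact/centre_itv/gpt_tri.
    + by move=> s; exact/centre_itv/gpt_tri.
    + move=> s i j k; apply: le_trans (K3 _ _ _ _ _ (gpt_tri R s) (parent_tri R s)) _.
      by rewrite ler_wpM2l// ler_pdivrMr// mulrC.
    + move=> s i j k /supp[/(K1 _ _ _ _ (gpt_tri R s))|/(K1 _ _ _ _ (parent_tri R s))][e1 e2].
        by split; lra.
      split.
        have := ler_distD (centre bb (parent R s)) (x i j) (centre bb (gpt R s)).
        by have := near bb s; rewrite [X in X <= h]distrC; lra.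
      have := ler_distD (centre (~~ bb) (parent R s)) (x i k) (centre (~~ bb) (gpt R s)).
      by have := near (~~ bb) s; rewrite [X in X <= h]distrC; lra.
    + move=> tn0 s i j k /supp[]; first exact/pred/gpt_tri.
      exact/pred/parent_tri.
    by rewrite lee_fin lerD2r ler_pM2r ?invr_gt0// ln_gidx.
  apply: Ex_le => a; first exact: bigmax_ge_id.
  rewrite /incmax; apply: le_bigmax2 => s _.
  by rewrite /X bilB.
Qed.

End ErrorProcess.

(** * Independent centred curves *)

Section CentredProcess.
Context (d : measure_display) (T : measurableType d) (R : realType).
Context (P : probability T R) (S : finType) (G : S -> set (set T)).
Hypothesis sG : forall s, sigma_algebra setT (G s).
Hypothesis mG : forall s, G s `<=` measurable.
Hypothesis indG : mutually_independent P G.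
Variables (n : nat) (src : 'I_n -> S).
Hypothesis src_inj : injective src.

Definition src_before (q : nat) : {set S} :=
  [set s | [exists i : 'I_n, (i < q)%N && (s == src i)]].

Let src_filtration : filtration P (fun q => sources G (src_before q))
  (fun q => sources G (if insub q is Some i then [set src i] else finset.set0)) n.
Proof.
apply: (filtration_of sG mG indG) => [q s qn|q qn].
  rewrite inE => /existsP[i /andP[iq /eqP ->]].
  rewrite insubT /= inE; apply/eqP => /src_inj iE.
  by move: iq; rewrite iE /= ltnn.
rewrite insubT /=; apply/fintype.subsetP => s; rewrite !inE => /orP[/existsP[i /andP[iq sE]]|/eqP ->].
  by apply/existsP; exists i; rewrite sE (ltn_trans iq).
by apply/existsP; exists (Ordinal qn); rewrite /= ltnSn eqxx.
Qed.

Hypothesis n0 : (0 < n)%N.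
Variables (Y : 'I_n -> R * R -> T -> R) (f : 'I_n -> T -> R) (V : 'I_n -> R).
Hypothesis mY : forall i t, measurable_wrt (sources G [set src i]) (Y i t).
Hypothesis mf : forall i, measurable_fun setT (f i).
Hypothesis Yc : forall i t, tri t -> (P.-integrable setT (fun a => (Y i t a)%:E) /\
  \int[P]_a (Y i t a)%:E = 0)%E.
Hypothesis fV : forall i, (Ex P (fun a => f i a ^+ 2)%R <= (V i)%:E)%E.

Let V0 i : 0 <= V i.
Proof. by rewrite -lee_fin; apply: le_trans (fV i); apply: Ex_ge0 => a; exact: sqr_ge0. Qed.

Let centred_max (I : finType) (Z : 'I_n -> I -> T -> R) (s lam : R) :
  (0 < #|I|)%N -> 0 < lam ->
  (forall i c, measurable_wrt (sources G [set src i]) (Z i c)) ->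
  (forall i c, P.-integrable setT (fun a => (Z i c a)%:E) /\
     \int[P]_a (Z i c a)%:E = 0)%E ->
  (forall i c a, `|Z i c a| <= s * f i a) ->
  (Ex P (fun a => \big[Num.max/0]_c `|n%:R^-1 * \sum_i Z i c a|)%R <=
    ((ln (2 * #|I|%:R) + 1) / lam +
      lam * s ^+ 2 * (8 * n%:R^-1 ^+ 2 * \sum_i V i))%:E)%E.
Proof.
move=> I0 lam0 mZ Zc Zf.
have nR : 0 < n%:R :> R by rewrite ltr0n.
pose xi i c a := n%:R^-1 * Z i c a.
have := nemirovski_ord src_filtration (xi := xi)
  (f := fun i a => n%:R^-1 * s * f i a)
  (V := fun i => (n%:R^-1 * s) ^+ 2 * V i) I0 lam0.
move=> H; apply: le_trans (_ : _ <= _)%E (le_trans (H _ _ _ _ _) _).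
- apply: Ex_le => a; first exact: bigmax_ge_id.
  by apply: le_bigmax2 => c _; rewrite mulr_sumr.
- move=> i c; rewrite valK; apply: measurable_funM; first exact: measurable_cst.
  exact: mZ.
- by move=> i; apply: measurable_funM.
- move=> i c a; rewrite /xi normrM gtr0_norm ?invr_gt0// -mulrA.
  by rewrite ler_pM2l ?invr_gt0.
- move=> i c; have [iZ EZ] := Zc i c; rewrite /xi; split.
    under eq_fun do rewrite EFinM; exact: integrableZl.
  under eq_integral do rewrite EFinM.
  by rewrite integralZl// EZ mule0.
- move=> i; rewrite [X in Ex _ X](_ : _ = fun a => (n%:R^-1 * s) ^+ 2 * f i a ^+ 2); last first.
    by apply/funext => a; rewrite exprMn.
  rewrite Ex_scale ?sqr_ge0//; [|by move=> a; exact: sqr_ge0|by apply: measurable_funX].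
  by rewrite [leRHS]EFinM; apply: lee_wpmul2l; rewrite ?lee_fin ?sqr_ge0.
rewrite lee_fin -mulr_sumr; apply: lerD.
  by rewrite ler_pM2r ?invr_gt0// lerDl.
by rewrite le_eqVlt; apply/orP; left; apply/eqP; ring.
Qed.

(** Chaining for a mean of independent centred processes whose increments are
    controlled, summand by summand, by a square-integrable random constant. *)
Lemma centred_process (l0 : nat) (rho lam : R) :
  0 < rho < 1 -> 0 < lam ->
  (forall i t a, tri t -> `|Y i t a| <= f i a) ->
  (forall i r (s : gidx (l0 + r).+1) a,
     `|Y i (gpt R s) a - Y i (parent R s) a| <= rho ^+ r * f i a) ->
  forall N, (Ex P (fun a => gridmax (l0 + N) (fun t => n%:R^-1 * \sum_i Y i t a))%R <=
    (chain_const rho * (l0.+1%:R / lam +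
       lam * (8 * n%:R^-1 ^+ 2 * \sum_i V i)))%:E)%E.
Proof.
move=> rho01 lam0 Yf Yinc; have /andP[r0 r1] := rho01.
have mY' i t : measurable_fun setT (Y i t).
  exact: (measurable_wrt_fun (@sources_measurable _ _ _ _ mG _) (@mY i t)).
apply: (chaining (X := fun t a => n%:R^-1 * \sum_i Y i t a)) => //.
- by rewrite mulr_ge0 ?mulr_ge0 ?sqr_ge0// sumr_ge0.
- by move=> t; meas; exact: mY'.
- move=> lam' lam'0.
  apply: le_trans (@centred_max _ (fun i (s : gidx l0) => Y i (gpt R s)) 1 lam' (gidx_gt0 l0) lam'0 _ _ _) _.
  + by move=> i s; exact: mY.
  + by move=> i s; exact/Yc/gpt_tri.
  + by move=> i s a; rewrite mul1r; exact/Yf/gpt_tri.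
  by rewrite lee_fin expr1n mulr1 lerD2r ler_pM2r ?invr_gt0// ln_gidx.
- move=> r lam' lam'0.
  pose Z i (s : gidx (l0 + r).+1) a := Y i (gpt R s) a - Y i (parent R s) a.
  apply: (@le_trans _ _ (Ex P (fun a => \big[Num.max/0]_s `|n%:R^-1 * \sum_i Z i s a|)%R)).
    apply: Ex_le => a; first exact: bigmax_ge_id.
    by rewrite /incmax; apply: le_bigmax2 => s _; rewrite -mulrBr -sumrB.
  apply: le_trans (@centred_max _ Z (rho ^+ r) lam' (gidx_gt0 _) lam'0 _ _ _) _.
  + by move=> i s; apply: measurable_funB; exact: mY.
  + move=> i s; have [i1 e1] := Yc i (gpt_tri R s).
    have [i2 e2] := Yc i (parent_tri R s).
    split; first exact: (integrableB _ i1 i2).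
    by rewrite (integralB _ i1 i2)// e1 e2 sube0.
  + by move=> i s a; exact: Yinc.
  by rewrite lee_fin lerD2r ler_pM2r ?invr_gt0// ln_gidx.
Qed.

End CentredProcess.

Section KernelSums.
Context (R : realType) (p : nat) (xs : 'I_p -> R).

(** The rows and the columns charged by [K] lie in two windows. *)
Lemma kernel_sum_le (K : 'I_p -> 'I_p -> R) (u v r s M : R) :
  0 <= s -> (forall j k, `|K j k| <= s) ->
  (forall j k, K j k != 0 -> `|xs j - u| <= r /\ `|xs k - v| <= r) ->
  #|[pred j | `|xs j - u| <= r]|%:R <= M ->
  #|[pred j | `|xs j - v| <= r]|%:R <= M ->
  \sum_j \sum_k `|K j k| <= M ^+ 2 * s.
Proof.
move=> s0 Ks supp uM vM; have M0 : 0 <= M by exact: le_trans uM.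
have inner j : \sum_k `|K j k| <= if `|xs j - u| <= r then M * s else 0.
  case: ifPn => ju; last first.
    rewrite big1// => k _; have [->|/supp[]] := eqVneq (K j k) 0; first exact: normr0.
    by rewrite (negbTE ju).
  apply: (@le_trans _ _ (\sum_(k in [pred k | `|xs k - v| <= r]) s)).
    rewrite [leRHS]big_mkcond /=; apply: ler_sum => k _; rewrite inE.
    case: ifPn => // kv; have [->|/supp[_]] := eqVneq (K j k) 0; first by rewrite normr0.
    by rewrite (negbTE kv).
  by rewrite sumr_const -[leLHS]mulr_natl ler_wpM2r.
apply: le_trans (ler_sum _ (fun j _ => inner j)) _.
rewrite -big_mkcond /= (_ : \sum_(i | _) _ = \sum_(i in [pred j | `|xs j - u| <= r]) (M * s)); last first.
  by apply: eq_bigl => j; rewrite inE.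
by rewrite sumr_const -[leLHS]mulr_natl expr2 -mulrA ler_wpM2r// mulr_ge0.
Qed.

Lemma kernel_form_le (K Q : 'I_p -> 'I_p -> R) (B s : R) :
  0 <= s -> \sum_j \sum_k `|K j k| <= B ->
  (forall j k, K j k != 0 -> `|Q j k| <= s) ->
  `|\sum_j \sum_k K j k * Q j k| <= B * s.
Proof.
move=> s0 KB Qs; apply: le_trans (ler_norm_sum _ _ _) _.
apply: (@le_trans _ _ ((\sum_j \sum_k `|K j k|) * s)); last by rewrite ler_wpM2r.
rewrite mulr_suml; apply: ler_sum => j _; apply: le_trans (ler_norm_sum _ _ _) _.
rewrite mulr_suml; apply: ler_sum => k _; rewrite normrM.
by have [->|/Qs Qs'] := eqVneq (K j k) 0; rewrite ?normr0 ?mul0r// ler_wpM2l.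
Qed.

End KernelSums.

Section KernelForms.
Context (R : realType) (n p : nat) (x : 'I_n -> 'I_p -> R) (h m A D : R).
Hypothesis h0 : 0 < h.
Hypothesis m0 : 0 < m.
Hypothesis D0 : 0 <= D.
Hypothesis wc : windows_card x h m A.
Variables (bb : bool) (kap : R * R -> 'I_n -> 'I_p -> 'I_p -> R).
Hypothesis kapP : kernel_conditions x h m D bb kap.

Let card i u r : 0 <= u <= 1 -> r <= 3 * h ->
  #|[pred j | `|x i j - u| <= r]|%:R <= A * m.
Proof.
move=> u01 r3; apply: le_trans (wc i u01); rewrite ler_nat; apply: subset_leq_card.
by apply/fintype.subsetP => j; rewrite !inE => e; apply: le_trans e _.
Qed.

Let A0 : (0 < n)%N -> 0 <= A.
Proof.
move=> n0; have := @card (Ordinal n0) 0 (3 * h) _ (lexx _).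
rewrite lexx ler01 => /(_ isT) => H; have := le_trans (ler0n _ _) H.
by rewrite pmulr_lge0.
Qed.

Lemma kernel_mass t i : tri t -> \sum_j \sum_k `|kap t i j k| <= D * A ^+ 2.
Proof.
move=> tt; have [K1 K2 _] := kapP; have hpos := h0.
have b1 := centre_itv bb tt; have b2 := centre_itv (~~ bb) tt.
have h3 : h <= 3 * h by lra.
apply: le_trans (kernel_sum_le _ (fun j k => K2 t i j k tt)
  (fun j k => K1 t i j k tt) (card i b1 h3) (card i b2 h3)) _.
  by rewrite divr_ge0// sqr_ge0.
by rewrite le_eqVlt; apply/orP; left; apply/eqP; field; rewrite gt_eqF.
Qed.

(** The supports at two points at distance at most [h] lie in common windows of
    twice the bandwidth. *)
Lemma kernel_near t t' i j k : tri t -> tri t' -> supdist t t' <= h ->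
  kap t i j k - kap t' i j k != 0 ->
  `|x i j - centre bb t| <= 2 * h /\ `|x i k - centre (~~ bb) t| <= 2 * h.
Proof.
move=> tt tt' th; have [K1 _ _] := kapP; have hpos := h0.
have [->|/(K1 _ _ _ _ tt)[e1 e2] _] := eqVneq (kap t i j k) 0; last by split; lra.
rewrite sub0r oppr_eq0 => /(K1 _ _ _ _ tt')[e1 e2].
have near c : `|centre c t' - centre c t| <= h.
  by rewrite distrC; exact: le_trans (centre_dist _ _ _) th.
split.
  have := ler_distD (centre bb t') (x i j) (centre bb t).
  by have := near bb; lra.
have := ler_distD (centre (~~ bb) t') (x i k) (centre (~~ bb) t).
by have := near (~~ bb); lra.
Qed.

Lemma kernel_increment_mass t t' i : tri t -> tri t' -> supdist t t' <= h ->
  \sum_j \sum_k `|kap t i j k - kap t' i j k| <= D * A ^+ 2 * (supdist t t' / h).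
Proof.
move=> tt tt' th; have [_ _ K3] := kapP; have hpos := h0.
have b1 := centre_itv bb tt; have b2 := centre_itv (~~ bb) tt.
have h3 : 2 * h <= 3 * h by lra.
apply: le_trans (kernel_sum_le _ (fun j k => K3 t t' i j k tt tt')
  (fun j k => @kernel_near t t' i j k tt tt' th) (card i b1 h3) (card i b2 h3)) _.
  by rewrite mulr_ge0// ?divr_ge0 ?sqr_ge0 ?supdist_ge0 ?(ltW h0).
by rewrite le_eqVlt; apply/orP; left; apply/eqP; field; rewrite !gt_eqF.
Qed.

End KernelForms.

(** * Regularity of smoothed functions of two arguments *)

Section HoelderForms.
Context (R : realType) (n p : nat) (x : 'I_n -> 'I_p -> R) (h m A D : R).
Hypothesis h0 : 0 < h.
Hypothesis m0 : 0 < m.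
Hypothesis D0 : 0 <= D.
Hypothesis wc : windows_card x h m A.
Variables (bb : bool) (kap : R * R -> 'I_n -> 'I_p -> 'I_p -> R).
Hypothesis kapP : kernel_conditions x h m D bb kap.
Hypothesis kap_lt : forall t i (j k : 'I_p), tri t -> kap t i j k != 0 -> (j < k)%N.
Hypothesis kap1 : forall t i, tri t -> \sum_j \sum_k kap t i j k = 1.
Variables (i : 'I_n) (Q : 'I_p -> 'I_p -> R) (F beta : R).
Hypothesis F0 : 0 <= F.
Hypothesis beta01 : 0 < beta <= 1.
Hypothesis QF : forall j k, `|Q j k| <= F.
Hypothesis Qh : forall j k j' k' : 'I_p, (j < k)%N -> (j' < k')%N ->
  `|Q j k - Q j' k'| <= F * Num.max `|x i j - x i j'| `|x i k - x i k'| `^ beta.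

Let form t := \sum_j \sum_k kap t i j k * Q j k.

Lemma kernel_form_bound t : tri t -> `|form t| <= D * A ^+ 2 * F.
Proof.
move=> tt; apply: kernel_form_le => //.
exact: (kernel_mass h0 m0 D0 wc kapP i tt).
Qed.

Let support t : tri t -> exists j k, kap t i j k != 0.
Proof.
move=> tt; apply: contrapT => H; have := kap1 i tt; rewrite big1 => [/eqP|j _].
  by rewrite eq_sym oner_eq0.
rewrite big1// => k _; apply/eqP; apply: contrapT => /negP K0.
by apply: H; exists j, k.
Qed.

Let Qh_le (j k j' k' : 'I_p) (y : R) : (j < k)%N -> (j' < k')%N -> 0 <= y ->
  `|x i j - x i j'| <= y -> `|x i k - x i k'| <= y ->
  `|Q j k - Q j' k'| <= F * y `^ beta.
Proof.
move=> jk jk' y0 e1 e2; apply: le_trans (Qh jk jk') _; rewrite ler_wpM2l//.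
by rewrite ge0_ler_powR ?nnegrE ?le_max ?normr_ge0// ?ge_max ?e1//; case/andP: beta01 => /ltW.
Qed.

Let powR_scale (c y : R) : 1 <= c -> 0 <= y -> (c * y) `^ beta <= c * y `^ beta.
Proof.
move=> c1 y0; have c0 : 0 <= c by exact: le_trans c1.
by rewrite powRM// ler_wpM2r ?powR_ge0// ler1_powR//; case/andP: beta01.
Qed.

Let centre_near t j k : tri t -> kap t i j k != 0 ->
  `|x i j - centre bb t| <= h /\ `|x i k - centre (~~ bb) t| <= h.
Proof. by move=> tt; have [K1 _ _] := kapP; exact: K1. Qed.

Let localize t j0 k0 : tri t -> kap t i j0 k0 != 0 ->
  `|form t - Q j0 k0| <= D * A ^+ 2 * (F * (2 * h) `^ beta).
Proof.
move=> tt n0; have hpos := h0.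
have -> : form t - Q j0 k0 = \sum_j \sum_k kap t i j k * (Q j k - Q j0 k0).
  under [RHS]eq_bigr do under eq_bigr do rewrite mulrBr.
  under [RHS]eq_bigr do rewrite sumrB -mulr_suml.
  by rewrite sumrB -mulr_suml kap1// mul1r.
have [a1 a2] := centre_near tt n0.
apply: kernel_form_le; first by rewrite mulr_ge0// powR_ge0.
  exact: (kernel_mass h0 m0 D0 wc kapP i tt).
move=> j k n1; have [b1 b2] := centre_near tt n1.
apply: Qh_le; [exact: kap_lt n1|exact: kap_lt n0|by lra| |].
- have := ler_distD (centre bb t) (x i j) (x i j0).
  by rewrite (distrC (centre bb t)); lra.
- have := ler_distD (centre (~~ bb) t) (x i k) (x i k0).
  by rewrite (distrC (centre (~~ bb) t)); lra.
Qed.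

(** Below the bandwidth the weights are Lipschitz at scale [h], and only the
    oscillation of [Q] over one window matters because the increments of the
    weights sum to zero; above it both forms are compared with [Q] itself. *)
Lemma kernel_form_hoelder t t' : tri t -> tri t' ->
  `|form t - form t'| <= (4 * (D * A ^+ 2) + 3) * F * supdist t t' `^ beta.
Proof.
move=> tt tt'; have hpos := h0; have /andP[be0 be1] := beta01.
have [j0 [k0 n0]] := support tt; have [j1 [k1 n1]] := support tt'.
set y := supdist t t'; have y0 : 0 <= y by exact: supdist_ge0.
have B0 : 0 <= D * A ^+ 2 by rewrite mulr_ge0 ?sqr_ge0.
have BF : 0 <= D * A ^+ 2 * F by rewrite mulr_ge0.
have yb : 0 <= y `^ beta by rewrite powR_ge0.
have hb : 0 <= h `^ beta by rewrite powR_ge0.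
have [a1 a2] := centre_near tt n0.
have BFy : 0 <= D * A ^+ 2 * F * y `^ beta by rewrite mulr_ge0.
have Fy : 0 <= F * y `^ beta by rewrite mulr_ge0.
have [yh|hy] := leP y h.
  have -> : form t - form t' = \sum_j \sum_k
      (kap t i j k - kap t' i j k) * (Q j k - Q j0 k0).
    under [RHS]eq_bigr do under eq_bigr do rewrite mulrBr mulrBl.
    under [RHS]eq_bigr do rewrite sumrB -mulr_suml !sumrB.
    rewrite [RHS]sumrB -mulr_suml !sumrB !kap1// subrr mul0r subr0.
    by [].
  have K j k : kap t i j k - kap t' i j k != 0 ->
      `|Q j k - Q j0 k0| <= F * (3 * h) `^ beta.
    move=> nz.
    have [b1 b2] := kernel_near h0 kapP tt tt' yh nz.
    have jk : (j < k)%N.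
      have [e|] := eqVneq (kap t i j k) 0; last exact: kap_lt.
      by apply: (@kap_lt t' i) => //; apply: contraNneq nz => ->; rewrite e subrr.
    apply: Qh_le; [exact: jk|exact: kap_lt n0|by lra| |].
    - have := ler_distD (centre bb t) (x i j) (x i j0).
      by rewrite (distrC (centre bb t)); lra.
    - have := ler_distD (centre (~~ bb) t) (x i k) (x i k0).
      by rewrite (distrC (centre (~~ bb) t)); lra.
  have F3 : 0 <= F * (3 * h) `^ beta by rewrite mulr_ge0// powR_ge0.
  apply: le_trans (kernel_form_le F3 (kernel_increment_mass h0 m0 D0 wc kapP i tt tt' yh) K) _.
  rewrite -/y; have [->|yn0] := eqVneq y 0.
    by rewrite mul0r mulr0 mul0r mulr_ge0// ?powR_ge0// mulr_ge0// addr_ge0// mulr_ge0.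
  have ypos : 0 < y by rewrite lt_neqAle eq_sym yn0.
  have ratio : y / h * h `^ beta <= y `^ beta.
    have -> : y `^ beta = (y / h) `^ beta * h `^ beta.
      by rewrite -powRM ?divr_ge0 ?ltW// divfK// gt_eqF.
    rewrite ler_wpM2r//; apply: ger1_powR => //.
    by rewrite divr_gt0//= ler_pdivrMr// mul1r.
  have h3 := powR_scale (_ : 1 <= 3) (ltW h0).
  apply: (@le_trans _ _ (D * A ^+ 2 * (y / h) * (F * (3 * h `^ beta)))).
    have BY : 0 <= D * A ^+ 2 * (y / h) by rewrite mulr_ge0// divr_ge0// ltW.
    by apply: ler_wpM2l => //; apply: ler_wpM2l => //; apply: h3; lra.
  rewrite (_ : _ * _ = 3 * (D * A ^+ 2 * F) * (y / h * h `^ beta)); last by ring.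
  apply: (@le_trans _ _ (3 * (D * A ^+ 2 * F) * y `^ beta)).
    by rewrite ler_wpM2l// mulr_ge0.
  by nra.
have l1 := localize tt n0; have l2 := localize tt' n1.
have [c1 c2] := centre_near tt' n1.
have near c : `|centre c t - centre c t'| <= y by exact: centre_dist.
have l3 : `|Q j0 k0 - Q j1 k1| <= F * (3 * y) `^ beta.
  apply: Qh_le; [exact: kap_lt n0|exact: kap_lt n1|by lra| |].
  - have := ler_distD (centre bb t) (x i j0) (x i j1).
    have := ler_distD (centre bb t') (centre bb t) (x i j1).
    by have := near bb; rewrite (distrC (centre bb t') (x i j1)); lra.
  - have := ler_distD (centre (~~ bb) t) (x i k0) (x i k1).
    have := ler_distD (centre (~~ bb) t') (centre (~~ bb) t) (x i k1).
    by have := near (~~ bb); rewrite (distrC (centre (~~ bb) t') (x i k1)); lra.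
have h2 := powR_scale (_ : 1 <= 2) (ltW h0).
have y3 := powR_scale (_ : 1 <= 3) y0.
have hyb : h `^ beta <= y `^ beta.
  by rewrite ge0_ler_powR ?nnegrE// ltW.
have H2 : (2 * h) `^ beta <= 2 * y `^ beta.
  by apply: le_trans (h2 _) _; [lra|rewrite ler_wpM2l].
have l4 : D * A ^+ 2 * (F * (2 * h) `^ beta) <= 2 * (D * A ^+ 2 * F * y `^ beta).
  rewrite (_ : 2 * (_ * _) = D * A ^+ 2 * (F * (2 * y `^ beta))); last by ring.
  by rewrite ler_wpM2l// ler_wpM2l.
have l5 : F * (3 * y) `^ beta <= 3 * (F * y `^ beta).
  rewrite mulrCA ler_wpM2l//; apply: y3; lra.
have := ler_distD (Q j0 k0) (form t) (form t').
have := ler_distD (Q j1 k1) (Q j0 k0) (form t').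
rewrite (distrC (Q j1 k1) (form t')) => g1 g2.
rewrite (_ : _ * _ * _ = 2 * (D * A ^+ 2 * F * y `^ beta) + 2 * (D * A ^+ 2 * F * y `^ beta)
   + 3 * (F * y `^ beta)); last by ring.
lra.
Qed.

End HoelderForms.

(** * Squared errors in windows *)

Section GaussianMoment.
Context (R : realType).

(** Completing the square at the integer nearest to [`|y| / 2]: a Gaussian
    exponential is bounded by countably many exponentials of linear functions,
    and those have moments by hypothesis. *)
Lemma exp_sqr_le_term (y : R) : exists k : nat,
  expR (y ^+ 2 / 4) <=
  expR 4^-1 * (expR (k%:R * y - k%:R ^+ 2) + expR (- (k%:R * y) - k%:R ^+ 2)).
Proof.
have z0 : 0 <= `|y| / 2 + 2^-1 by rewrite addr_ge0// divr_ge0.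
have /andP[t1 t2] := truncn_itv z0.
set k := Num.truncn _ in t1 t2; exists k.
have dist : `| `|y| / 2 - k%:R| <= 2^-1.
  by rewrite ler_norml; move: t2; rewrite -[k.+1%:R]natr1 => t2; apply/andP; split; lra.
have sq : (`|y| / 2 - k%:R) ^+ 2 <= 4^-1.
  rewrite -real_normK ?num_real// (_ : 4^-1 = 2^-1 ^+ 2); last by field.
  by rewrite ler_pXn2r ?nnegrE ?invr_ge0.
have key : expR (y ^+ 2 / 4) <= expR 4^-1 * expR (k%:R * `|y| - k%:R ^+ 2).
  rewrite -expRD ler_expR -(real_normK (num_real y)).
  rewrite (_ : `|y| ^+ 2 / 4 = k%:R * `|y| - k%:R ^+ 2 + (`|y| / 2 - k%:R) ^+ 2); first lra.
  by field.
apply: le_trans key _; rewrite ler_pM2l ?expR_gt0//.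
have [y0|y0] := leP 0 y; first by rewrite ger0_norm// lerDl expR_ge0.
by rewrite ltr0_norm// mulrN lerDr expR_ge0.
Qed.

(** The geometric sum of the means of the terms in [exp_sqr_le_term]. *)
Definition gauss_const : R :=
  expR 4^-1 * (2 / (1 - expR (- 2^-1)) ^+ 2).

Let rho : R := expR (- 2^-1).

Let rho01 : 0 < rho < 1.
Proof. by rewrite expR_gt0 expR_lt1; lra. Qed.

Context (d : measure_display) (T : measurableType d) (P : probability T R).

Lemma subgaussian_sqr (X : T -> R) (tau : R) : 0 < tau ->
  measurable_fun setT X ->
  (forall lam, (Ex P (fun a => expR (lam * X a)) <= (expR (lam ^+ 2 * tau / 2))%:E)%E) ->
  (Ex P (fun a => expR ((4 * tau)^-1 * X a ^+ 2)) <= gauss_const%:E)%E.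
Proof.
move=> tau0 mX mgf; set s := Num.sqrt tau.
have s0 : 0 < s by rewrite sqrtr_gt0.
have s2 : s ^+ 2 = tau by rewrite sqr_sqrtr// ltW.
pose y a := s^-1 * X a.
pose u k a := expR 4^-1 * (expR (k%:R * y a - k%:R ^+ 2) + expR (- (k%:R * y a) - k%:R ^+ 2)).
have my : measurable_fun setT y by apply: measurable_funM.
have u0 k a : 0 <= u k a by rewrite mulr_ge0 ?addr_ge0 ?expR_ge0.
have mu k : measurable_fun setT (u k) by rewrite /u; meas.
have mgfy (l : R) : (Ex P (fun a => expR (l * y a)) <= (expR (l ^+ 2 / 2))%:E)%E.
  have := mgf (l / s); rewrite (_ : (l / s) ^+ 2 * tau / 2 = l ^+ 2 / 2); last first.
    by rewrite -s2; field; rewrite gt_eqF.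
  rewrite (_ : (fun a => expR (l * y a)) = fun a => expR (l / s * X a))//.
  by apply/funext => a; rewrite /y mulrA.
have half (k : nat) (l : R) : l ^+ 2 = k%:R ^+ 2 ->
    (Ex P (fun a => expR (l * y a - k%:R ^+ 2)) <= (rho ^+ k)%:E)%E.
  move=> lk; rewrite (_ : (fun a => _) = fun a => expR (- k%:R ^+ 2) * expR (l * y a)); last first.
    by apply/funext => a; rewrite -expRD addrC.
  rewrite Ex_scale ?expR_ge0//; last by meas.
  apply: (@le_trans _ _ ((expR (- k%:R ^+ 2))%:E * (expR (l ^+ 2 / 2))%:E)%E).
    by apply: lee_wpmul2l; rewrite ?lee_fin ?expR_ge0.
  rewrite -EFinM -expRD lee_fin /rho -expRM_natl ler_expR lk.
  case: k {lk} => [|k]; first by rewrite expr0n/=; lra.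
  have : 1 <= k.+1%:R :> R by rewrite ler1n.
  by nra.
have Eu k : (Ex P (u k) <= (expR 4^-1 * (2 * rho ^+ k))%:E)%E.
  rewrite /u Ex_scale ?expR_ge0//; last by meas.
  rewrite [leRHS]EFinM; apply: lee_wpmul2l; first by rewrite lee_fin expR_ge0.
  rewrite Ex_add; [|by move=> a; exact: expR_ge0|by move=> a; exact: expR_ge0|by meas|by meas].
  rewrite (_ : 2 * rho ^+ k = rho ^+ k + rho ^+ k); last by ring.
  rewrite EFinD; apply: leeD; first exact: half.
  have := half k (- k%:R); rewrite sqrrN => /(_ erefl).
  by under [X in Ex _ X]eq_fun do rewrite mulNr.
apply: (@le_trans _ _ (\int[P]_a (\sum_(0 <= k <oo) (u k a)%:E))%E).
  apply: lower_integral_le => a; first by rewrite lee_fin expR_ge0.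
  have [k hk] := exp_sqr_le_term (y a).
  apply: (@le_trans _ _ (u k a)%:E).
    rewrite lee_fin (_ : (4 * tau)^-1 * X a ^+ 2 = y a ^+ 2 / 4)//.
    by rewrite /y -s2; field; rewrite gt_eqF.
  rewrite (nneseries_split 0 k.+1); last by move=> i _; rewrite lee_fin.
  rewrite add0n big_nat_recr//=; apply: (@le_trans _ _ (0 + (u k a)%:E + 0)%E).
    by rewrite add0e adde0.
  apply: leeD; first by rewrite leeD2r// sume_ge0// => i _; rewrite lee_fin.
  by apply: nneseries_ge0 => i _ _; rewrite lee_fin.
rewrite integral_nneseries//; last 2 first.
- by move=> k; exact/measurable_EFinP.
- by move=> k a _; rewrite lee_fin.
apply: lime_le; first by apply: is_cvg_nneseries => k _ _; apply: integral_ge0 => a _; rewrite lee_fin.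
apply: nearW => N.
apply: (@le_trans _ _ (\sum_(0 <= k < N) (expR 4^-1 * (2 * rho ^+ k))%:E)%E).
  by apply: lee_sum => k _; exact: Eu.
rewrite sumEFin lee_fin -mulr_sumr /gauss_const ler_pM2l ?expR_gt0//.
apply: le_trans (geometric_sum N rho01); rewrite big_mkord; apply: ler_sum => k _.
have /andP[r0 r1] := rho01.
by apply: ler_wpM2r; [rewrite exprn_ge0// ltW|rewrite ler_nat].
Qed.

Lemma gauss_const_ge1 : 1 <= gauss_const.
Proof.
have /andP[r0 r1] := rho01; rewrite /gauss_const -/rho -[leLHS]mul1r.
have e1 : 1 <= expR 4^-1 :> R by have := expR_ge1Dx (4^-1 : R); lra.
apply: ler_pM => //; rewrite ler_pdivlMr ?exprn_gt0 ?subr_gt0// mul1r.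
have q : 0 <= 1 - rho <= 1 by apply/andP; split; lra.
by case/andP: q => q0 q1; nra.
Qed.

End GaussianMoment.

Section ErrorWindows.
Context (d : measure_display) (T : measurableType d) (R : realType).
Context (P : probability T R) (S : finType) (G : S -> set (set T)).
Hypothesis sG : forall s, sigma_algebra setT (G s).
Hypothesis mG : forall s, G s `<=` measurable.
Hypothesis indG : mutually_independent P G.
Variables (n p : nat) (src : 'I_n -> 'I_p -> S).
Hypothesis src_inj : forall i j i' j', src i j = src i' j' -> i = i' /\ j = j'.
Variables (err : 'I_n -> 'I_p -> T -> R) (tau : R).
Hypothesis merr : forall i j, measurable_wrt (sources G [set src i j]) (err i j).
Hypothesis tau0 : 0 < tau.
Hypothesis mgf : forall i j lam,
  (Ex P (fun a => expR (lam * err i j a)) <= (expR (lam ^+ 2 * tau / 2))%:E)%E.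
Hypothesis n0 : (0 < n)%N.
Variables (x : 'I_n -> 'I_p -> R) (h m A : R) (l0 : nat).
Hypothesis h0 : 0 < h.
Hypothesis m0 : 0 < m.
Hypothesis hl0 : 2^-1 ^+ l0 <= h.
Hypothesis wc : windows_card x h m A.

Let merr' i j : measurable_fun setT (err i j).
Proof. exact: (measurable_wrt_fun (@sources_measurable _ _ _ _ mG _) (@merr i j)). Qed.

Let node (g : 'I_(2 ^ l0).+1) : R := g%:R / 2 ^+ l0.

Let node01 g : 0 <= node g <= 1.
Proof.
rewrite /node divr_ge0 ?exprn_ge0//= ler_pdivrMr ?exprn_gt0// mul1r.
by rewrite -natrX ler_nat -ltnS.
Qed.

Let wsum (g : 'I_(2 ^ l0).+1) (a : T) : R :=
  \sum_i \sum_(j | `|x i j - node g| <= 3 * h) err i j a ^+ 2.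

Let wsum0 g a : 0 <= wsum g a.
Proof. by rewrite sumr_ge0// => i _; rewrite sumr_ge0// => j _; exact: sqr_ge0. Qed.

Let mwsum g : measurable_fun setT (wsum g).
Proof. by rewrite /wsum; meas; exact: merr'. Qed.

(** Finitely many windows suffice: one of radius [3 * h] around a node of mesh at
    most [h] contains a given window of radius [2 * h]. *)
Definition sqr_windows (a : T) : R :=
  (n%:R * m)^-1 * \big[Num.max/0]_g `|wsum g a|.

Lemma sqr_windows_ge0 a : 0 <= sqr_windows a.
Proof. by rewrite mulr_ge0 ?bigmax_ge_id// invr_ge0 mulr_ge0// ltW. Qed.

Lemma measurable_sqr_windows : measurable_fun setT sqr_windows.
Proof. by rewrite /sqr_windows; meas; exact: mwsum. Qed.

Lemma sqr_windowsP a u : 0 <= u <= 1 ->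
  \sum_i \sum_(j | `|x i j - u| <= 2 * h) err i j a ^+ 2 <= n%:R * m * sqr_windows a.
Proof.
move=> /andP[u0 u1]; have hpos := h0.
have nm : 0 < n%:R * m by rewrite mulr_gt0// ltr0n.
have pl : 0 < 2 ^+ l0 :> R by rewrite exprn_gt0.
have ul : 0 <= u * 2 ^+ l0 by rewrite mulr_ge0// ltW.
have /andP[t1 t2] := truncn_itv ul.
have gl : (Num.truncn (u * 2 ^+ l0) < (2 ^ l0).+1)%N.
  by rewrite ltnS -(ler_nat R); apply: le_trans t1 _; rewrite natrX ler_piMl// ltW.
pose g := Ordinal gl.
have ug : `|u - node g| <= h.
  apply: le_trans hl0; rewrite /node /=.
  rewrite -(ler_pM2r pl) exprVn mulVf ?gt_eqF//.
  rewrite -[X in _ * X]gtr0_norm// -normrM mulrBl divfK ?gt_eqF//.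
  by rewrite ger0_norm ?subr_ge0// lerBlDr addrC natr1 ltW.
rewrite /sqr_windows mulrA mulfV ?gt_eqF// mul1r.
apply: (@le_trans _ _ (wsum g a)); last first.
  by rewrite -[leLHS]ger0_norm//; exact: (le_bigmax _ (fun g => `|wsum g a|)).
apply: ler_sum => i _; rewrite big_mkcond [leRHS]big_mkcond /=; apply: ler_sum => j _.
case: ifPn => ju; last by case: ifP => // _; exact: sqr_ge0.
rewrite ifT//; have := ler_distD u (x i j) (node g).
by lra.
Qed.

(** The squared errors over a window have an exponential moment of the order of
    its cardinality, so that the union bound over the windows costs only the
    logarithm of their number. *)
Lemma sqr_windows_mean : 0 <= A ->
  (Ex P sqr_windows <=
    (4 * tau * (ln (gauss_const R) * A + 4 * l0.+1%:R / (n%:R * m)))%:E)%E.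
Proof.
move=> A0; set c0 := ln (gauss_const R); set th := (4 * tau)^-1.
have th0 : 0 < th by rewrite invr_gt0 mulr_gt0.
have c00 : 0 <= c0 by rewrite ln_ge0// gauss_const_ge1.
have nm : 0 < n%:R * m by rewrite mulr_gt0// ltr0n.
have nR : 0 < n%:R :> R by rewrite ltr0n.
set M := c0 * (n%:R * m * A).
have M0 : 0 <= M by rewrite mulr_ge0// mulr_ge0// ltW.
have gpos : 0 < gauss_const R by exact: lt_le_trans ltr01 (gauss_const_ge1 R).
have en g : (Ex P (fun a => expR (- (th * wsum g a) - M)) <= 1)%E.
  rewrite -(Ex_cst P 1); apply: Ex_le => a; first exact: expR_ge0.
  rewrite -(expR0 R) ler_expR; have : 0 <= th * wsum g a by rewrite mulr_ge0// ltW.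
  by lra.
have ep g : (Ex P (fun a => expR (th * wsum g a - M)) <= 1)%E.
  pose y i k (a b : T) := if `|x i k - node g| <= 3 * h
    then expR (th * err i k b ^+ 2 - c0) else 1.
  have y1 i k a : (Ex P (y i k a) <= 1)%E.
    rewrite /y; case: (`|x i k - node g| <= 3 * h); last by rewrite Ex_cst.
    rewrite (_ : (fun b => _) = fun b => expR (- c0) * expR (th * err i k b ^+ 2)); last first.
      by apply/funext => b; rewrite -expRD addrC.
    have mi := @merr' i k.
    rewrite Ex_scale ?expR_ge0//; last by meas.
    apply: (@le_trans _ _ ((expR (- c0))%:E * (gauss_const R)%:E)%E).
      by apply: lee_wpmul2l; rewrite ?lee_fin ?expR_ge0//; exact: subgaussian_sqr.
    by rewrite -EFinM expRN /c0 lnK ?posrE// mulVf// gt_eqF.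
  apply: le_trans (@ordered_product _ _ _ P _ _ sG mG indG _ _ _ src_inj y _ _ y1).
  - apply: Ex_le => a; first exact: expR_ge0.
    have -> : \prod_i \prod_k y i k a a = expR (\sum_i \sum_(k | `|x i k - node g| <= 3 * h)
        (th * err i k a ^+ 2 - c0)).
      rewrite expR_sum; apply: eq_bigr => i _; rewrite expR_sum [RHS]big_mkcond.
      by apply: eq_bigr => k _; rewrite /y; case: ifP.
    rewrite ler_expR.
    have -> : \sum_i \sum_(k | `|x i k - node g| <= 3 * h) (th * err i k a ^+ 2 - c0) =
       th * wsum g a - \sum_i c0 * #|[pred k | `|x i k - node g| <= 3 * h]|%:R.
      rewrite /wsum mulr_sumr -sumrB; apply: eq_bigr => i _.
      by rewrite sumrB -mulr_sumr sumr_const mulr_natr.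
    rewrite lerD2l lerN2 /M; apply: (@le_trans _ _ (\sum_(i < n) c0 * (A * m))).
      by apply: ler_sum => i _; rewrite ler_wpM2l// wc.
    rewrite sumr_const card_ord -[leLHS]mulr_natl le_eqVlt; apply/orP; left; apply/eqP.
    by ring.
  - by move=> i k a b; rewrite /y; case: ifP => // _; exact: expR_ge0.
  - move=> i k; rewrite /y; case: (`|x i k - node g| <= 3 * h); last exact: measurable_cst.
    apply: measurable_exp; apply: measurable_funB; last exact: measurable_cst.
    apply: measurable_funM; first exact: measurable_cst.
    apply: measurable_funX.
    exact: (measurable_wrt2_r (G := sources G (before src i k)) (@merr i k)).
have I0 : (0 < #|'I_(2 ^ l0).+1|)%N by rewrite card_ord.
have mM : measurable_fun [set: T] (fun=> M) by exact: measurable_cst.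
have := max_of_exponential I0 th0 mwsum mM (fun=> M0) ep en.
move=> H; rewrite /sqr_windows Ex_scale; first last.
- by meas; exact: mwsum.
- by move=> a; exact: bigmax_ge_id.
- by rewrite invr_ge0 ltW.
apply: (@le_trans _ _ (((n%:R * m)^-1)%:E * ((th^-1)%:E * (M + 4 * l0.+1%:R)%:E))%E); last first.
  rewrite -!EFinM lee_fin le_eqVlt; apply/orP; left; apply/eqP.
  by rewrite /M /th; field; rewrite !gt_eqF.
apply: lee_wpmul2l; first by rewrite lee_fin invr_ge0 ltW.
apply: le_trans H _; apply: lee_wpmul2l; first by rewrite lee_fin invr_ge0 ltW.
rewrite Ex_cst -EFinD lee_fin lerD2l.
apply: le_trans (ln_gidx R l0); rewrite lerD2r ler_ln ?posrE ?mulr_gt0 ?ltr0n ?gidx_gt0//.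
rewrite ler_pM2l// ler_nat card_prod !card_ord; set q := (2 ^ l0)%N; nia.
Qed.

End ErrorWindows.

(** * Taylor expansion on the triangle and the bias *)

Section Taylor1.
Context (R : realType).
Implicit Types (c y t B : R) (a : nat -> R).

Definition taylor_poly a (m : nat) t : R := \sum_(s < m) a s * t ^+ s / s`!%:R.

Lemma is_derive_taylor_poly a m t :
  is_derive t 1 (taylor_poly a m.+1) (taylor_poly (fun s => a s.+1) m t).
Proof.
elim: m => [|m IH].
  rewrite (_ : taylor_poly a 1 = cst (a 0%N)); last first.
    by apply/funext => u; rewrite /taylor_poly big_ord_recr big_ord0/= add0r expr0 fact0 mulr1 divr1.
  by rewrite /taylor_poly big_ord0; exact: is_derive_cst.
rewrite (_ : taylor_poly a m.+2 =
    taylor_poly a m.+1 \+ (fun u => (a m.+1 / (m.+1)`!%:R) *: (u ^+ m.+1 : R^o))); last first.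
  apply/funext => u; rewrite /taylor_poly big_ord_recr/=; congr (_ + _).
  by rewrite /GRing.scale/= mulrAC.
rewrite [X in is_derive _ _ _ X](_ : _ = taylor_poly (fun s => a s.+1) m t +
    (a m.+1 / (m.+1)`!%:R) *: ((m.+1%:R * t ^+ m) *: (1 : R^o))); last first.
  rewrite /taylor_poly big_ord_recr/=; congr (_ + _).
  rewrite /GRing.scale/= mulr1 factS natrM; field.
  by rewrite nat1r !pnatr_eq0 -lt0n fact_gt0.
apply: is_deriveD; apply: is_deriveZ.
have := @is_deriveX R R^o id m.+1 t 1 1 _ => /(_ (is_derive_id _ _)).
by rewrite (_ : (id : R -> R) ^+ m.+1 = fun u => u ^+ m.+1)//; apply/funext => u; rewrite fctE.
Qed.

Let between c y t := Num.min c y <= t <= Num.max c y.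

(** The remainder of order [m] is the primitive, from [c], of the remainder of
    order [m - 1] of the derivative. *)
Lemma taylor1 (g : nat -> R -> R) m c y B : 0 <= B ->
  (forall s t, (s < m)%N -> between c y t -> is_derive t 1 (g s) (g s.+1 t)) ->
  (forall t, between c y t -> `|g m t - g m c| <= B) ->
  `|g 0%N y - taylor_poly (fun s => g s c) m.+1 (y - c)| <= B * `|y - c| ^+ m.
Proof.
move=> B0; elim: m g y => [|m IH] g y dg gB.
  rewrite /taylor_poly big_ord_recr big_ord0/= add0r !expr0 fact0 mulr1 divr1 mulr1.
  by apply: gB; rewrite /between le_max ge_min !lexx !orbT.
pose r t := g 0%N t - taylor_poly (fun s => g s c) m.+2 (t - c).
pose r' t := g 1%N t - taylor_poly (fun s => g s.+1 c) m.+1 (t - c).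
have dr t : between c y t -> is_derive t 1 r (r' t).
  move=> ct; apply: is_deriveB; first exact: dg.
  have := @is_derive1_comp R (taylor_poly (fun s => g s c) m.+2) (fun u => u - c) t _ 1
    (is_derive_taylor_poly _ m.+1 (t - c)).
  rewrite mulr1; apply.
  rewrite -[X in is_derive _ _ _ X](subr0 1); apply: is_deriveB.
have r'B t : between c y t -> `|r' t| <= B * `|y - c| ^+ m.
  move=> ct; have := IH (fun s => g s.+1) t _ _.
  have sub u : between c t u -> between c y u.
    move: ct; rewrite /between !ge_min !le_max => /andP[/orP[] ? /orP[] ?] /andP[/orP[] ? /orP[] ?];
    by apply/andP; split; apply/orP; (left; lra) || (right; lra).
  move=> H; apply: le_trans (H _ _) _.
  - by move=> s u sm /sub cu; exact: dg.
  - by move=> u /sub cu; exact: gB.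
  rewrite ler_wpM2l// lerXn2r ?nnegrE//.
  move: ct; rewrite /between ge_min le_max.
  have [h1|h1] := leP 0 (t - c); have [h2|h2] := leP 0 (y - c);
  rewrite ?(ger0_norm h1) ?(ltr0_norm h1) ?(ger0_norm h2) ?(ltr0_norm h2) => /andP[/orP[] ? /orP[] ?]; lra.
have rc : r c = 0.
  rewrite /r subrr /taylor_poly big_ord_recl /= expr0 fact0 mulr1 divr1 big1 ?addr0 ?subrr// => s _.
  by rewrite /bump/= exprS mul0r mulr0 mul0r.
have cont (a b : R) : (forall t, t \in `[a, b] -> between c y t) -> {within `[a, b], continuous r}.
  move=> ab; apply: derivable_within_continuous => t tab.
  by have [] := dr t (ab t tab).
rewrite -/(r y) -[r y]subr0 -rc exprSr mulrA.
have [cy|yc] := leP c y.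
  have sub t : t \in `[c, y] -> between c y t.
    by rewrite in_itv/= /between => /andP[? ?]; rewrite min_l// max_r//; apply/andP.
  have [|t tcy ->] := MVT_segment cy _ (cont _ _ sub) (df := r').
  - move=> t tcy; apply: dr; apply: sub; exact: subset_itv_oo_cc.
  by rewrite normrM ler_wpM2r//; apply: r'B; exact: sub.
have sub t : t \in `[y, c] -> between c y t.
  by rewrite in_itv/= /between => /andP[? ?]; rewrite (min_r (ltW yc)) (max_l (ltW yc)); apply/andP.
have [|t tcy E] := MVT_segment (ltW yc) _ (cont _ _ sub) (df := r').
- move=> t tcy; apply: dr; apply: sub; exact: subset_itv_oo_cc.
rewrite distrC E normrM (distrC c y) ler_wpM2r//; apply: r'B; exact: sub.
Qed.

End Taylor1.

Section Taylor2.
Context (R : realType).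

Lemma fact_inv_le1 r : (r`!%:R)^-1 <= 1 :> R.
Proof. by rewrite invf_le1 ?ltr0n ?fact_gt0// ler1n fact_gt0. Qed.

Definition taylor_poly2 (c : nat -> nat -> R) (k : nat) (s t : R) : R :=
  \sum_(r1 < k.+1) \sum_(r2 < k.+1 | (r1 + r2 <= k)%N)
    c r1 r2 * (s ^+ r1 / r1`!%:R) * (t ^+ r2 / r2`!%:R).

Lemma taylor_poly2_swap c k s t :
  taylor_poly2 c k s t = taylor_poly2 (fun r1 r2 => c r2 r1) k t s.
Proof.
rewrite /taylor_poly2; under eq_bigr do rewrite big_mkcond.
rewrite exchange_big /=; apply: eq_bigr => r1 _; rewrite [RHS]big_mkcond.
by apply: eq_bigr => r2 _; rewrite addnC; case: ifP => // _; ring.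
Qed.

Let between (c y t : R) := Num.min c y <= t <= Num.max c y.

(** Two expansions in one variable, along the path from [(u, v)] to [(a, b)]
    through the corner [(u, b)]; the first one leaves the derivatives at the
    corner, which the second one expands in turn. *)
Lemma taylor2_path (D : nat -> nat -> R -> R -> R) (k : nat) (u v a b h B : R) :
  0 <= B -> `|a - u| <= h -> `|b - v| <= h ->
  (forall r t, (r < k)%N -> between u a t ->
     is_derive t 1 (fun t => D r 0%N t b) (D r.+1 0%N t b)) ->
  (forall r s t, (r + s < k)%N -> between v b t ->
     is_derive t 1 (fun t => D r s u t) (D r s.+1 u t)) ->
  (forall t, between u a t -> `|D k 0%N t b - D k 0%N u b| <= B) ->
  (forall r t, (r <= k)%N -> between v b t ->
     `|D r (k - r)%N u t - D r (k - r)%N u v| <= B) ->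
  `|D 0%N 0%N a b - taylor_poly2 (fun r s => D r s u v) k (a - u) (b - v)|
    <= k.+2%:R * B * h ^+ k.
Proof.
move=> B0 ah bh d1 d2 B1 B2.
have h0 : 0 <= h by exact: le_trans ah.
have first := taylor1 (g := fun r t => D r 0%N t b) B0 d1 B1.
pose rem (r : 'I_k.+1) : R := D r 0%N u b -
  taylor_poly (fun s => D r s u v) (k - r).+1 (b - v).
have second (r : 'I_k.+1) : `|rem r| <= B * `|b - v| ^+ (k - r).
  have rk : (r <= k)%N by rewrite -ltnS.
  apply: (taylor1 (g := fun s t => D r s u t)) => //.
  - by move=> s t sk; apply: d2; lia.
  - by move=> t; exact: B2.
have E : taylor_poly (fun r => D r 0%N u b) k.+1 (a - u) -
    taylor_poly2 (fun r s => D r s u v) k (a - u) (b - v) =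
    \sum_(r < k.+1) rem r * ((a - u) ^+ r / r`!%:R).
  rewrite /taylor_poly -sumrB; apply: eq_bigr => r _.
  have rk : (r <= k)%N by rewrite -ltnS.
  rewrite -mulrA mulrBl; congr (_ - _); rewrite /taylor_poly mulr_suml.
  rewrite [RHS](big_ord_widen_cond k.+1 (fun _ => true)
    (fun s => D r s u v * (b - v) ^+ s / s`!%:R * ((a - u) ^+ r / r`!%:R))) ?ltnS ?leq_subr//.
  apply: eq_big => [s|s _]; first by rewrite /= ltnS leq_subRL.
  by ring.
rewrite -[D 0%N 0%N a b](subrK (taylor_poly (fun r => D r 0%N u b) k.+1 (a - u))).
rewrite -[X in `|X|]addrA E.
apply: le_trans (ler_normD _ _) _.
have hk : B * `|a - u| ^+ k <= B * h ^+ k.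
  by rewrite ler_wpM2l// lerXn2r ?nnegrE.
have terms : `|\sum_(r < k.+1) rem r * ((a - u) ^+ r / r`!%:R)| <= k.+1%:R * (B * h ^+ k).
  apply: le_trans (ler_norm_sum _ _ _) _.
  rewrite (_ : k.+1%:R * _ = \sum_(r < k.+1) (B * h ^+ k)); last first.
    by rewrite sumr_const card_ord -[RHS]mulr_natl.
  apply: ler_sum => r _; have rk : (r <= k)%N by rewrite -ltnS.
  have hkr : h ^+ k = h ^+ (k - r) * h ^+ r by rewrite -exprD subnK.
  rewrite normrM hkr mulrA; apply: ler_pM => //.
    apply: le_trans (second r) _; rewrite ler_wpM2l//.
    by rewrite lerXn2r ?nnegrE.
  rewrite normrM normrX [X in _ * X <= _]ger0_norm ?invr_ge0// -[leRHS]mulr1.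
  by apply: ler_pM; rewrite ?exprn_ge0 ?invr_ge0 ?fact_inv_le1// lerXn2r ?nnegrE.
have := lerD (le_trans first hk) terms; rewrite -(natr1 k.+1); lra.
Qed.

End Taylor2.

Section HoelderTriangle.
Context (R : realType).

Lemma sfloor_lt (gamma : R) : 0 < gamma -> (sfloor gamma)%:R < gamma.
Proof.
move=> g0; rewrite /sfloor; elim/big_rec: _ => [//|k y kg yg].
by rewrite /maxn; case: ifP.
Qed.

Variables (gamma L : R) (f : R * R -> R) (D : nat * nat -> R * R -> R).
Hypothesis gamma0 : 0 < gamma.
Let k := sfloor gamma.
Hypothesis fD : derivatives_on_tri k f D.
Hypothesis DL : (hoelder_norm gamma D <= L%:E)%E.

Let sup_norm : \bar R := ereal_sup [set `|D sv.1 sv.2|%:E | sv in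
     [set sv : (nat * nat) * (R * R) | (sv.1.1 + sv.1.2 <= k)%N /\ tri sv.2]].
Let sup_quot : \bar R := ereal_sup [set (`|D svw.1 svw.2.1 - D svw.1 svw.2.2|
        / Num.max `|svw.2.1.1 - svw.2.2.1| `|svw.2.1.2 - svw.2.2.2|
            `^ (gamma - k%:R))%:E | svw in
     [set svw : (nat * nat) * ((R * R) * (R * R)) |
        (svw.1.1 + svw.1.2 = k)%N /\
        [/\ tri svw.2.1, tri svw.2.2 & svw.2.1 <> svw.2.2]]].

Let tri00 : tri ((0, 0) : R * R). Proof. by split=> //=; rewrite lexx ler01. Qed.
Let tri01 : tri ((0, 1) : R * R). Proof. by split=> //=; rewrite ler01 lexx. Qed.

Let sup_norm0 : (0 <= sup_norm)%E.
Proof.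
apply: (@le_trans _ _ (`|D (0%N, 0%N) (0, 0)|%:E)); first by rewrite lee_fin.
by apply: ereal_sup_ubound; exists ((0%N, 0%N), (0, 0)).
Qed.

Let sup_quot0 : (0 <= sup_quot)%E.
Proof.
pose q : (nat * nat) * ((R * R) * (R * R)) := ((k, 0%N), ((0, 0), (0, 1))).
apply: (@le_trans _ _ ((`|D q.1 q.2.1 - D q.1 q.2.2|
        / Num.max `|q.2.1.1 - q.2.2.1| `|q.2.1.2 - q.2.2.2| `^ (gamma - k%:R))%:E)).
  by rewrite lee_fin divr_ge0// powR_ge0.
apply: ereal_sup_ubound; exists q => //; split; first by rewrite /= addn0.
split=> //= -[] /eqP; by rewrite eq_sym oner_eq0.
Qed.

Lemma hoelder_sup s v : (s.1 + s.2 <= k)%N -> tri v -> `|D s v| <= L.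
Proof.
move=> sk tv; rewrite -lee_fin; apply: le_trans DL.
apply: (@le_trans _ _ (sup_norm + 0)%E); last by rewrite leeD2l.
by rewrite adde0; apply: ereal_sup_ubound; exists (s, v).
Qed.

Lemma hoelder_increment s v w : (s.1 + s.2 = k)%N -> tri v -> tri w ->
  `|D s v - D s w| <= L * supdist v w `^ (gamma - k%:R).
Proof.
move=> sk tv tw; have L0 : 0 <= L.
  by apply: le_trans (hoelder_sup _ tv) => //; rewrite -?sk.
have [->|/eqP vw] := eqVneq v w; first by rewrite subrr normr0 mulr_ge0// powR_ge0.
have sd : 0 < supdist v w.
  rewrite lt_neqAle supdist_ge0 andbT eq_sym; apply/eqP => sd0; apply: vw.
  have : `|v.1 - w.1| <= 0 by rewrite -sd0 le_max lexx.
  have : `|v.2 - w.2| <= 0 by rewrite -sd0 le_max lexx orbT.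
  rewrite !normr_le0 !subr_eq0 => /eqP e2 /eqP e1.
  by move: e1 e2; case: (v) (w) => [? ?] [? ?] /= -> ->.
rewrite -ler_pdivrMr ?powR_gt0// -lee_fin; apply: le_trans DL.
apply: (@le_trans _ _ (0 + sup_quot)%E); last by rewrite leeD2r.
by rewrite add0e; apply: ereal_sup_ubound; exists (s, (v, w)).
Qed.

Let L0 : 0 <= L.
Proof. by apply: le_trans (hoelder_sup (s := (0%N, 0%N)) _ tri00). Qed.

Let tri_int_tri v : tri_int v -> @tri R v.
Proof. by move=> [? [? ?]]; split; [|split]; exact: ltW. Qed.

Let inc_h s v w (h : R) : (s.1 + s.2 = k)%N -> tri_int v -> tri_int w -> 0 <= h ->
  supdist v w <= h -> `|D s v - D s w| <= L * h `^ (gamma - k%:R).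
Proof.
move=> sk tv tw h0 vwh; apply: le_trans (hoelder_increment sk (tri_int_tri tv) (tri_int_tri tw)) _.
rewrite ler_wpM2l// ge0_ler_powR ?nnegrE ?supdist_ge0//.
by rewrite subr_ge0 ltW// sfloor_lt.
Qed.

Let pow_h (h : R) : 0 < h -> L * h `^ (gamma - k%:R) * h ^+ k = L * h `^ gamma.
Proof.
move=> h0; rewrite -mulrA -powR_mulrn ?ltW// -powRD ?subrK//.
by rewrite gt_eqF// implybT.
Qed.

Let poly (P Q : R * R) := taylor_poly2 (fun r s => D (r, s) P) k (Q.1 - P.1) (Q.2 - P.2).

(** One of the two corners of the rectangle spanned by two interior points of
    the triangle is interior, and so is the axis-parallel path through it. *)
Lemma taylor_interior (P Q : R * R) (h : R) : 0 < h -> tri_int P -> tri_int Q ->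
  supdist Q P <= h ->
  `|f Q - poly P Q| <= k.+2%:R * (L * h `^ gamma).
Proof.
have [D0 _ Dx Dy] := fD.
case: P Q => u v [a b] h0 tP tQ; rewrite /supdist ge_max /= => /andP[ah bh].
have [u0 [uv v1]] := tP; have [a0 [ab b1]] := tQ.
rewrite -(D0 (a, b)); last exact: tri_int_tri.
rewrite /= in u0 uv v1 a0 ab b1.
have LB : 0 <= L * h `^ (gamma - k%:R) by rewrite mulr_ge0// powR_ge0.
have btw (c y t z : R) : `|y - c| <= z -> Num.min c y <= t <= Num.max c y -> `|t - c| <= z.
  rewrite ge_min le_max !ler_norml => /andP[? ?] /andP[/orP[] ? /orP[] ?]; apply/andP; split; lra.
have triu : u < b \/ a < v by have [|] := ltP u b; [left|right; lra].
rewrite -(pow_h h0) mulrA; case: triu => [ub|av].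
  have ct t : Num.min u a <= t <= Num.max u a -> tri_int (t, b).
    rewrite ge_min le_max => /andP[/orP[] ? /orP[] ?]; split=> /=; lra.
  have cb t : Num.min v b <= t <= Num.max v b -> tri_int (u, t).
    rewrite ge_min le_max => /andP[/orP[] ? /orP[] ?]; split=> /=; lra.
  have cu : tri_int (u, b) by apply: ct; rewrite ge_min le_max !lexx.
  apply: (taylor2_path (D := fun r s x y => D (r, s) (x, y)) LB ah bh).
  - by move=> r t rk tt; apply: (Dx (r, 0%N) (t, b)) => //=; [rewrite addn0|exact: ct].
  - by move=> r s t rk tt; apply: (Dy (r, s) (u, t)) => //=; exact: cb.
  - move=> t tt; apply: inc_h; rewrite ?addn0//; [exact: ct|exact: ltW|].
    by rewrite /supdist /= ge_max subrr normr0 (ltW h0) andbT; exact: btw ah tt.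
  - move=> r t rk tt; apply: inc_h => /=; rewrite ?subnKC//; [exact: cb|exact: ltW|].
    by rewrite /supdist /= ge_max subrr normr0 (ltW h0) /=; exact: btw bh tt.
rewrite /poly taylor_poly2_swap /=.
have ct t : Num.min v b <= t <= Num.max v b -> tri_int (a, t).
  rewrite ge_min le_max => /andP[/orP[] ? /orP[] ?]; split=> /=; lra.
have cb t : Num.min u a <= t <= Num.max u a -> tri_int (t, v).
  rewrite ge_min le_max => /andP[/orP[] ? /orP[] ?]; split=> /=; lra.
have cu : tri_int (a, v) by apply: ct; rewrite ge_min le_max !lexx.
apply: (taylor2_path (D := fun r s x y => D (s, r) (y, x)) LB bh ah).
- by move=> r t rk tt; apply: (Dy (0%N, r) (a, t)) => //=; exact: ct.
- by move=> r s t rk tt; apply: (Dx (s, r) (t, v)) => //=; [rewrite addnC|exact: cb].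
- move=> t tt; apply: inc_h => //; [exact: ct|exact: ltW|].
  by rewrite /supdist /= ge_max subrr normr0 (ltW h0) /=; exact: btw bh tt.
- move=> r t rk tt; apply: inc_h => /=; rewrite ?subnK//; [exact: cb|exact: ltW|].
  by rewrite /supdist /= ge_max subrr normr0 (ltW h0) andbT; exact: btw ah tt.
Qed.

End HoelderTriangle.

Section TaylorClosure.
Context (R : realType).

Let shrink (t : R) (P : R * R) : R * R :=
  ((1 - t) * P.1 + t / 3, (1 - t) * P.2 + t * (2 / 3)).

Let shrink_int (t : R) P : 0 < t <= 1 -> tri P -> tri_int (shrink t P).
Proof.
case: P => u v /andP[t0 t1] [/= u0 [uv v1]].
have q0 : 0 <= 1 - t by lra.
have a1 : 0 <= (1 - t) * u by exact: mulr_ge0.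
have a2 : (1 - t) * u <= (1 - t) * v by exact: ler_wpM2l.
have a3 : (1 - t) * v <= (1 - t) * 1 by exact: ler_wpM2l.
by split; [|split] => /=; lra.
Qed.

Let harm01 n : 0 < (harmonic n : R) <= 1.
Proof. by rewrite /harmonic /= invr_gt0 ltr0n invf_le1 ?ltr0n// ler1n. Qed.

Let shrink1 n (P : R * R) : tri P -> tri (shrink (harmonic n) P).
Proof.
by move=> tP; have [? [? ?]] := shrink_int (harm01 n) tP; split; [|split]; exact: ltW.
Qed.

Let cvg_affine (a b : R) : (fun n => (1 - harmonic n) * a + harmonic n * b) @ \oo --> a.
Proof.
have H := @cvg_harmonic R.
have : (fun n => (1 - harmonic n) * a + harmonic n * b) @ \oo --> (1 - 0) * a + 0 * b.
  by apply: cvgD; apply: cvgM => //; [apply: cvgB => //|..]; exact: cvg_cst.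
by rewrite subr0 mul1r mul0r addr0.
Qed.

Let shrink_cvg P : shrink (harmonic n) P @[n --> \oo] --> P.
Proof.
case: P => u v; exact: (@cvg_pair _ _ _ _ (nbhs u) (nbhs v) _ _ _ _ _ (@cvg_affine u _) (@cvg_affine v _)).
Qed.

Let cvg_shrink (g : R * R -> R) (P : R * R) : {within @tri R, continuous g} -> tri P ->
  g (shrink (harmonic n) P) @[n --> \oo] --> g P.
Proof.
move=> /subspace_continuousP cg tP.
apply: (cvg_comp (fun n => shrink (harmonic n) P) g); last exact: cg.
move=> A; rewrite /within/= => nA.
have near_tri : \forall n \near \oo, tri (shrink (harmonic n) P) ->
    A (shrink (harmonic n) P) by exact: (shrink_cvg nA).
by apply: filterS near_tri => n; apply; exact: shrink1.
Qed.

Variables (gamma L : R) (f : R * R -> R).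
Hypothesis gamma0 : 0 < gamma.
Hypothesis fL : hoelder_class gamma L f.
Let k := sfloor gamma.

(** The expansion passes from the interior to the boundary along points shrunk
    towards [(1/3, 2/3)], because the derivatives are continuous up to the
    boundary. *)
Lemma taylor_tri (P : R * R) : tri P -> exists c : nat -> nat -> R,
  c 0%N 0%N = f P /\ forall (Q : R * R) h, tri Q -> 0 < h -> supdist Q P <= h ->
  `|f Q - taylor_poly2 c k (Q.1 - P.1) (Q.2 - P.2)| <= k.+2%:R * (L * h `^ gamma).
Proof.
move=> tP; have [D [fD DL]] := fL; have [D0 Dc _ _] := fD.
exists (fun r s => D (r, s) P); split; first exact: D0.
move=> Q h tQ h0 QPh.
pose W n := f (shrink (harmonic n) Q) -
  taylor_poly2 (fun r s => D (r, s) (shrink (harmonic n) P)) k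
    ((shrink (harmonic n) Q).1 - (shrink (harmonic n) P).1)
    ((shrink (harmonic n) Q).2 - (shrink (harmonic n) P).2).
have Wle n : `|W n| <= k.+2%:R * (L * h `^ gamma).
  apply: (taylor_interior gamma0 fD DL h0) => //; try exact: shrink_int.
  have /andP[t0 t1] := harm01 n.
  apply: le_trans QPh; rewrite /supdist /shrink /=.
  have e (t i j z : R) : (1 - t) * i + z - ((1 - t) * j + z) = (1 - t) * (i - j) by ring.
  rewrite !e !normrM.
  have q0 : 0 <= 1 - (harmonic n : R) by rewrite subr_ge0.
  have q1 : 1 - (harmonic n : R) <= 1 by rewrite lerBlDr lerDl ltW.
  rewrite (ger0_norm q0) ge_max !le_max !ler_piMl ?normr_ge0// ?orbT//.
have cW : W n @[n --> \oo] --> f Q -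
    taylor_poly2 (fun r s => D (r, s) P) k (Q.1 - P.1) (Q.2 - P.2).
  apply: cvgB.
    rewrite (_ : (fun n => f _) = fun n => D (0%N, 0%N) (shrink (harmonic n) Q)); last first.
      by apply/funext => n; rewrite D0//; exact: shrink1.
    by rewrite -(D0 Q)//; apply: cvg_shrink => //; exact: Dc.
  rewrite /taylor_poly2; apply: cvg_big => [|r1 _]; first exact: add_continuous.
  apply: cvg_big => [|r2 r12]; first exact: add_continuous.
  have cdiff : (shrink (harmonic n) Q).1 - (shrink (harmonic n) P).1 @[n --> \oo] --> Q.1 - P.1.
    by apply: cvgB; exact: cvg_affine.
  have cdiff2 : (shrink (harmonic n) Q).2 - (shrink (harmonic n) P).2 @[n --> \oo] --> Q.2 - P.2.
    by apply: cvgB; exact: cvg_affine.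
  apply: cvgM; first apply: cvgM.
  - exact/cvg_shrink/tP/Dc.
  - apply: cvgM; last exact: cvg_cst.
    exact: (cvg_comp _ _ cdiff (@exprn_continuous _ r1 _)).
  - apply: cvgM; last exact: cvg_cst.
    exact: (cvg_comp _ _ cdiff2 (@exprn_continuous _ r2 _)).
apply: (cvgr_to_le (cvg_norm cW)).
by apply: nearW => n; exact: Wle.
Qed.

Lemma hoelder_class_sup v : tri v -> `|f v| <= L.
Proof.
move=> tv; have [D [fD DL]] := fL; have [<-// _ _ _] := fD.
exact: (hoelder_sup DL (s := (0%N, 0%N))) tv.
Qed.

(** The weights annihilate all monomials of the Taylor polynomial at [P] but the
    constant one, whose coefficient is [f P]. *)
Lemma kernel_bias (p : nat) (xs : 'I_p -> R) (K : 'I_p -> 'I_p -> R) (P : R * R) (B h : R) :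
  tri P -> 0 < h -> \sum_j \sum_k0 `|K j k0| <= B ->
  (forall j k0, K j k0 != 0 -> tri (xs j, xs k0) /\ supdist (xs j, xs k0) P <= h) ->
  \sum_j \sum_k0 K j k0 = 1 ->
  (forall r1 r2 : nat, (1 <= r1 + r2 <= k)%N ->
     \sum_j \sum_k0 (xs j - P.1) ^+ r1 * (xs k0 - P.2) ^+ r2 * K j k0 = 0) ->
  `|\sum_j \sum_k0 K j k0 * f (xs j, xs k0) - f P| <= B * (k.+2%:R * (L * h `^ gamma)).
Proof.
move=> tP h0 KB supp K1 Kmom; have [c [c0 cT]] := taylor_tri tP.
pose T j k0 := taylor_poly2 c k (xs j - P.1) (xs k0 - P.2).
have repro : \sum_j \sum_k0 K j k0 * T j k0 = f P.
  have -> : \sum_j \sum_k0 K j k0 * T j k0 =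
    \sum_(r1 < k.+1) \sum_(r2 < k.+1 | (r1 + r2 <= k)%N)
      c r1 r2 / r1`!%:R / r2`!%:R *
      \sum_j \sum_k0 (xs j - P.1) ^+ r1 * (xs k0 - P.2) ^+ r2 * K j k0.
    under eq_bigr do under eq_bigr do rewrite mulr_sumr.
    under eq_bigr do rewrite exchange_big /=.
    rewrite exchange_big /=; apply: eq_bigr => r1 _.
    under eq_bigr do under eq_bigr do rewrite mulr_sumr.
    under eq_bigr do rewrite exchange_big /=.
    rewrite exchange_big /=; apply: eq_bigr => r2 _.
    rewrite mulr_sumr; apply: eq_bigr => j _; rewrite mulr_sumr.
    by apply: eq_bigr => k0 _; ring.
  rewrite big_ord_recl /= big_mkcond big_ord_recl /=.
  rewrite !fact0 !divr1 c0.
  under eq_bigr do under eq_bigr do rewrite !expr0 !mul1r.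
  rewrite K1 mulr1 big1 ?addr0 => [|r2 _]; last first.
    by case: ifP => // r2k; rewrite Kmom ?mulr0.
  rewrite big1 ?addr0// => r1 _; apply: big1 => r2 r12.
  by rewrite Kmom ?mulr0//.
have Lh : 0 <= k.+2%:R * (L * h `^ gamma).
  rewrite mulr_ge0// mulr_ge0 ?powR_ge0//.
  exact: le_trans (normr_ge0 _) (hoelder_class_sup tP).
rewrite -repro -sumrB; under eq_bigr do rewrite -sumrB.
under eq_bigr do under eq_bigr do rewrite -mulrBr.
apply: kernel_form_le => // j k0 /supp[tQ Qh].
exact: (cT (xs j, xs k0)).
Qed.

End TaylorClosure.

(** * From the process to the curves at the design points *)

Section CoordinateSpace.
Context (R : realType) (p : nat).

(** Vectors carry the sigma-algebra generated by the rectangles, on which the laws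
    of the curves are prescribed. *)
Definition rectangles : set (set ('I_p -> R)) :=
  [set A | exists2 B : 'I_p -> set R, (forall l, measurable (B l)) &
     A = \bigcap_l (fun z => z l) @^-1` (B l)].

Definition vec : Type := g_sigma_algebraType rectangles.
HB.instance Definition _ := Measurable.on vec.

Lemma rectanglesI : setI_closed rectangles.
Proof.
move=> _ _ [B mB ->] [C mC ->]; exists (fun l => B l `&` C l).
  by move=> l; exact: measurableI.
rewrite -bigcapI; apply: eq_bigcapr => l _; by rewrite preimage_setI.
Qed.

Lemma rectanglesT : rectangles setT.
Proof. by exists (fun=> setT) => //; apply/seteqP; split. Qed.

Lemma measurable_coord (j : 'I_p) : measurable_fun setT (fun z : vec => z j : R).
Proof.
move=> _ B mB; rewrite setTI; apply: sub_gen_smallest.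
exists (fun l => if l == j then B else setT) => [l|]; first by case: ifP.
apply/seteqP; split=> [z zB l _ /=|z /(_ j)/=]; last by rewrite eqxx; exact.
by case: eqP => [->|].
Qed.

Lemma measurable_vec d (T : measurableType d) (X : 'I_p -> T -> R) :
  (forall j, measurable_fun setT (X j)) ->
  measurable_fun setT (fun a => (fun j => X j a) : vec).
Proof.
move=> mX; apply: (@measurability _ _ T vec _ _ rectangles) => //.
move=> _ [_ [B mB ->] <-]; rewrite setTI preimage_bigcap.
apply: fin_bigcap_measurable; first exact: finite_finset.
by move=> l _; rewrite -[X in measurable X]setTI; exact: mX.
Qed.

End CoordinateSpace.

Section Transfer.
Context (R : realType) (n p : nat) (E : experiment R n p) (Z : process R).
Hypothesis EZ : iid_copies E Z.
Hypothesis cZ : centered_sq_integrable Z.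
Variables (i : 'I_n) (t : 'I_p -> R).
Hypothesis t01 : forall j, 0 <= t j <= 1.

Let ecurve (a : espace E) : vec R p := fun j => curve i (t j) a.
Let zcurve (a : pspace Z) : vec R p := fun j => Z (t j) a.

Let mecurve : measurable_fun setT ecurve.
Proof. by apply: measurable_vec => j; have [+ _] := EZ i; exact. Qed.

Let mzcurve : measurable_fun setT zcurve.
Proof. by apply: measurable_vec => j; have [] := cZ (t01 j). Qed.

HB.instance Definition _ := @isMeasurableFun.Build _ _ _ _ ecurve mecurve.
HB.instance Definition _ := @isMeasurableFun.Build _ _ _ _ zcurve mzcurve.

Let same_law (A : set (vec R p)) : measurable A ->
  distribution (elaw E) ecurve A = distribution (plaw Z) zcurve A.
Proof.
move=> mA; have rectT (k : nat) : @rectangles R p setT by exact: rectanglesT.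
apply: (@g_sigma_algebra_measure_unique _ R (vec R p) (@rectangles R p)
  _ (fun=> setT) rectT _ (distribution (elaw E) ecurve)
  (distribution (plaw Z) zcurve)) => //.
- by move=> B; exact: sub_gen_smallest.
- by rewrite bigcup_const.
- exact: rectanglesI.
- move=> _ [B mB ->]; have [_ law] := EZ i; have := law p t B t01 mB.
  have e1 : ecurve @^-1` (\bigcap_l (fun z : vec R p => z l) @^-1` (B l)) =
    \bigcap_l (curve i (t l) @^-1` B l) by rewrite preimage_bigcap.
  have e2 : zcurve @^-1` (\bigcap_l (fun z : vec R p => z l) @^-1` (B l)) =
    \bigcap_l (Z (t l) @^-1` B l) by rewrite preimage_bigcap.
  by rewrite -e1 -e2.
- by move=> _; apply: (@le_lt_trans _ _ 1%E); [exact: probability_le1|exact: ltry].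
Qed.

(** Only the finite-dimensional laws of a curve are known, which is all that the
    values at the design points depend on. *)
Lemma transfer_ge0 (g : vec R p -> R) : measurable_fun setT g -> (forall z, 0 <= g z) ->
  Ex (elaw E) (fun a => g (fun j => curve i (t j) a)) =
  Ex (plaw Z) (fun a => g (fun j => Z (t j) a)).
Proof.
move=> mg g0; have mg' : measurable_fun setT (EFin \o g) by exact/measurable_EFinP.
have g0' z : (0 <= (EFin \o g) z)%E by rewrite lee_fin.
have := ge0_integral_distribution (P := elaw E) ecurve mg' g0'.
have := ge0_integral_distribution (P := plaw Z) zcurve mg' g0'.
rewrite /Ex => <- <-; apply: eq_measure_integral => A mA _; exact: same_law.
Qed.

Lemma transfer_integrable (g : vec R p -> R) : measurable_fun setT g ->
  (plaw Z).-integrable setT (fun a => (g (fun j => Z (t j) a))%:E) ->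
  (elaw E).-integrable setT (fun a => (g (fun j => curve i (t j) a))%:E) /\
  (\int[elaw E]_a (g (fun j => curve i (t j) a))%:E =
   \int[plaw Z]_a (g (fun j => Z (t j) a))%:E)%E.
Proof.
move=> mg iZ; have mg' : measurable_fun setT (EFin \o g) by exact/measurable_EFinP.
have iE : (elaw E).-integrable setT (fun a => (g (fun j => curve i (t j) a))%:E).
  apply/integrableP; split; first exact: measurableT_comp mg' mecurve.
  have mn : measurable_fun setT (fun z => `|g z|) by exact: measurable_norm.
  have [_ fin] := elimT (integrableP _ _ _) iZ.
  by move: fin; rewrite -[X in (X < _)%E -> _](transfer_ge0 mn (fun z => normr_ge0 _)).
split=> //.
have := integral_distribution (P := elaw E) (X := ecurve) mg' iE.
have := integral_distribution (P := plaw Z) (X := zcurve) mg' iZ.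
move=> <- <-; apply: eq_measure_integral => A mA _; exact: same_law.
Qed.

End Transfer.

Section Envelope.
Context (R : realType) (p : nat) (xs : 'I_p -> R) (beta0 : R).

Definition vnorm (z : 'I_p -> R) : R := \big[Num.max/0]_j `|z j|.

Definition hoelder_quot (z : 'I_p -> R) : R :=
  \big[Num.max/0]_(jk : 'I_p * 'I_p | jk.1 != jk.2)
    (`|z jk.1 - z jk.2| / `|xs jk.1 - xs jk.2| `^ beta0).

(** It dominates the products [z j * z k] as well as their Hoelder quotients. *)
Definition envelope (z : 'I_p -> R) : R :=
  vnorm z ^+ 2 + 2 * (vnorm z * hoelder_quot z).

Lemma vnorm_ge0 z : 0 <= vnorm z. Proof. exact: bigmax_ge_id. Qed.

Lemma vnorm_ge z j : `|z j| <= vnorm z.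
Proof. exact: (le_bigmax _ (fun j => `|z j|)). Qed.

Lemma hoelder_quot_ge0 z : 0 <= hoelder_quot z. Proof. exact: bigmax_ge_id. Qed.

Lemma envelope_ge0 z : 0 <= envelope z.
Proof. by rewrite addr_ge0 ?sqr_ge0 ?mulr_ge0 ?vnorm_ge0 ?hoelder_quot_ge0. Qed.

Lemma vnorm_le_envelope z : vnorm z ^+ 2 <= envelope z.
Proof. by rewrite lerDl ?mulr_ge0 ?vnorm_ge0 ?hoelder_quot_ge0. Qed.

Lemma prod_le_envelope z j k : `|z j * z k| <= envelope z.
Proof.
apply: le_trans (vnorm_le_envelope z); rewrite normrM expr2.
by apply: ler_pM => //; exact: vnorm_ge.
Qed.

Hypothesis xs_inj : injective xs.
Hypothesis beta0P : 0 < beta0.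

Lemma hoelder_quotP z j k : `|z j - z k| <= hoelder_quot z * `|xs j - xs k| `^ beta0.
Proof.
have [->|jk] := eqVneq j k.
  by rewrite subrr normr0 mulr_ge0 ?hoelder_quot_ge0// powR_ge0.
have d0 : 0 < `|xs j - xs k|.
  by rewrite normr_gt0 subr_eq0; apply: contraNneq jk => /xs_inj ->.
rewrite -ler_pdivrMr ?powR_gt0//.
exact: (le_bigmax_cond 0 (j := (j, k)) (P := fun jk : 'I_p * 'I_p => jk.1 != jk.2)
  (fun jk => `|z jk.1 - z jk.2| / `|xs jk.1 - xs jk.2| `^ beta0) jk).
Qed.

Lemma envelope_hoelder z j k j' k' : `|z j * z k - z j' * z k'| <=
  envelope z * Num.max `|xs j - xs j'| `|xs k - xs k'| `^ beta0.
Proof.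
set y := Num.max _ _; have v0 := vnorm_ge0 z; have H0 := hoelder_quot_ge0 z.
have yb : 0 <= y `^ beta0 by exact: powR_ge0.
have y0 : 0 <= y by rewrite /y le_max normr_ge0.
have inc (a b : 'I_p) : `|xs a - xs b| <= y -> `|z a - z b| <= hoelder_quot z * y `^ beta0.
  move=> aby; apply: le_trans (hoelder_quotP z a b) _; rewrite ler_wpM2l//.
  by rewrite ge0_ler_powR ?nnegrE// ltW.
have -> : z j * z k - z j' * z k' = z j * (z k - z k') + (z j - z j') * z k' by ring.
apply: le_trans (ler_normD _ _) _; rewrite !normrM.
apply: (@le_trans _ _ (vnorm z * (hoelder_quot z * y `^ beta0) +
    hoelder_quot z * y `^ beta0 * vnorm z)).
  apply: lerD; apply: ler_pM; rewrite ?vnorm_ge//; apply: inc.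
    by rewrite /y le_max lexx orbT.
  by rewrite /y le_max lexx.
rewrite /envelope mulrDl (_ : _ + _ = 2 * (vnorm z * hoelder_quot z) * y `^ beta0); last by ring.
by rewrite lerDr mulr_ge0 ?sqr_ge0.
Qed.

Lemma measurable_vnorm : measurable_fun setT (vnorm : vec R p -> R).
Proof. by rewrite /vnorm; meas; exact: measurable_coord. Qed.

Lemma measurable_envelope : measurable_fun setT (envelope : vec R p -> R).
Proof.
have mv := measurable_vnorm.
have mh : measurable_fun setT (hoelder_quot : vec R p -> R).
  by rewrite /hoelder_quot; meas; exact: measurable_coord.
by rewrite /envelope; meas.
Qed.

End Envelope.

Section ProcessMoments.
Context (R : realType) (gamma L beta0 CZ : R) (Z : process R).
Hypothesis beta0P : 0 < beta0.
Hypothesis ZP : process_class gamma L beta0 CZ Z.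
Variables (p : nat) (xs : 'I_p -> R).
Hypothesis xs01 : forall j, 0 <= xs j <= 1.
Hypothesis xs_inj : injective xs.

Let cZ : centered_sq_integrable Z. Proof. by have [] := ZP. Qed.

Let zvec (a : pspace Z) : vec R p := fun j => Z (xs j) a.

Let mzvec : measurable_fun setT zvec.
Proof. by apply: measurable_vec => j; have [] := cZ (xs01 j). Qed.

(** The envelope is at most quadratic in [`|Z 0| + M], hence has a second moment;
    lowering the exponent from [beta] to [beta0] only increases the powers of
    distances at most one. *)
Lemma process_envelope :
  (Ex (plaw Z) (fun a => envelope xs beta0 (zvec a) ^+ 2)%R <= (72 * CZ)%:E)%E.
Proof.
have [_ [beta [M [/andP[b0b b1] M0 mom hold]]] _] := ZP.
have z01 : 0 <= (0 : R) <= 1 by rewrite lexx ler01.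
have [mZ0 _ _] := cZ z01.
pose U a := 72 * (M a ^+ 4 + Z 0 a ^+ 4).
have mM : measurable_fun setT M by [].
have p4 (y : R) : 0 <= y ^+ 4 by rewrite (exprM y 2 2) sqr_ge0.
have mU : measurable_fun setT U by rewrite /U; meas.
have menv : measurable_fun setT (fun a => envelope xs beta0 (zvec a)).
  exact: measurableT_comp (@measurable_envelope R p xs beta0) mzvec.
apply: (@le_trans _ _ (Ex (plaw Z) U)); last first.
  rewrite /U Ex_scale//; [|by move=> a; rewrite addr_ge0|by meas].
  rewrite [leRHS]EFinM; apply: lee_wpmul2l; first by rewrite lee_fin.
  rewrite Ex_add//; [|by meas|by meas].
  by move: mom; rewrite unlock.
apply: ae_ge0_le_integral => //.
- by move=> a _; rewrite lee_fin sqr_ge0.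
- by apply/measurable_EFinP; exact: measurable_funX.
- by move=> a _; rewrite lee_fin mulr_ge0// addr_ge0.
- exact/measurable_EFinP.
apply: filterS hold => a hold _; rewrite lee_fin.
have Ma := M0 a; set Y := `|Z 0 a| + M a.
have Y0 : 0 <= Y by rewrite addr_ge0// ltW.
have vY : vnorm (zvec a) <= Y.
  apply: bigmax_le => // j _.
  have -> : zvec a j = Z 0 a + (Z (xs j) a - Z 0 a) by rewrite addrC subrK.
  apply: le_trans (ler_normD _ _) _; rewrite lerD2l.
  apply: le_trans (hold _ _ (xs01 j) z01) _; apply: ler_piMr; first exact: ltW.
  rewrite subr0 [leRHS](_ : 1 = 1 `^ beta); last by rewrite powR1.
  rewrite ge0_ler_powR ?nnegrE//.
    exact: le_trans (ltW beta0P) b0b.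
  by have /andP[? ?] := xs01 j; rewrite ger0_norm.
have hM : hoelder_quot xs beta0 (zvec a) <= M a.
  apply: bigmax_le => [|[j k] /= jk]; first exact: ltW.
  have d0 : 0 < `|xs j - xs k|.
    by rewrite normr_gt0 subr_eq0; apply: contraNneq jk => /xs_inj ->.
  rewrite ler_pdivrMr ?powR_gt0//; apply: le_trans (hold _ _ (xs01 j) (xs01 k)) _.
  rewrite ler_pM2l//; apply: ger_powR => //.
  rewrite d0 /= ler_norml; have /andP[? ?] := xs01 j; have /andP[? ?] := xs01 k.
  by apply/andP; split; lra.
have hY : hoelder_quot xs beta0 (zvec a) <= Y by apply: le_trans hM _; rewrite lerDr.
have v0 := vnorm_ge0 (zvec a); have h0 := hoelder_quot_ge0 xs beta0 (zvec a).
have e3 : envelope xs beta0 (zvec a) <= 3 * Y ^+ 2.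
  have s1 : vnorm (zvec a) ^+ 2 <= Y ^+ 2 by rewrite lerXn2r ?nnegrE.
  have s2 : vnorm (zvec a) * hoelder_quot xs beta0 (zvec a) <= Y ^+ 2.
    by rewrite expr2 ler_pM.
  by rewrite /envelope; lra.
have e0 := envelope_ge0 xs beta0 (zvec a).
have Y2 : Y ^+ 2 <= 2 * (Z 0 a ^+ 2 + M a ^+ 2).
  by rewrite /Y -(real_normK (num_real (Z 0 a))); have := sqr_ge0 (`|Z 0 a| - M a); nra.
have e6 : envelope xs beta0 (zvec a) <= 6 * (Z 0 a ^+ 2 + M a ^+ 2) by lra.
apply: (@le_trans _ _ ((6 * (Z 0 a ^+ 2 + M a ^+ 2)) ^+ 2)).
  by rewrite lerXn2r ?nnegrE// mulr_ge0// addr_ge0 ?sqr_ge0.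
rewrite /U (exprM (M a) 2 2) (exprM (Z 0 a) 2 2).
by have := sqr_ge0 (Z 0 a ^+ 2 - M a ^+ 2); nra.
Qed.

Lemma process_product (j k : 'I_p) :
  (plaw Z).-integrable setT (fun a => (Z (xs j) a * Z (xs k) a)%:E) /\
  (\int[plaw Z]_a (Z (xs j) a * Z (xs k) a)%R%:E = (cov_kernel Z (xs j, xs k))%:E)%E.
Proof.
have mZ i : measurable_fun setT (Z (xs i)) by have [] := cZ (xs01 i).
have iZ : (plaw Z).-integrable setT (fun a => (Z (xs j) a * Z (xs k) a)%:E).
  apply/integrableP; split.
    by apply/measurable_EFinP; exact: measurable_funM.
  apply: (@le_lt_trans _ _ (Ex (plaw Z) (fun a => 1 + envelope xs beta0 (zvec a) ^+ 2))).
    apply: lower_integral_le => // a; rewrite lee_fin.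
    apply: le_trans (prod_le_envelope xs beta0 (zvec a) j k) _.
    by have := sqr_ge0 (envelope xs beta0 (zvec a) - 1); nra.
  rewrite Ex_add//; [|by move=> a; exact: sqr_ge0|].
    rewrite Ex_cst; apply: (@le_lt_trans _ _ (1 + (72 * CZ)%:E)%E); last exact: ltry.
    by rewrite leeD2l//; exact: process_envelope.
  apply: measurable_funX.
  exact: measurableT_comp (@measurable_envelope R p xs beta0) mzvec.
split=> //; rewrite /cov_kernel unlock fineK//.
exact: integrable_fin_num.
Qed.

Variables (n : nat) (E : experiment R n p) (i : 'I_n).
Hypothesis EZ : iid_copies E Z.

Let cvec (a : espace E) : 'I_p -> R := fun j => curve i (xs j) a.

Lemma measurable_curve_vec : measurable_fun setT (cvec : espace E -> vec R p).
Proof. by apply: measurable_vec => j; have [+ _] := EZ i; exact. Qed.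

Lemma curve_envelope :
  (Ex (elaw E) (fun a => envelope xs beta0 (cvec a) ^+ 2)%R <= (72 * CZ)%:E)%E.
Proof.
rewrite (transfer_ge0 EZ cZ i xs01 (g := fun z => envelope xs beta0 z ^+ 2)).
- exact: process_envelope.
- by apply: measurable_funX; exact: measurable_envelope.
- by move=> z; exact: sqr_ge0.
Qed.

Lemma curve_product (j k : 'I_p) :
  (elaw E).-integrable setT (fun a => (cvec a j * cvec a k)%:E) /\
  (\int[elaw E]_a (cvec a j * cvec a k)%R%:E = (cov_kernel Z (xs j, xs k))%:E)%E.
Proof.
have [iZ <-] := process_product j k.
apply: (transfer_integrable EZ cZ i xs01 (g := fun z => z j * z k)) iZ.
by apply: measurable_funM; exact: measurable_coord.
Qed.

Lemma curve_centred (j : 'I_p) :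
  (elaw E).-integrable setT (fun a => (cvec a j)%:E) /\
  (\int[elaw E]_a (cvec a j)%:E = 0)%E.
Proof.
have [mZ c0 _] := cZ (xs01 j).
have iZ : (plaw Z).-integrable setT (fun a => (Z (xs j) a)%:E).
  have [+ _] := process_product j j => /integrableP[_ fin].
  apply/integrableP; split; first exact/measurable_EFinP.
  apply: (@le_lt_trans _ _ (Ex (plaw Z) (fun a => 1 + `|Z (xs j) a * Z (xs j) a|))).
    apply: lower_integral_le => // a; rewrite lee_fin normrM -expr2.
    by have := sqr_ge0 (`|Z (xs j) a| - 1); nra.
  rewrite Ex_add//; last by meas.
  by rewrite Ex_cst lte_add_pinfty// ltry.
have [-> ->] := transfer_integrable EZ cZ i xs01 (@measurable_coord R p j) iZ.
by split=> //; move: c0; rewrite unlock.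
Qed.

End ProcessMoments.

(** * The errors as sources of randomness *)

Section ExperimentSources.
Context (R : realType) (n p : nat) (E : experiment R n p).

Definition source (s : 'I_n + 'I_n * 'I_p) : set (set (espace E)) :=
  match s with
  | inl i => sigma_gen (fun t : {t : R | 0 <= t <= 1} => curve i (sval t))
  | inr ij => sigma_gen (fun _ : unit => @err R n p E ij.1 ij.2)
  end.

Lemma sigma_gen_algebra (J : Type) (X : J -> espace E -> R) :
  sigma_algebra setT (sigma_gen X).
Proof. exact: smallest_sigma_algebra. Qed.

Lemma sigma_gen_measurable (J : Type) (X : J -> espace E -> R) :
  (forall j, measurable_fun setT (X j)) -> sigma_gen X `<=` measurable.
Proof.
move=> mX; apply: smallest_sub; first exact: sigma_algebra_measurable.
by move=> _ [j _ [B mB <-]]; exact: mX.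
Qed.

Definition sigma_gens (J : Type) (X : J -> espace E -> R) : set (set (espace E)) :=
  \bigcup_j preimage_set_system setT (X j) measurable.

Lemma measurable_sigma_gens (J : Type) (X : J -> espace E -> R) j :
  measurable_wrt (sigma_gens X) (X j).
Proof.
move=> _ B mB; rewrite setTI; apply: sub_gen_smallest.
by exists j => //; exists B => //; rewrite setTI.
Qed.

Variables (Z : process R) (sigma2 kappa : R).
Hypothesis EZ : iid_copies E Z.
Hypothesis indE : sources_independent E.
Hypothesis errE : error_conditions E sigma2 kappa.

Lemma source_algebra s : sigma_algebra setT (source s).
Proof. by case: s => [i|ij]; exact: sigma_gen_algebra. Qed.

Lemma source_measurable s : source s `<=` measurable.
Proof.
case: s => [i|[i j]]; apply: sigma_gen_measurable.
  by move=> [t t01]; have [+ _] := EZ i; exact.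
by move=> _; have [] := errE i j.
Qed.

Lemma source_independent : mutually_independent (elaw E) source.
Proof. exact: indE. Qed.

Lemma source_wrt (A : {set 'I_n + 'I_n * 'I_p}) s (f : espace E -> R) : s \in A ->
  (forall B, measurable B -> source s (f @^-1` B)) -> measurable_wrt (sources source A) f.
Proof.
move=> sA fB _ B mB; rewrite setTI; apply: sub_gen_smallest.
by exists s => //; exact: fB.
Qed.

Lemma curve_wrt (A : {set 'I_n + 'I_n * 'I_p}) i (t : R) : inl i \in A -> 0 <= t <= 1 ->
  measurable_wrt (sources source A) (curve i t).
Proof.
move=> iA t01; apply: (source_wrt iA) => B mB /=.
have := @measurable_sigma_gens _ (fun t : {t : R | 0 <= t <= 1} => curve i (sval t))
  (exist _ t t01) measurableT B mB.
by rewrite setTI.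
Qed.

Lemma err_wrt (A : {set 'I_n + 'I_n * 'I_p}) i j : inr (i, j) \in A ->
  measurable_wrt (sources source A) (@err R n p E i j).
Proof.
move=> ijA; apply: (source_wrt ijA) => B mB /=.
have := @measurable_sigma_gens _ (fun _ : unit => @err R n p E i j) tt measurableT B mB.
by rewrite setTI.
Qed.

(** A positive variance proxy common to all the errors. *)
Definition err_proxy : R := kappa ^+ 2 * `|sigma2| + 1.

Lemma err_proxy_gt0 : 0 < err_proxy.
Proof. by rewrite ltr_pwDr// mulr_ge0// sqr_ge0. Qed.

Let esq i j : (Ex (elaw E) (fun a => @err R n p E i j a ^+ 2)%R <= `|sigma2|%:E)%E.
Proof.
have [_ _ + _] := errE i j; rewrite unlock => /le_trans; apply.
by rewrite lee_fin ler_norm.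
Qed.

Lemma err_mgf i j lam : (Ex (elaw E) (fun a => expR (lam * @err R n p E i j a))%R <=
  (expR (lam ^+ 2 * err_proxy / 2))%:E)%E.
Proof.
have [_ _ _ /(_ lam)] := errE i j; rewrite unlock => /le_trans; apply.
rewrite lee_fin ler_expR ler_pM2r ?invr_gt0// -mulrA ler_wpM2l ?sqr_ge0//.
apply: (@le_trans _ _ (kappa ^+ 2 * `|sigma2|)); last by rewrite lerDl.
rewrite ler_wpM2l ?sqr_ge0//.
have := esq i j; rewrite /Ex; case: (X in (X <= _)%E -> fine X <= _) => [r||]//=.
Qed.

Lemma err_sqr i j : 1 <= kappa ->
  (Ex (elaw E) (fun a => @err R n p E i j a ^+ 2)%R <= err_proxy%:E)%E.
Proof.
move=> k1; apply: le_trans (esq i j) _; rewrite lee_fin /err_proxy.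
apply: (@le_trans _ _ (kappa ^+ 2 * `|sigma2|)); last by rewrite lerDl.
by rewrite ler_peMl// exprn_ege1.
Qed.

End ExperimentSources.

Section FrozenErrors.
Context (R : realType) (n p : nat) (E : experiment R n p).
Variables (Z : process R) (sigma2 kappa : R).
Hypothesis EZ : iid_copies E Z.
Hypothesis indE : sources_independent E.
Hypothesis errE : error_conditions E sigma2 kappa.
Hypothesis n0 : (0 < n)%N.
Variables (xs : 'I_n -> 'I_p -> R) (h m A D : R) (l0 : nat).
Hypothesis h0 : 0 < h.
Hypothesis m0 : 0 < m.
Hypothesis A0 : 0 <= A.
Hypothesis D0 : 0 <= D.
Hypothesis hl0 : 2^-1 ^+ l0 <= h.
Hypothesis wc : windows_card xs h m A.

Let tau := err_proxy sigma2 kappa.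

Definition mean_sqr_norm (z : 'I_n -> 'I_p -> R) : R :=
  n%:R^-1 * \sum_i vnorm (z i) ^+ 2.

Lemma mean_sqr_norm_ge0 z : 0 <= mean_sqr_norm z.
Proof. by rewrite mulr_ge0 ?invr_ge0// sumr_ge0// => i _; exact: sqr_ge0. Qed.

(** The bound of [sqr_windows_mean]. *)
Definition err_sqr_bound : R :=
  4 * tau * (ln (gauss_const R) * A + 4 * l0.+1%:R / (n%:R * m)).

Let windows_norm z u : 0 <= u <= 1 ->
  \sum_i \sum_(j | `|xs i j - u| <= 2 * h) z i j ^+ 2 <= n%:R * m * (A * mean_sqr_norm z).
Proof.
move=> u01; have hpos := h0; have nR : 0 < n%:R :> R by rewrite ltr0n.
rewrite (_ : n%:R * m * _ = \sum_i A * m * vnorm (z i) ^+ 2); last first.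
  by rewrite -mulr_sumr /mean_sqr_norm; field; rewrite gt_eqF.
apply: ler_sum => i _.
apply: (@le_trans _ _ (\sum_(j in [pred j | `|xs i j - u| <= 2 * h]) vnorm (z i) ^+ 2)).
  rewrite (eq_bigl (mem [pred j | `|xs i j - u| <= 2 * h])); last by move=> j; rewrite inE.
  apply: ler_sum => j _; rewrite -(real_normK (num_real (z i j))).
  by rewrite lerXn2r ?nnegrE ?vnorm_ge0// vnorm_ge.
rewrite sumr_const -[leLHS]mulr_natl ler_wpM2r ?sqr_ge0//.
apply: le_trans (wc i u01); rewrite ler_nat; apply: subset_leq_card.
apply/fintype.subsetP => j; rewrite !inE => e; apply: le_trans e _.
by rewrite ler_pM2r// ler_nat.
Qed.

(** [theta = 0] gives forms linear in the errors, [theta = 1] includes the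
    quadratic one. In that case the sum of squares over a window is random, but
    bounded in mean by [sqr_windows_mean]. *)
Lemma frozen_errors bb kap (z : 'I_n -> 'I_p -> R) (theta : R) (lam : R) :
  kernel_conditions xs h m D bb kap ->
  (theta != 0 -> forall t i (j k : 'I_p), tri t -> kap t i j k != 0 -> (j < k)%N) ->
  0 < lam ->
  forall N, (Ex (elaw E) (fun a => gridmax (l0 + N)
      (fun t => bil (kap t) (fun i j => z i j + theta * @err R n p E i j a) (fun i j => @err R n p E i j a)))%R <=
    (chain_const (2^-1 : R) * (l0.+1%:R / lam + lam *
       (tau * A ^+ 2 * D ^+ 2 * (2 * A * mean_sqr_norm z + 2 * theta ^+ 2 * err_sqr_bound)
         / (2 * n%:R * m))))%:E)%E.
Proof.
move=> kapP lt lam0 N.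
have nR : 0 < n%:R :> R by rewrite ltr0n.
have inj (i : 'I_n) (j : 'I_p) i' j' : inr (i, j) = inr (i', j') :> 'I_n + 'I_n * 'I_p ->
  i = i' /\ j = j' by case.
have merr i j : measurable_wrt (sources (@source R n p E) [set inr (i, j)]) (@err R n p E i j).
  by apply: err_wrt; rewrite inE.
have sG := @source_algebra R n p E.
have mG := source_measurable EZ errE.
have indG := source_independent indE.
have tau0 := err_proxy_gt0 sigma2 kappa.
pose sw := sqr_windows (@err R n p E) xs h m l0.
have msw : measurable_fun setT sw by exact: (measurable_sqr_windows mG merr).
have sw0 a : 0 <= sw a by exact: sqr_windows_ge0.
pose Q a := 2 * A * mean_sqr_norm z + 2 * theta ^+ 2 * sw a.
have c0 : 0 <= 2 * A * mean_sqr_norm z.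
  by rewrite mulr_ge0 ?mean_sqr_norm_ge0// mulr_ge0.
have t0 : 0 <= 2 * theta ^+ 2 by rewrite mulr_ge0 ?sqr_ge0.
apply: (error_process sG mG indG inj merr (ltW tau0) (err_mgf errE) n0 h0 m0 D0 wc
  (Q := Q) _ _ _ _ kapP lt lam0 hl0).
- by rewrite /Q; meas.
- by move=> a; rewrite /Q addr_ge0// mulr_ge0.
- rewrite /Q Ex_add//; [|by move=> a; rewrite mulr_ge0|by meas].
  rewrite Ex_cst EFinD leeD2l// Ex_scale// [leRHS]EFinM.
  apply: lee_wpmul2l; first by rewrite lee_fin.
  exact: (sqr_windows_mean sG mG indG inj merr tau0 (err_mgf errE) n0 h0 m0 hl0 wc A0).
- move=> a u u01.
  apply: (@le_trans _ _ (2 * (\sum_i \sum_(j | `|xs i j - u| <= 2 * h) z i j ^+ 2) +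
     2 * theta ^+ 2 * (\sum_i \sum_(j | `|xs i j - u| <= 2 * h) @err R n p E i j a ^+ 2))).
    rewrite !mulr_sumr -big_split; apply: ler_sum => i _ /=.
    rewrite !mulr_sumr -big_split; apply: ler_sum => j _ /=.
    by have := sqr_ge0 (z i j - theta * @err R n p E i j a); nra.
  have wz := windows_norm z u01.
  have ws : \sum_i \sum_(j | `|xs i j - u| <= 2 * h) @err R n p E i j a ^+ 2 <= n%:R * m * sw a.
    exact: (sqr_windowsP _ n0 xs h0 m0 hl0).
  apply: le_trans (lerD (ler_wpM2l _ wz) (ler_wpM2l t0 ws)) _ => //.
  by rewrite le_eqVlt; apply/orP; left; apply/eqP; rewrite /Q; ring.
Qed.

End FrozenErrors.

(** * Terms free of the pre-estimation *)

Section SourceTerms.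
Context (R : realType) (n p : nat) (E : experiment R n p).
Variables (gamma L beta0 CZ : R) (Z : process R) (sigma2 kappa : R).
Hypothesis beta01 : 0 < beta0 <= 1.
Hypothesis CZ0 : 0 < CZ.
Hypothesis ZP : process_class gamma L beta0 CZ Z.
Hypothesis EZ : iid_copies E Z.
Hypothesis indE : sources_independent E.
Hypothesis errE : error_conditions E sigma2 kappa.
Hypothesis n0 : (0 < n)%N.
Variables (xs : 'I_n -> 'I_p -> R) (h m A D : R) (l0 : nat).
Hypothesis xs01 : forall i j, 0 <= xs i j <= 1.
Hypothesis xs_inj : forall i, injective (xs i).
Hypothesis h0 : 0 < h.
Hypothesis m0 : 0 < m.
Hypothesis A0 : 0 <= A.
Hypothesis D0 : 0 <= D.
Hypothesis hl0 : 2^-1 ^+ l0 <= h.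
Hypothesis wc : windows_card xs h m A.

Let tau := err_proxy sigma2 kappa.
Let P := elaw E.
Let cv i j a : R := @curve R n p E i (xs i j) a.
Let er i j a : R := @err R n p E i j a.

(** The second moment of the envelope is at most [72 * CZ] by [curve_envelope], and
    its mean at most one more. *)
Definition moment_bound : R := 1 + 72 * CZ.

Lemma moment_bound_ge0 : 0 <= moment_bound.
Proof. by have cz := CZ0; rewrite /moment_bound; lra. Qed.

Definition curve_sources : {set 'I_n + 'I_n * 'I_p} :=
  [set s | if s is inl _ then true else false].
Definition error_sources : {set 'I_n + 'I_n * 'I_p} :=
  [set s | if s is inr _ then true else false].

Let sG := @source_algebra R n p E.
Let mG := source_measurable EZ errE.
Let indG := source_independent indE.

Let beta0P : 0 < beta0. Proof. by case/andP: beta01. Qed.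

Lemma measurable_cv i j : measurable_fun setT (cv i j).
Proof. by have [+ _] := EZ i; apply. Qed.

Lemma measurable_er i j : measurable_fun setT (er i j).
Proof. by have [] := errE i j. Qed.

Lemma measurable_env i :
  measurable_fun setT (fun a => envelope (xs i) beta0 (cv i ^~ a)).
Proof.
exact: (measurableT_comp (@measurable_envelope R p (xs i) beta0)
  (measurable_curve_vec (xs01 i) i EZ)).
Qed.

Lemma measurable_cv_norm i : measurable_fun setT (fun a => vnorm (cv i ^~ a)).
Proof.
exact: (measurableT_comp (@measurable_vnorm R p)
  (measurable_curve_vec (xs01 i) i EZ)).
Qed.

Lemma env_sqr i : (Ex P (fun a => envelope (xs i) beta0 (cv i ^~ a) ^+ 2)%R
  <= moment_bound%:E)%E.
Proof.
apply: le_trans (curve_envelope beta0P ZP (xs01 i) (@xs_inj i) i EZ) _.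
by rewrite lee_fin /moment_bound lerDr.
Qed.

Lemma env_mean i : (Ex P (fun a => envelope (xs i) beta0 (cv i ^~ a))
  <= moment_bound%:E)%E.
Proof.
have me := measurable_env i.
apply: (@le_trans _ _ (Ex P (fun a => 1 + envelope (xs i) beta0 (cv i ^~ a) ^+ 2))).
  apply: Ex_le => a; first exact: envelope_ge0.
  by have := sqr_ge0 (envelope (xs i) beta0 (cv i ^~ a) - 1); nra.
rewrite Ex_add//; [|by move=> a; exact: sqr_ge0|by meas].
rewrite Ex_cst /moment_bound EFinD leeD2l//.
exact: (curve_envelope beta0P ZP (xs01 i) (@xs_inj i) i EZ).
Qed.

Lemma norm_sqr_mean i : (Ex P (fun a => vnorm (cv i ^~ a) ^+ 2)%R <= moment_bound%:E)%E.
Proof.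
apply: le_trans (env_mean i); apply: Ex_le => a; first exact: sqr_ge0.
exact: vnorm_le_envelope.
Qed.

Lemma mean_sqr_norm_mean :
  (Ex P (fun a => mean_sqr_norm (fun i j => cv i j a)) <= moment_bound%:E)%E.
Proof.
have nR : 0 < n%:R :> R by rewrite ltr0n.
have mv := measurable_cv_norm.
rewrite /mean_sqr_norm Ex_scale ?invr_ge0//; first last.
- by meas.
- by move=> a; rewrite sumr_ge0// => i _; exact: sqr_ge0.
rewrite Ex_sum; [|by move=> i a; exact: sqr_ge0|by move=> i; apply: measurable_funX; exact: mv].
apply: (@le_trans _ _ ((n%:R^-1)%:E * (\sum_(i < n) moment_bound%:E))%E).
  apply: lee_wpmul2l; first by rewrite lee_fin invr_ge0.
  by apply: lee_sum => i _; exact: norm_sqr_mean.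
rewrite sumEFin sumr_const card_ord -EFinM lee_fin -[X in _ * X]mulr_natl mulrA mulVf ?mul1r//.
by rewrite gt_eqF.
Qed.

Let indep : independent2 P <<s sources (@source R n p E) curve_sources >>
   <<s sources (@source R n p E) error_sources >>.
Proof.
apply: (sources_independent2 sG mG indG) => s; rewrite !inE.
by case: s.
Qed.

Lemma measurable_gridmax d (T : measurableType d) (kap : R * R -> 'I_n -> 'I_p -> 'I_p -> R)
    (b c : 'I_n -> 'I_p -> T -> R) l :
  (forall i j, measurable_fun setT (b i j)) ->
  (forall i j, measurable_fun setT (c i j)) ->
  measurable_fun setT (fun a =>
    gridmax l (fun t => bil (kap t) (fun i j => b i j a) (fun i j => c i j a))).
Proof.
move=> mb mc; apply: measurable_bigmax => s; apply: measurable_norm.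
rewrite /bil; apply: measurable_funM; first exact: measurable_cst.
apply: measurable_sum => i; apply: measurable_sum => j; apply: measurable_sum => k.
by apply: measurable_funM => //; apply: measurable_funM => //; exact: measurable_cst.
Qed.

(** The curves are frozen first; the bound for frozen ones is affine in their mean
    squared norm. *)
Lemma error_terms bb kap (theta lam : R) :
  kernel_conditions xs h m D bb kap ->
  (theta != 0 -> forall t i (j k : 'I_p), tri t -> kap t i j k != 0 -> (j < k)%N) ->
  0 < lam ->
  forall N, (Ex P (fun a => gridmax (l0 + N)
      (fun t => bil (kap t) (fun i j => cv i j a + theta * er i j a) (fun i j => er i j a)))%R <=
    (chain_const (2^-1 : R) * (l0.+1%:R / lam + lam *
       (tau * A ^+ 2 * D ^+ 2 * (2 * A * moment_bound +
          2 * theta ^+ 2 * err_sqr_bound n sigma2 kappa m A l0)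
         / (2 * n%:R * m))))%:E)%E.
Proof.
move=> kapP lt lam0 N; have nR : 0 < n%:R :> R by rewrite ltr0n.
pose f a b := gridmax (l0 + N)
  (fun t => bil (kap t) (fun i j => cv i j a + theta * er i j b) (fun i j => er i j b)).
set esb := err_sqr_bound n sigma2 kappa m A l0.
pose g q := chain_const (2^-1 : R) * (l0.+1%:R / lam + lam *
       (tau * A ^+ 2 * D ^+ 2 * (2 * A * q + 2 * theta ^+ 2 * esb) / (2 * n%:R * m))).
pose c1 := chain_const (2^-1 : R) * (lam * (tau * A ^+ 2 * D ^+ 2 * (2 * A) / (2 * n%:R * m))).
have gE q : g q = g 0 + c1 * q by rewrite /g /c1; field; rewrite !gt_eqF.
have tau0 : 0 <= tau by exact/ltW/err_proxy_gt0.
have den0 : 0 < 2 * n%:R * m by rewrite mulr_gt0// mulr_gt0.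
have cc0 : 0 <= chain_const (2^-1 : R).
  by rewrite /chain_const addr_ge0// divr_ge0// sqr_ge0.
have num0 : 0 <= tau * A ^+ 2 * D ^+ 2.
  by rewrite mulr_ge0 ?sqr_ge0// mulr_ge0// sqr_ge0.
have c10 : 0 <= c1.
  rewrite /c1 mulr_ge0// mulr_ge0 ?(ltW lam0)// divr_ge0 ?(ltW den0)//.
  by rewrite mulr_ge0// mulr_ge0.
have g00 : 0 <= g 0.
  have := frozen_errors EZ indE errE n0 h0 m0 A0 D0 hl0 wc (fun _ _ => 0) kapP lt lam0 N.
  rewrite (_ : mean_sqr_norm _ = 0) => [H|].
    rewrite -lee_fin; apply: le_trans H.
    by apply: Ex_ge0 => a; exact: gridmax_ge0.
  rewrite /mean_sqr_norm big1 ?mulr0// => i _.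
  suff -> : vnorm (fun=> 0 : R) = 0 :> R by rewrite expr0n.
  move=> q; rewrite /vnorm; apply/eqP; rewrite eq_le bigmax_ge_id andbT.
  by apply: bigmax_le => // j _; rewrite normr0.
have mcv i j : measurable_wrt (sources (@source R n p E) curve_sources) (cv i j).
  by apply: curve_wrt; rewrite ?inE.
have mer i j : measurable_wrt (sources (@source R n p E) error_sources) (er i j).
  by apply: err_wrt; rewrite ?inE.
have mms : measurable_fun setT (fun a => mean_sqr_norm (fun i j => cv i j a)).
  by rewrite /mean_sqr_norm; have mv := measurable_cv_norm; meas.
have mf : measurable_wrt2 (sources (@source R n p E) curve_sources)
    (sources (@source R n p E) error_sources) f.
  apply: (@measurable_gridmax _
    (g_sigma_algebraType (sources (@source R n p E) curve_sources) *
     g_sigma_algebraType (sources (@source R n p E) error_sources))%type kap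
    (fun i j z => cv i j z.1 + theta * er i j z.2) (fun i j z => er i j z.2)) => i j.
    apply: measurable_funD; first exact: (measurable_wrt2_l (H := sources (@source R n p E) error_sources) (mcv i j)).
    apply: measurable_funM; first exact: measurable_cst.
    exact: (measurable_wrt2_r (G := sources (@source R n p E) curve_sources) (mer i j)).
  exact: (measurable_wrt2_r (G := sources (@source R n p E) curve_sources) (mer i j)).
have frozen a : (Ex P (f a) <= (g (mean_sqr_norm (fun i j => cv i j a)))%:E)%E.
  exact: (frozen_errors EZ indE errE n0 h0 m0 A0 D0 hl0 wc (fun i j => cv i j a) kapP lt lam0 N).
have fub := Ex_fubini_le (@sources_measurable _ _ _ _ mG _) (@sources_measurable _ _ _ _ mG _) indep mf
  (fun a b => gridmax_ge0 _ _) frozen.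
apply: le_trans fub _.
rewrite (_ : (fun a => g _) = fun a => g 0 + c1 * mean_sqr_norm (fun i j => cv i j a)); last first.
  by apply/funext => a; exact: gE.
rewrite Ex_add//; [|by move=> a; rewrite mulr_ge0// mean_sqr_norm_ge0|by meas].
rewrite [X in (_ <= X%:E)%E](_ : _ = g 0 + c1 * moment_bound); last exact: gE.
rewrite Ex_cst EFinD leeD2l// Ex_scale//; last by move=> a; exact: mean_sqr_norm_ge0.
rewrite [leRHS]EFinM; apply: lee_wpmul2l; first by rewrite lee_fin.
exact: mean_sqr_norm_mean.
Qed.

Variable kap : R * R -> 'I_n -> 'I_p -> 'I_p -> R.
Hypothesis kapP : kernel_conditions xs h m D true kap.
Hypothesis kap_lt : forall t i (j k : 'I_p), tri t -> kap t i j k != 0 -> (j < k)%N.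
Hypothesis kap1 : forall t i, tri t -> \sum_j \sum_k kap t i j k = 1.

Definition smooth_const : R := 4 * (D * A ^+ 2) + 3.

(** The products of the curves minus their means, smoothed by the weights, form
    a process with square-integrable Hoelder constant; chaining starts at the
    diameter of the triangle, hence no logarithm. *)
Lemma curve_products (lam : R) : 0 < lam -> forall N,
  (Ex P (fun a => gridmax N (fun t =>
     n%:R^-1 * \sum_i \sum_j \sum_k kap t i j k *
       (cv i j a * cv i k a - cov_kernel Z (xs i j, xs i k))))%R <=
   (chain_const (2^-1 `^ beta0) * (1 / lam +
      lam * (8 / n%:R * (smooth_const ^+ 2 * (2 * moment_bound + 2 * moment_bound ^+ 2)))))%:E)%E.
Proof.
move=> lam0 N; have nR : 0 < n%:R :> R by rewrite ltr0n.
have B0 : 0 <= D * A ^+ 2 by rewrite mulr_ge0// sqr_ge0.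
have C0 : 0 <= smooth_const by rewrite /smooth_const; lra.
pose Q i a j k := cv i j a * cv i k a - cov_kernel Z (xs i j, xs i k).
pose Y i t a := \sum_j \sum_k kap t i j k * Q i a j k.
pose F i a := envelope (xs i) beta0 (cv i ^~ a) + moment_bound.
pose f i a := smooth_const * F i a.
have MB0 := moment_bound_ge0.
have F0 i a : 0 <= F i a by rewrite addr_ge0// envelope_ge0.
have menv := measurable_env.
have prodE i j k := curve_product beta0P ZP (xs01 i) (@xs_inj i) i EZ j k.
have iprod i j k : P.-integrable setT (fun a => (cv i j a * cv i k a)%:E) by have [] := prodE i j k.
have Eprod i j k : (\int[P]_a (cv i j a * cv i k a)%R%:E = (cov_kernel Z (xs i j, xs i k))%:E)%E by have [] := prodE i j k.
have Gam i j k : `|cov_kernel Z (xs i j, xs i k)| <= moment_bound.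
  rewrite -lee_fin -abse_EFin -Eprod; apply: le_trans (le_abse_integral _ _ _) _ => //.
    by have /integrableP[] := iprod i j k.
  apply: le_trans (env_mean i); apply: lower_integral_le => a; first exact: abse_ge0.
  by rewrite abse_EFin lee_fin; exact: prod_le_envelope.
have Gamh i (j k j' k' : 'I_p) : `|cov_kernel Z (xs i j, xs i k) - cov_kernel Z (xs i j', xs i k')|
    <= moment_bound * Num.max `|xs i j - xs i j'| `|xs i k - xs i k'| `^ beta0.
  set y := _ `^ beta0; have y0 : 0 <= y by exact: powR_ge0.
  rewrite -lee_fin -abse_EFin EFinB -!Eprod -integralB//.
  apply: le_trans (le_abse_integral _ _ _) _ => //.
    by apply: emeasurable_funB; [have /integrableP[] := iprod i j k|have /integrableP[] := iprod i j' k'].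
  apply: (@le_trans _ _ (Ex P (fun a => y * envelope (xs i) beta0 (cv i ^~ a)))).
    apply: lower_integral_le => a; first exact: abse_ge0.
    rewrite -EFinB abse_EFin lee_fin [leRHS]mulrC.
    exact: (envelope_hoelder (@xs_inj i) beta0P (cv i ^~ a) j k j' k').
  rewrite Ex_scale//; last by move=> a; exact: envelope_ge0.
  by rewrite mulrC EFinM; apply: lee_wpmul2l; rewrite ?lee_fin//; exact: env_mean.
have QF i a j k : `|Q i a j k| <= F i a.
  apply: le_trans (ler_normB _ _) _; apply: lerD; last exact: Gam.
  exact: (prod_le_envelope _ _ (cv i ^~ a)).
have Qh i a (j k j' k' : 'I_p) : (j < k)%N -> (j' < k')%N -> `|Q i a j k - Q i a j' k'| <=
    F i a * Num.max `|xs i j - xs i j'| `|xs i k - xs i k'| `^ beta0.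
  move=> _ _; rewrite /Q opprB addrACA mulrDl.
  apply: le_trans (_ : `|(cv i j a * cv i k a - cv i j' a * cv i k' a) -
     (cov_kernel Z (xs i j, xs i k) - cov_kernel Z (xs i j', xs i k'))| <= _).
    by rewrite le_eqVlt; apply/orP; left; apply/eqP; congr (`| _ |); ring.
  apply: le_trans (ler_normB _ _) _; apply: lerD; last exact: Gamh.
  exact: (envelope_hoelder (@xs_inj i) beta0P (cv i ^~ a) j k j' k').
have mcv i j : measurable_wrt (sources (@source R n p E) [set inl i]) (cv i j).
  by apply: curve_wrt; rewrite ?inE.
have r01 : 0 < (2^-1 `^ beta0 : R) < 1.
  rewrite powR_gt0//= [ltRHS](_ : 1 = 1 `^ beta0); last by rewrite powR1.
  by rewrite gt0_ltr_powR ?nnegrE//; lra.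
have := @centred_process _ _ R P _ (@source R n p E) sG mG indG n (fun i => inl i) _ n0 Y f
  (fun=> smooth_const ^+ 2 * (2 * moment_bound + 2 * moment_bound ^+ 2)) _ _ _ _ 0 (2^-1 `^ beta0) lam r01 lam0.
move=> H; apply: le_trans (H _ _ _ _ _ _ _ N) _.
- by move=> i j [].
- move=> i t; apply: measurable_sum => j; apply: measurable_sum => k.
  apply: measurable_funM; first exact: measurable_cst.
  apply: measurable_funB; last exact: measurable_cst.
  by apply: measurable_funM; exact: mcv.
- by move=> i; rewrite /f /F; meas.
- move=> i t tt.
  have iQ j k : P.-integrable setT (fun a => (kap t i j k * Q i a j k)%:E).
    under eq_fun do rewrite EFinM; apply: integrableZl => //.
    under eq_fun do rewrite /Q EFinB; apply: integrableB => //.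
    exact: finite_measure_integrable_cst.
  have EQ j k : (\int[P]_a (kap t i j k * Q i a j k)%R%:E = 0)%E.
    under eq_integral do rewrite EFinM.
    have iq : P.-integrable setT (fun a => (Q i a j k)%:E).
      under eq_fun do rewrite /Q EFinB; apply: integrableB => //.
      exact: finite_measure_integrable_cst.
    rewrite integralZl//; under eq_integral do rewrite /Q EFinB.
    rewrite integralB//; last exact: finite_measure_integrable_cst.
    rewrite Eprod [X in (_ - X)%E](_ : _ = (cov_kernel Z (xs i j, xs i k))%:E).
      by rewrite subee// mule0.
    exact: Ex_cst.
  have iS j : P.-integrable setT (fun a => (\sum_k kap t i j k * Q i a j k)%:E).
    by under eq_fun do rewrite -sumEFin; exact: integrable_sum.
  split.
    by rewrite /Y; under eq_fun do rewrite -sumEFin; exact: integrable_sum.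
  rewrite /Y; under eq_integral do rewrite -sumEFin.
  rewrite integral_sum// big1// => j _; under eq_integral do rewrite -sumEFin.
  by rewrite integral_sum// big1.
- move=> i; rewrite /f; under [X in Ex _ X]eq_fun do rewrite exprMn.
  have mF : measurable_fun setT (F i) by rewrite /F; meas.
  rewrite Ex_scale ?sqr_ge0//; [|by move=> a; exact: sqr_ge0|by meas].
  rewrite [leRHS]EFinM; apply: lee_wpmul2l; first by rewrite lee_fin sqr_ge0.
  apply: (@le_trans _ _ (Ex P (fun a => 2 * envelope (xs i) beta0 (cv i ^~ a) ^+ 2 + 2 * moment_bound ^+ 2))).
    apply: Ex_le => a; first exact: sqr_ge0.
    by rewrite /F; have := sqr_ge0 (envelope (xs i) beta0 (cv i ^~ a) - moment_bound); nra.
  have me := menv i.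
  rewrite Ex_add; [|by move=> a; rewrite mulr_ge0// sqr_ge0|by move=> a; rewrite mulr_ge0// sqr_ge0|by meas|by meas].
  rewrite Ex_cst EFinD leeD2r// Ex_scale//; [|by move=> a; exact: sqr_ge0|by meas].
  by rewrite [leRHS]EFinM; apply: lee_wpmul2l; rewrite ?lee_fin//; exact: env_sqr.
- move=> i t a tt; apply: le_trans (kernel_form_bound h0 m0 D0 wc kapP i (F0 i a) (QF i a) tt) _.
  by rewrite ler_wpM2r// /smooth_const; lra.
- move=> i r s a.
  apply: le_trans (kernel_form_hoelder h0 m0 D0 wc kapP kap_lt kap1 (F0 i a) beta01
    (Qh i a) (gpt_tri R s) (parent_tri R s)) _.
  rewrite -/smooth_const mulrC ler_wpM2r ?mulr_ge0//.
  rewrite -powR_mulrn ?powR_ge0// -powRrM mulrC powRrM powR_mulrn//.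
  rewrite ge0_ler_powR ?nnegrE ?supdist_ge0 ?exprn_ge0//; first exact: ltW.
  apply: le_trans (parent_dist R s) _; rewrite add0n exprSr ler_piMr ?exprn_ge0//; lra.
rewrite lee_fin le_eqVlt; apply/orP; left; apply/eqP; congr (_ * _).
rewrite sumr_const card_ord -[_ *+ n]mulr_natl; field.
by rewrite !gt_eqF.
Qed.

End SourceTerms.

(** * Cross terms with the pre-estimation *)

Section CrossTerms.
Context (R : realType) (n p : nat) (E : experiment R n p).
Variables (gamma L beta0 CZ : R) (Z : process R) (sigma2 kappa : R).
Hypothesis beta01 : 0 < beta0 <= 1.
Hypothesis CZ0 : 0 < CZ.
Hypothesis ZP : process_class gamma L beta0 CZ Z.
Hypothesis EZ : iid_copies E Z.
Hypothesis indE : sources_independent E.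
Hypothesis errE : error_conditions E sigma2 kappa.
Hypothesis n0 : (0 < n)%N.
Variables (xs : 'I_n -> 'I_p -> R) (h m A D : R) (l0 : nat).
Hypothesis xs01 : forall i j, 0 <= xs i j <= 1.
Hypothesis xs_inj : forall i, injective (xs i).
Hypothesis h0 : 0 < h.
Hypothesis m0 : 0 < m.
Hypothesis A0 : 0 <= A.
Hypothesis D0 : 0 <= D.
Hypothesis hl0 : 2^-1 ^+ l0 <= h.
Hypothesis wc : windows_card xs h m A.
Variables (bb : bool) (kap : R * R -> 'I_n -> 'I_p -> 'I_p -> R).
Hypothesis kapP : kernel_conditions xs h m D bb kap.

Let tau := err_proxy sigma2 kappa.
Let P := elaw E.
Let cv i j a : R := @curve R n p E i (xs i j) a.
Let er i j a : R := @err R n p E i j a.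
Let MB := moment_bound CZ.
Let CC := chain_const (2^-1 : R).
Let Lam : R := l0.+1%:R.

Let sG := @source_algebra R n p E.
Let mG := source_measurable EZ errE.
Let indG := source_independent indE.
Let mcv := measurable_cv EZ xs01.
Let mer := measurable_er errE.

Let beta0P : 0 < beta0. Proof. by case/andP: beta01. Qed.
Let nR : 0 < n%:R :> R. Proof. by rewrite ltr0n. Qed.
Let DA0 : 0 <= D * A ^+ 2. Proof. by rewrite mulr_ge0// sqr_ge0. Qed.
Let tau0 : 0 < tau. Proof. exact: err_proxy_gt0. Qed.
Let MB0 : 0 <= MB. Proof. exact: moment_bound_ge0. Qed.
Let CC0 : 0 <= CC.
Proof. by rewrite /CC /chain_const addr_ge0// divr_ge0// sqr_ge0. Qed.

Lemma form_product_le t i (z z' : 'I_p -> R) : tri t ->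
  `|\sum_j \sum_k kap t i j k * (z j * z' k)| <= D * A ^+ 2 * (vnorm z * vnorm z').
Proof.
move=> tt; apply: kernel_form_le; first by rewrite mulr_ge0 ?vnorm_ge0.
  exact: (kernel_mass h0 m0 D0 wc kapP i tt).
by move=> j k _; rewrite normrM ler_pM ?vnorm_ge.
Qed.

(** The products of a frozen factor and a curve have no regularity in the design
    points, so that the chaining starts at the bandwidth, from where the weights
    alone provide it. *)
Lemma frozen_curves (z : 'I_n -> 'I_p -> R) lam : 0 < lam -> forall N,
  (Ex P (fun a => gridmax (l0 + N) (fun t => bil (kap t) z (fun i k => cv i k a)))%R <=
   (CC * (Lam / lam + lam * (8 / n%:R * ((D * A ^+ 2) ^+ 2 * MB * mean_sqr_norm z))))%:E)%E.
Proof.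
move=> lam0 N; have hpos := h0.
pose Y i t a := \sum_j \sum_k kap t i j k * (z i j * cv i k a).
pose f i a := D * A ^+ 2 * (vnorm (z i) * vnorm (cv i ^~ a)).
have mn := measurable_cv_norm EZ xs01.
have icv i j : P.-integrable setT (fun a => (cv i j a)%:E).
  by have [] := curve_centred beta0P ZP (xs01 i) (@xs_inj i) i EZ j.
have ecv i j : (\int[P]_a (cv i j a)%:E = 0)%E.
  by have [] := curve_centred beta0P ZP (xs01 i) (@xs_inj i) i EZ j.
have mcw i j : measurable_wrt (sources (@source R n p E) [set inl i]) (cv i j).
  by apply: curve_wrt; rewrite ?inE.
have r01 : 0 < (2^-1 : R) < 1 by apply/andP; split; lra.
have := @centred_process _ _ R P _ (@source R n p E) sG mG indG n (fun i => inl i) _ n0 Y f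
  (fun i => (D * A ^+ 2) ^+ 2 * (vnorm (z i) ^+ 2 * MB)) _ _ _ _ l0 2^-1 lam r01 lam0.
move=> H; apply: le_trans (_ : _ <= _)%E (le_trans (H _ _ _ _ _ _ _ N) _).
- apply: Ex_le => a; first exact: gridmax_ge0.
  rewrite le_eqVlt; apply/orP; left; apply/eqP; congr (gridmax _ _); apply/funext => t.
  rewrite /bil /Y; congr (_ * _); apply: eq_bigr => i _; apply: eq_bigr => j _.
  by apply: eq_bigr => k _; rewrite mulrA.
- by move=> i j [].
- move=> i t; apply: measurable_sum => j; apply: measurable_sum => k.
  apply: measurable_funM; first exact: measurable_cst.
  by apply: measurable_funM; [exact: measurable_cst|exact: mcw].
- by move=> i; rewrite /f; meas.
- move=> i t tt.
  have iQ j k : P.-integrable setT (fun a => (kap t i j k * (z i j * cv i k a))%:E).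
    under eq_fun do rewrite mulrA EFinM; exact: integrableZl.
  have EQ j k : (\int[P]_a (kap t i j k * (z i j * cv i k a))%R%:E = 0)%E.
    under eq_integral do rewrite mulrA EFinM.
    by rewrite integralZl// ecv mule0.
  have iS j : P.-integrable setT (fun a => (\sum_k kap t i j k * (z i j * cv i k a))%:E).
    by under eq_fun do rewrite -sumEFin; exact: integrable_sum.
  split.
    by rewrite /Y; under eq_fun do rewrite -sumEFin; exact: integrable_sum.
  rewrite /Y; under eq_integral do rewrite -sumEFin.
  rewrite integral_sum// big1// => j _; under eq_integral do rewrite -sumEFin.
  by rewrite integral_sum// big1.
- move=> i; rewrite /f.
  under [X in Ex _ X]eq_fun do rewrite mulrA exprMn.
  rewrite Ex_scale ?sqr_ge0//; [|by move=> a; exact: sqr_ge0|by apply: measurable_funX; exact: mn].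
  rewrite mulrA -exprMn [leRHS]EFinM; apply: lee_wpmul2l; first by rewrite lee_fin sqr_ge0.
  exact: (norm_sqr_mean beta01 ZP EZ xs01 xs_inj).
- by move=> i t a tt; exact: form_product_le.
- move=> i r s a.
  have dist : supdist (gpt R s) (parent R s) <= h * 2^-1 ^+ r.
    apply: le_trans (parent_dist R s) _; rewrite exprSr exprD.
    apply: (@le_trans _ _ (2^-1 ^+ l0 * 2^-1 ^+ r)).
      by rewrite ler_piMr// ?mulr_ge0 ?exprn_ge0 ?invr_ge0//; lra.
    by rewrite ler_wpM2r// exprn_ge0// invr_ge0.
  have r1 : 2^-1 ^+ r <= 1 :> R by rewrite exprn_ile1 ?invr_ge0//; lra.
  have disth : supdist (gpt R s) (parent R s) <= h.
    by apply: le_trans dist _; rewrite ler_piMr// ltW.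
  rewrite /Y -sumrB; under eq_bigr do rewrite -sumrB.
  under eq_bigr do under eq_bigr do rewrite -mulrBl.
  apply: le_trans (kernel_form_le (s := vnorm (z i) * vnorm (cv i ^~ a)) _
    (kernel_increment_mass h0 m0 D0 wc kapP i (gpt_tri R s) (parent_tri R s) disth) _) _.
  + by rewrite mulr_ge0 ?vnorm_ge0.
  + by move=> j k _; rewrite normrM ler_pM ?vnorm_ge// (vnorm_ge (cv i ^~ a)).
  rewrite /f [leRHS]mulrA [leRHS](_ : _ = D * A ^+ 2 * 2^-1 ^+ r * (vnorm (z i) * vnorm (cv i ^~ a))); last by ring.
  by rewrite ler_wpM2r ?mulr_ge0 ?vnorm_ge0// ler_wpM2l// ler_pdivrMr// mulrC.
rewrite lee_fin le_eqVlt; apply/orP; left; apply/eqP; congr (_ * (_ + _ * _)).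
rewrite -mulr_sumr -mulr_suml /mean_sqr_norm; field.
by rewrite !gt_eqF.
Qed.

Lemma frozen_linear_errors (z : 'I_n -> 'I_p -> R) lam : 0 < lam -> forall N,
  (Ex P (fun a => gridmax (l0 + N) (fun t => bil (kap t) z (fun i k => er i k a)))%R <=
   (CC * (Lam / lam + lam * (tau * A ^+ 3 * D ^+ 2 / (n%:R * m) * mean_sqr_norm z)))%:E)%E.
Proof.
move=> lam0 N.
have lt0 : (0 : R) != 0 -> forall t i (j k : 'I_p), tri t -> kap t i j k != 0 -> (j < k)%N.
  by rewrite eqxx.
have := frozen_errors EZ indE errE n0 h0 m0 A0 D0 hl0 wc z kapP lt0 lam0 N.
under [X in Ex _ X]eq_fun do under [X in gridmax _ X]eq_fun do
  under [X in bil _ X]eq_fun do under eq_fun do rewrite mul0r addr0.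
move=> /le_trans; apply; rewrite lee_fin le_eqVlt; apply/orP; left; apply/eqP.
by rewrite -/tau /CC /Lam; field; rewrite !gt_eqF.
Qed.

Lemma frozen_cross (z : 'I_n -> 'I_p -> R) lam1 lam2 : 0 < lam1 -> 0 < lam2 -> forall N,
  (Ex P (fun a => gridmax (l0 + N) (fun t => bil (kap t) z (fun i k => cv i k a + er i k a)))%R <=
   (CC * (Lam / lam1 + lam1 * (8 / n%:R * ((D * A ^+ 2) ^+ 2 * MB * mean_sqr_norm z))) +
    CC * (Lam / lam2 + lam2 * (tau * A ^+ 3 * D ^+ 2 / (n%:R * m) * mean_sqr_norm z)))%:E)%E.
Proof.
move=> lam10 lam20 N.
apply: (@le_trans _ _ (Ex P (fun a =>
    gridmax (l0 + N) (fun t => bil (kap t) z (fun i k => cv i k a)) +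
    gridmax (l0 + N) (fun t => bil (kap t) z (fun i k => er i k a))))).
  apply: Ex_le => a; first exact: gridmax_ge0.
  by apply: gridmax_leD => t; rewrite bilDr ler_normD.
rewrite Ex_add.
- by rewrite EFinD leeD ?frozen_curves ?frozen_linear_errors.
- by move=> a; exact: gridmax_ge0.
- by move=> a; exact: gridmax_ge0.
- by apply: (measurable_gridmax kap (b := fun i j _ => z i j)) => // i j; exact: measurable_cst.
- by apply: (measurable_gridmax kap (b := fun i j _ => z i j)) => // i j; exact: measurable_cst.
Qed.

(** A pre-estimation independent of the data can be frozen; the bound for a
    frozen one is affine in its mean squared norm. *)
Lemma independent_cross (G H : set (set (espace E))) (b : 'I_n -> 'I_p -> espace E -> R)
    (r2 lam1 lam2 : R) : <<s G >> `<=` measurable -> <<s H >> `<=` measurable ->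
  independent2 P <<s G >> <<s H >> ->
  (forall i j, measurable_wrt G (b i j)) ->
  (forall i j, measurable_wrt H (fun a => cv i j a + er i j a)) ->
  (Ex P (fun a => mean_sqr_norm (fun i j => b i j a)) <= r2%:E)%E ->
  0 < lam1 -> 0 < lam2 -> forall N,
  (Ex P (fun a => gridmax (l0 + N) (fun t => bil (kap t) (fun i j => b i j a)
     (fun i k => cv i k a + er i k a)))%R <=
   (CC * (Lam / lam1 + lam1 * (8 / n%:R * ((D * A ^+ 2) ^+ 2 * MB * r2))) +
    CC * (Lam / lam2 + lam2 * (tau * A ^+ 3 * D ^+ 2 / (n%:R * m) * r2)))%:E)%E.
Proof.
move=> GT HT GH mb mW Er lam10 lam20 N.
pose f a a' := gridmax (l0 + N) (fun t => bil (kap t) (fun i j => b i j a)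
     (fun i k => cv i k a' + er i k a')).
pose c1 := CC * (lam1 * (8 / n%:R * ((D * A ^+ 2) ^+ 2 * MB))) +
  CC * (lam2 * (tau * A ^+ 3 * D ^+ 2 / (n%:R * m))).
pose c0 := CC * (Lam / lam1) + CC * (Lam / lam2).
have c00 : 0 <= c0.
  by rewrite addr_ge0// mulr_ge0// divr_ge0// ltW.
have c10 : 0 <= c1.
  have t3 : 0 <= tau * A ^+ 3 * D ^+ 2.
    by rewrite mulr_ge0 ?sqr_ge0// mulr_ge0 ?exprn_ge0// ltW.
  have t4 : 0 <= tau * A ^+ 3 * D ^+ 2 / (n%:R * m).
    by rewrite divr_ge0// mulr_ge0// ltW.
  have t5 : 0 <= 8 / n%:R * ((D * A ^+ 2) ^+ 2 * MB).
    by rewrite mulr_ge0 ?divr_ge0// mulr_ge0// sqr_ge0.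
  by rewrite addr_ge0// mulr_ge0// mulr_ge0// ltW.
have gE q : CC * (Lam / lam1 + lam1 * (8 / n%:R * ((D * A ^+ 2) ^+ 2 * MB * q))) +
    CC * (Lam / lam2 + lam2 * (tau * A ^+ 3 * D ^+ 2 / (n%:R * m) * q)) = c0 + c1 * q.
  by rewrite /c0 /c1; ring.
have mb' i j : measurable_fun setT (b i j) by exact: measurable_wrt_fun (mb i j).
have mf : measurable_wrt2 G H f.
  apply: (@measurable_gridmax _ _ _ _
    (g_sigma_algebraType G * g_sigma_algebraType H)%type kap
    (fun i j z => b i j z.1) (fun i j z => cv i j z.2 + er i j z.2)) => i j.
    exact: (measurable_wrt2_l (H := H) (mb i j)).
  exact: (measurable_wrt2_r (G := G) (mW i j)).
have frozen a : (Ex P (f a) <= (c0 + c1 * mean_sqr_norm (fun i j => b i j a))%:E)%E.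
  by rewrite -gE; exact: frozen_cross.
have fub := Ex_fubini_le GT HT GH mf (fun a b => gridmax_ge0 _ _) frozen.
apply: le_trans fub _; rewrite gE.
have ms : measurable_fun setT (fun a => mean_sqr_norm (fun i j => b i j a)).
  by rewrite /mean_sqr_norm /vnorm; meas.
rewrite Ex_add//; [|by move=> a; rewrite mulr_ge0// mean_sqr_norm_ge0|by meas].
rewrite Ex_cst [leRHS]EFinD leeD2l// Ex_scale//; last by move=> a; exact: mean_sqr_norm_ge0.
by rewrite [leRHS]EFinM; apply: lee_wpmul2l; rewrite ?lee_fin.
Qed.

Definition one_row (i : 'I_n) (z : 'I_n -> 'I_p -> R) i' j : R :=
  if i' == i then z i' j else 0.

Let bil_rows K z z' : bil K z z' = \sum_i bil K (one_row i z) (one_row i z').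
Proof.
rewrite /bil -mulr_sumr; congr (_ * _); apply: eq_bigr => i _.
rewrite [RHS](bigD1 i)//= [X in _ + X]big1 ?addr0; last first.
  move=> i' i'i; rewrite big1// => j _; rewrite big1// => k _.
  by rewrite /one_row (negbTE i'i) mulr0.
by apply: eq_bigr => j _; apply: eq_bigr => k _; rewrite /one_row eqxx.
Qed.

Definition curve_data (i : 'I_n) : {set 'I_n + 'I_n * 'I_p} :=
  [set s | match s with inl i' => i' == i | inr ij => ij.1 == i end].

Definition other_data (i : 'I_n) : {set 'I_n + 'I_n * 'I_p} :=
  [set s | match s with inl i' => i' != i | inr ij => ij.1 != i end].

Definition single_curve_const : R := CC * (1 + tau * A ^+ 3 * D ^+ 2) * Num.sqrt (Lam / m) +
  D * A ^+ 2 * (1 + MB).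

Lemma single_curve_const_ge0 : 0 <= single_curve_const.
Proof.
have t3 : 0 <= tau * A ^+ 3 * D ^+ 2.
  by rewrite mulr_ge0 ?sqr_ge0// mulr_ge0 ?exprn_ge0// ltW.
by rewrite addr_ge0// ?mulr_ge0 ?sqrtr_ge0// addr_ge0.
Qed.

Let mean_norm i : (Ex P (fun a => vnorm (cv i ^~ a)) <= (1 + MB)%:E)%E.
Proof.
have mn := measurable_cv_norm EZ xs01 i.
apply: (@le_trans _ _ (Ex P (fun a => 1 + vnorm (cv i ^~ a) ^+ 2))).
  apply: Ex_le => a; first exact: vnorm_ge0.
  by have := sqr_ge0 (vnorm (cv i ^~ a) - 1); have := vnorm_ge0 (cv i ^~ a); nra.
rewrite Ex_add//; [|by move=> a; exact: sqr_ge0|by apply: measurable_funX; exact: mn].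
by rewrite Ex_cst EFinD leeD2l//; exact: (norm_sqr_mean beta01 ZP EZ xs01 xs_inj).
Qed.

(** One curve against a frozen pre-estimation: the errors of a single curve have
    no averaging over [n] to profit from, whence the loss [sqrt (Lam / m)]; for
    the curve itself the crude bound suffices. *)
Lemma frozen_row (i : 'I_n) (z : 'I_n -> 'I_p -> R) N :
  (Ex P (fun a => gridmax (l0 + N) (fun t => bil (kap t) (one_row i z)
     (one_row i (fun i k => cv i k a + er i k a))))%R <=
   (single_curve_const * (n%:R^-1 * vnorm (z i)))%:E)%E.
Proof.
set v := vnorm (z i); have v0 : 0 <= v by exact: vnorm_ge0.
have mn := measurable_cv_norm EZ xs01.
have split_row t a : bil (kap t) (one_row i z) (one_row i (fun i k => cv i k a + er i k a)) =
    bil (kap t) (one_row i z) (fun i k => er i k a) +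
    n%:R^-1 * \sum_j \sum_k kap t i j k * (z i j * cv i k a).
  rewrite [X in _ = _ + X](_ : _ = bil (kap t) (one_row i z) (fun i k => cv i k a)).
    rewrite -bilDr /bil; congr (_ * _); apply: eq_bigr => i' _; apply: eq_bigr => j _.
    apply: eq_bigr => k _; rewrite /one_row; case: ifP => _; last by rewrite !(mulr0, mul0r).
    by congr (_ * _); rewrite addrC.
  rewrite /bil; congr (_ * _); rewrite [RHS](bigD1 i)//= [X in _ + X]big1 ?addr0; last first.
    move=> i' i'i; rewrite big1// => j _; rewrite big1// => k _.
    by rewrite /one_row (negbTE i'i) mulr0 mul0r.
  by apply: eq_bigr => j _; apply: eq_bigr => k _; rewrite /one_row eqxx mulrA.
have crude t a : tri t -> `|n%:R^-1 * \sum_j \sum_k kap t i j k * (z i j * cv i k a)| <=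
    n%:R^-1 * (D * A ^+ 2 * v) * vnorm (cv i ^~ a).
  move=> tt; rewrite normrM gtr0_norm ?invr_gt0// -!mulrA ler_wpM2l ?invr_ge0//.
  by have := @form_product_le t i (z i) (cv i ^~ a) tt; rewrite -/v !mulrA.
have errpart : (Ex P (fun a => gridmax (l0 + N) (fun t => bil (kap t) (one_row i z)
     (fun i k => er i k a)))%R <=
   (CC * (1 + tau * A ^+ 3 * D ^+ 2) * Num.sqrt (Lam / m) * (n%:R^-1 * v))%:E)%E.
  have [vz|vn0] := eqVneq v 0.
    rewrite vz !mulr0 -(Ex_cst P 0); apply: Ex_le => a; first exact: gridmax_ge0.
    apply: gridmax_le => // t _; rewrite /bil big1 ?mulr0 ?normr0// => i' _.
    rewrite big1// => j _; rewrite big1// => k _; rewrite /one_row.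
    case: eqP => [->|_]; last by rewrite mulr0 mul0r.
    have : `|z i j| <= 0 by rewrite -vz; exact: vnorm_ge.
    by rewrite normr_le0 => /eqP ->; rewrite mulr0 mul0r.
  have vp : 0 < v by rewrite lt_neqAle eq_sym vn0.
  set s := Num.sqrt (Lam / m).
  have s0 : 0 < s by rewrite sqrtr_gt0 divr_gt0.
  have sE : Lam = s ^+ 2 * m by rewrite sqr_sqrtr ?divr_ge0 ?(ltW m0)// divfK// gt_eqF.
  (* balances the entropy against the variance *)
  have lam0 : 0 < n%:R * (s * m) / v by rewrite divr_gt0// mulr_gt0// mulr_gt0.
  apply: le_trans (frozen_linear_errors _ lam0 N) _.
  have -> : mean_sqr_norm (one_row i z) = n%:R^-1 * v ^+ 2.
    rewrite /mean_sqr_norm (bigD1 i)//= [X in _ + X]big1 ?addr0; last first.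
      move=> i' i'i; rewrite (_ : vnorm _ = 0) ?expr0n//.
      rewrite /vnorm; apply/eqP; rewrite eq_le bigmax_ge_id andbT.
      by apply: bigmax_le => // j _; rewrite /one_row (negbTE i'i) normr0.
    by congr (_ * _ ^+ 2); apply: eq_bigr => j _; rewrite /one_row eqxx.
  rewrite lee_fin le_eqVlt; apply/orP; left; apply/eqP.
  rewrite sE; field; rewrite !gt_eqF//.
apply: (@le_trans _ _ (Ex P (fun a =>
    gridmax (l0 + N) (fun t => bil (kap t) (one_row i z) (fun i k => er i k a)) +
    n%:R^-1 * (D * A ^+ 2 * v) * vnorm (cv i ^~ a)))).
  apply: Ex_le => a; first exact: gridmax_ge0.
  apply: bigmax_le => [|s _]; first by rewrite addr_ge0 ?gridmax_ge0 ?mulr_ge0 ?vnorm_ge0.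
  rewrite split_row; apply: le_trans (ler_normD _ _) _; apply: lerD.
    exact: (gridmax_ge (fun t => bil (kap t) (one_row i z) (fun i k => er i k a))).
  exact/crude/gpt_tri.
have k0 : 0 <= n%:R^-1 * (D * A ^+ 2 * v) by rewrite mulr_ge0// mulr_ge0.
rewrite Ex_add; first last.
- by apply: measurable_funM; [exact: measurable_cst|exact: mn].
- by apply: (measurable_gridmax kap (b := fun i' j _ => one_row i z i' j)) => // i' j; exact: measurable_cst.
- by move=> a; rewrite mulr_ge0 ?vnorm_ge0.
- by move=> a; exact: gridmax_ge0.
rewrite Ex_scale//; [|by move=> a; exact: vnorm_ge0|exact: mn].
rewrite /single_curve_const mulrDl EFinD; apply: leeD => //.
rewrite [X in (_ <= X%:E)%E](_ : _ = n%:R^-1 * (D * A ^+ 2 * v) * (1 + MB)); last by ring.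
by rewrite [leRHS]EFinM; apply: lee_wpmul2l; rewrite ?lee_fin.
Qed.

(** Curve by curve, the pre-estimation leaving the curve out can be frozen. *)
Lemma leave_one_out_cross (b : 'I_n -> 'I_p -> espace E -> R) (r1 : R) :
  (forall i j, measurable_wrt (sources (@source R n p E) (other_data i)) (b i j)) ->
  (forall i, (Ex P (fun a => vnorm (b i ^~ a)) <= r1%:E)%E) ->
  forall N, (Ex P (fun a => gridmax (l0 + N) (fun t => bil (kap t) (fun i j => b i j a)
     (fun i k => cv i k a + er i k a)))%R <= (single_curve_const * r1)%:E)%E.
Proof.
move=> mb Er N; pose W i k a := cv i k a + er i k a.
have mW i k : measurable_fun setT (W i k).
  by apply: measurable_funD; [exact: mcv|exact: mer].
have mb' i j : measurable_fun setT (b i j).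
  exact: (measurable_wrt_fun (@sources_measurable _ _ _ _ mG _) (mb i j)).
pose f i a a' := gridmax (l0 + N) (fun t => bil (kap t) (one_row i (fun i j => b i j a))
     (one_row i (fun i k => W i k a'))).
have mfi i : measurable_fun setT (fun a => f i a a).
  apply: (measurable_gridmax kap (b := fun i' j a => one_row i (fun i j => b i j a) i' j)
     (c := fun i' j a => one_row i (fun i k => W i k a) i' j)) => i' j.
    by rewrite /one_row; case: eqP => _; [exact: mb'|exact: measurable_cst].
  by rewrite /one_row; case: eqP => _; [exact: mW|exact: measurable_cst].
apply: (@le_trans _ _ (Ex P (fun a => \sum_i f i a a))).
  apply: Ex_le => a; first exact: gridmax_ge0.
  apply: bigmax_le => [|s _]; first by rewrite sumr_ge0// => i _; exact: gridmax_ge0.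
  rewrite bil_rows; apply: le_trans (ler_norm_sum _ _ _) _; apply: ler_sum => i _.
  exact: (gridmax_ge (fun t => bil (kap t) (one_row i _) (one_row i _))).
rewrite Ex_sum//; last by move=> i a; exact: gridmax_ge0.
rewrite (_ : single_curve_const * r1 = \sum_(i < n) single_curve_const * (n%:R^-1 * r1)); last first.
  by rewrite sumr_const card_ord -[RHS]mulr_natl; field; rewrite gt_eqF.
rewrite -sumEFin; apply: lee_sum => i _.
have indep : independent2 P <<s sources (@source R n p E) (other_data i)>>
    <<s sources (@source R n p E) (curve_data i)>>.
  by apply: (sources_independent2 sG mG indG) => -[i'|[i' j]]; rewrite !inE.
have mWi k : measurable_wrt (sources (@source R n p E) (curve_data i)) (W i k).
  apply: measurable_funD; first by apply: curve_wrt; rewrite ?inE.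
  by apply: err_wrt; rewrite ?inE.
have mf : measurable_wrt2 (sources (@source R n p E) (other_data i))
    (sources (@source R n p E) (curve_data i)) (f i).
  apply: (@measurable_gridmax _ _ _ _
    (g_sigma_algebraType (sources (@source R n p E) (other_data i)) *
     g_sigma_algebraType (sources (@source R n p E) (curve_data i)))%type kap
    (fun i' j z => one_row i (fun i j => b i j z.1) i' j)
    (fun i' j z => one_row i (fun i k => W i k z.2) i' j)) => i' j.
    rewrite /one_row; case: eqP => [->|_]; last exact: measurable_cst.
    exact: (measurable_wrt2_l (H := sources (@source R n p E) (curve_data i)) (mb i j)).
  rewrite /one_row; case: eqP => [->|_]; last exact: measurable_cst.
  exact: (measurable_wrt2_r (G := sources (@source R n p E) (other_data i)) (mWi j)).
have frozen a : (Ex P (f i a) <= (single_curve_const * (n%:R^-1 * vnorm (b i ^~ a)))%:E)%E.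
  exact: (frozen_row i (fun i j => b i j a)).
have fub := Ex_fubini_le (@sources_measurable _ _ _ _ mG _) (@sources_measurable _ _ _ _ mG _) indep mf
  (fun a b => gridmax_ge0 _ _) frozen.
apply: le_trans fub _.
have mv : measurable_fun setT (fun a => vnorm (b i ^~ a)) by rewrite /vnorm; meas.
have rc0 := single_curve_const_ge0.
under eq_fun do rewrite mulrA.
rewrite Ex_scale; [|by rewrite mulr_ge0|by move=> a; exact: vnorm_ge0|by []].
rewrite [X in (_ <= X%:E)%E]mulrA [leRHS]EFinM; apply: lee_wpmul2l; first by rewrite lee_fin mulr_ge0.
exact: Er.
Qed.

End CrossTerms.

(** * Decomposition of the estimation error *)

Lemma Ex_add_le d (T : measurableType d) (R : realType) (P : probability T R)
    (f g : T -> R) (u v : R) : (forall a, 0 <= f a) -> (forall a, 0 <= g a) ->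
  measurable_fun setT f -> measurable_fun setT g ->
  (Ex P f <= u%:E)%E -> (Ex P g <= v%:E)%E ->
  (Ex P (fun a => f a + g a)%R <= (u + v)%:E)%E.
Proof. by move=> *; rewrite Ex_add// EFinD leeD. Qed.

Section Decomposition.
Context (R : realType) (n p : nat) (E : experiment R n p).
Variables (gamma L beta0 CZ : R) (Z : process R) (sigma2 kappa : R).
Hypothesis gamma0 : 0 < gamma.
Hypothesis beta01 : 0 < beta0 <= 1.
Hypothesis CZ0 : 0 < CZ.
Hypothesis L0 : 0 <= L.
Hypothesis kappa1 : 1 <= kappa.
Hypothesis ZP : process_class gamma L beta0 CZ Z.
Hypothesis EZ : iid_copies E Z.
Hypothesis indE : sources_independent E.
Hypothesis errE : error_conditions E sigma2 kappa.
Hypothesis n0 : (0 < n)%N.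
Hypothesis p0 : (0 < p)%N.
Variables (xs : 'I_n -> 'I_p -> R) (h m A D : R) (l0 : nat).
Hypothesis xs01 : forall i j, 0 <= xs i j <= 1.
Hypothesis xs_lt : forall i (j k : 'I_p), (j < k)%N -> xs i j < xs i k.
Hypothesis h0 : 0 < h.
Hypothesis m0 : 0 < m.
Hypothesis A0 : 0 <= A.
Hypothesis D0 : 0 <= D.
Hypothesis hl0 : 2^-1 ^+ l0 <= h.
Hypothesis wc : windows_card xs h m A.
Variable kap : R * R -> 'I_n -> 'I_p -> 'I_p -> R.
Hypothesis kapP : kernel_conditions xs h m D true kap.
Hypothesis kap_lt : forall t i (j k : 'I_p), tri t -> kap t i j k != 0 -> (j < k)%N.
Hypothesis kap1 : forall t i, tri t -> \sum_j \sum_k kap t i j k = 1.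
Hypothesis kap_moments : forall t i (r1 r2 : nat), tri t ->
  (1 <= r1 + r2 <= sfloor gamma)%N ->
  \sum_j \sum_k (xs i j - t.1) ^+ r1 * (xs i k - t.2) ^+ r2 * kap t i j k = 0.
(** The error of the pre-estimation at the design point [xs i j]. *)
Variable b : 'I_n -> 'I_p -> espace E -> R.
Hypothesis mb : forall i j, measurable_fun setT (b i j).
Variables (r2 cross U : R).
Hypothesis Eb : (Ex (elaw E) (fun a => mean_sqr_norm (fun i j => b i j a)) <= r2%:E)%E.

Let tau := err_proxy sigma2 kappa.
Let P := elaw E.
Let cv i j a : R := @curve R n p E i (xs i j) a.
Let er i j a : R := @err R n p E i j a.
Let MB := moment_bound CZ.
Let CC := chain_const (2^-1 : R).
Let Lam : R := l0.+1%:R.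
Let Gam := cov_kernel Z.
Let e i j a := cv i j a + er i j a - b i j a.

Hypothesis Ecross : forall bb kap', kernel_conditions xs h m D bb kap' ->
  forall N, (Ex P (fun a => gridmax (l0 + N) (fun t => bil (kap' t) (fun i j => b i j a)
     (fun i k => cv i k a + er i k a)))%R <= cross%:E)%E.
Hypothesis LamU : Lam / (n%:R * m) <= U.

Let xs_inj i : injective (xs i).
Proof.
move=> j k; have [jk|kj|jk] := ltngtP j k; last by move=> _; exact: val_inj.
- by move=> e'; have := xs_lt i jk; rewrite e' ltxx.
- by move=> e'; have := xs_lt i kj; rewrite e' ltxx.
Qed.

Let mcv := measurable_cv EZ xs01.
Let mer := measurable_er errE.
Let nR : 0 < n%:R :> R. Proof. by rewrite ltr0n. Qed.
Let DA0 : 0 <= D * A ^+ 2. Proof. by rewrite mulr_ge0// sqr_ge0. Qed.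
Let tau0 : 0 < tau. Proof. exact: err_proxy_gt0. Qed.
Let MB0 : 0 <= MB. Proof. exact: moment_bound_ge0. Qed.
Let CC0 : 0 <= CC.
Proof. by rewrite /CC /chain_const addr_ge0// divr_ge0// sqr_ge0. Qed.
Let me i j : measurable_fun setT (e i j).
Proof.
apply: measurable_funB; last exact: mb.
by apply: measurable_funD; [exact: mcv|exact: mer].
Qed.

Let fluct t a := bil (kap t) (fun i j => e i j a) (fun i j => e i j a) -
  n%:R^-1 * \sum_i \sum_j \sum_k kap t i j k * Gam (xs i j, xs i k).

Let products t a := n%:R^-1 * \sum_i \sum_j \sum_k kap t i j k *
       (cv i j a * cv i k a - cov_kernel Z (xs i j, xs i k)).
Let kapT t i j k := kap t i k j.

(* expanding [e]; transposing the kernel gives the mixed terms a common shape *)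
Let fluctE t a : fluct t a = products t a +
  bil (kap t) (fun i j => cv i j a + 1 * er i j a) (fun i j => er i j a) +
  bil (kapT t) (fun i j => cv i j a + 0 * er i j a) (fun i j => er i j a) -
  bil (kap t) (fun i j => b i j a) (fun i k => cv i k a + er i k a) -
  bil (kapT t) (fun i j => b i j a) (fun i k => cv i k a + er i k a) +
  bil (kap t) (fun i j => b i j a) (fun i j => b i j a).
Proof.
rewrite /fluct /products /kapT -!(bil_transpose (kap t)).
rewrite /bil -!mulrBr -!mulrDr -!mulrBr -!mulrDr; congr (_ * _).
rewrite -!(sumrB, big_split); apply: eq_bigr => i _ /=.
rewrite -!(sumrB, big_split); apply: eq_bigr => j _ /=.
rewrite -!(sumrB, big_split); apply: eq_bigr => k _ /=.
by rewrite /e /Gam; ring.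
Qed.

Definition products_const : R := chain_const (2^-1 `^ beta0) *
  (1 + 8 * (smooth_const A D ^+ 2 * (2 * MB + 2 * MB ^+ 2))).

Definition errors_const : R := 2 * CC * (1 + tau * A ^+ 2 * D ^+ 2 *
  (A * MB + 4 * tau * (ln (gauss_const R) * A + 4 * U))).

Let s := Num.sqrt (Lam / (n%:R * m)).

Let Eproducts N : (Ex P (fun a => gridmax (l0 + N) (products ^~ a)) <=
  (products_const / Num.sqrt n%:R)%:E)%E.
Proof.
have q0 : 0 < Num.sqrt (n%:R : R) by rewrite sqrtr_gt0.
apply: le_trans (curve_products beta01 CZ0 ZP EZ indE errE n0 xs01 xs_inj h0 m0 D0 wc
  kapP kap_lt kap1 q0 (l0 + N)) _.
rewrite lee_fin le_eqVlt; apply/orP; left; apply/eqP; rewrite /products_const -/MB.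
by rewrite -[X in 8 / X](sqr_sqrtr (ltW nR)); field; rewrite gt_eqF.
Qed.

Let Eerrors bb kap' (theta : R) N : 0 <= theta <= 1 -> kernel_conditions xs h m D bb kap' ->
  (theta != 0 -> forall t i (j k : 'I_p), tri t -> kap' t i j k != 0 -> (j < k)%N) ->
  (Ex P (fun a => gridmax (l0 + N)
      (fun t => bil (kap' t) (fun i j => cv i j a + theta * er i j a) (fun i j => er i j a)))%R <=
    (errors_const / 2 * s)%:E)%E.
Proof.
move=> /andP[t0 t1] kapP' lt'.
have nm0 : 0 < n%:R * m by rewrite mulr_gt0.
have s0 : 0 < s by rewrite sqrtr_gt0 divr_gt0.
have sE : s ^+ 2 = Lam / (n%:R * m) by rewrite sqr_sqrtr ?divr_ge0 ?(ltW nm0).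
(* balances the entropy against the variance *)
have lam0 : 0 < s * (n%:R * m) by rewrite mulr_gt0.
apply: le_trans (error_terms beta01 ZP EZ indE errE n0 xs01 xs_inj h0 m0 A0 D0 hl0 wc
  kapP' lt' lam0 N) _.
rewrite lee_fin -/Lam -/tau -/MB.
set esb := err_sqr_bound _ _ _ _ _ _.
have esbE : esb = 4 * tau * (ln (gauss_const R) * A + 4 * (Lam / (n%:R * m))).
  by rewrite /esb /err_sqr_bound mulrA.
have gc0 : 0 <= ln (gauss_const R) by rewrite ln_ge0// gauss_const_ge1.
have t4 : 0 <= 4 * tau by rewrite mulr_ge0// ltW.
have esb0 : 0 <= esb.
  rewrite esbE mulr_ge0// addr_ge0//; first exact: mulr_ge0.
  by rewrite mulr_ge0// divr_ge0// ltW.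
have esbU : esb <= 4 * tau * (ln (gauss_const R) * A + 4 * U).
  by rewrite esbE ler_wpM2l// lerD2l ler_wpM2l.
rewrite (_ : Lam / (s * (n%:R * m)) = s); last first.
  by rewrite invfM mulrCA -sE expr2 mulrA mulVf ?gt_eqF// mul1r.
rewrite /errors_const (_ : 2 * CC * _ / 2 * s = CC * (s * (1 + tau * A ^+ 2 * D ^+ 2 *
  (A * MB + 4 * tau * (ln (gauss_const R) * A + 4 * U))))); last by field.
rewrite ler_wpM2l// [leRHS]mulrDr mulr1 lerD2l.
rewrite (_ : s * (n%:R * m) * _ = s * (tau * A ^+ 2 * D ^+ 2 * (A * MB + theta ^+ 2 * esb))); last first.
  by field; rewrite !gt_eqF.
have k0 : 0 <= tau * A ^+ 2 * D ^+ 2.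
  by rewrite mulr_ge0 ?sqr_ge0// mulr_ge0 ?sqr_ge0// ltW.
rewrite ler_wpM2l ?(ltW s0)// ler_wpM2l// lerD2l.
apply: le_trans esbU; rewrite ler_piMl//.
by rewrite expr_le1.
Qed.

Let msn_b a := mean_sqr_norm (fun i j => b i j a).

Let mmsn : measurable_fun setT msn_b.
Proof. by rewrite /msn_b /mean_sqr_norm /vnorm; meas. Qed.

Let form_msn t (z : 'I_n -> 'I_p -> R) : tri t ->
  `|bil (kap t) z z| <= D * A ^+ 2 * mean_sqr_norm z.
Proof.
move=> tt; rewrite /bil normrM gtr0_norm ?invr_gt0// /mean_sqr_norm mulrCA.
rewrite ler_wpM2l ?invr_ge0//; apply: le_trans (ler_norm_sum _ _ _) _.
rewrite mulr_sumr; apply: ler_sum => i _.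
under eq_bigr do under eq_bigr do rewrite -mulrA.
exact: (form_product_le h0 m0 D0 wc kapP i (z i) (z i) tt).
Qed.

Let mproducts N : measurable_fun setT (fun a => gridmax (l0 + N) (products ^~ a)).
Proof.
apply: measurable_bigmax => c; apply: measurable_norm.
apply: measurable_funM; first exact: measurable_cst.
apply: measurable_sum => i; apply: measurable_sum => j; apply: measurable_sum => k.
apply: measurable_funM; first exact: measurable_cst.
apply: measurable_funB; last exact: measurable_cst.
by apply: measurable_funM; exact: mcv.
Qed.

Let mforms kap' theta N : measurable_fun setT (fun a => gridmax (l0 + N)
  (fun t => bil (kap' t) (fun i j => cv i j a + theta * er i j a) (fun i j => er i j a))).
Proof.
apply: (measurable_gridmax kap' (b := fun i j a => cv i j a + theta * er i j a)) => i j; last exact: mer.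
apply: measurable_funD; first exact: mcv.
by apply: measurable_funM; [exact: measurable_cst|exact: mer].
Qed.

Let mcross kap' N : measurable_fun setT (fun a => gridmax (l0 + N)
  (fun t => bil (kap' t) (fun i j => b i j a) (fun i j => cv i j a + er i j a))).
Proof.
apply: (measurable_gridmax kap' (c := fun i j a => cv i j a + er i j a)) => i j; first exact: mb.
by apply: measurable_funD; [exact: mcv|exact: mer].
Qed.

Let Efluct N : (Ex P (fun a => gridmax (l0 + N) (fluct ^~ a)) <=
  (products_const / Num.sqrt n%:R + errors_const * s + 2 * cross + D * A ^+ 2 * r2)%:E)%E.
Proof.
have kapTP : kernel_conditions xs h m D false kapT by exact: kernel_transpose kapP.
have t1 : 0 <= (1 : R) <= 1 by rewrite ler01 lexx.
have t0 : 0 <= (0 : R) <= 1 by rewrite ler01 lexx.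
have lt1 : (1 : R) != 0 -> forall t i (j k : 'I_p), tri t -> kap t i j k != 0 -> (j < k)%N.
  by move=> _; exact: kap_lt.
have lt0 : (0 : R) != 0 -> forall t i (j k : 'I_p), tri t -> kapT t i j k != 0 -> (j < k)%N.
  by rewrite eqxx.
pose g0 a := gridmax (l0 + N) (products ^~ a).
pose g1 a := gridmax (l0 + N)
  (fun t => bil (kap t) (fun i j => cv i j a + 1 * er i j a) (fun i j => er i j a)).
pose g2 a := gridmax (l0 + N)
  (fun t => bil (kapT t) (fun i j => cv i j a + 0 * er i j a) (fun i j => er i j a)).
pose g3 a := gridmax (l0 + N)
  (fun t => bil (kap t) (fun i j => b i j a) (fun i j => cv i j a + er i j a)).
pose g4 a := gridmax (l0 + N)
  (fun t => bil (kapT t) (fun i j => b i j a) (fun i j => cv i j a + er i j a)).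
have pos := gridmax_ge0.
have bs0 a : 0 <= D * A ^+ 2 * msn_b a by rewrite mulr_ge0// mean_sqr_norm_ge0.
rewrite (_ : _ + _ + _ + _ = products_const / Num.sqrt n%:R + (errors_const / 2 * s +
   (errors_const / 2 * s + (cross + (cross + D * A ^+ 2 * r2))))); last first.
  by field; rewrite gt_eqF// sqrtr_gt0.
apply: (@le_trans _ _ (Ex P (fun a => g0 a + (g1 a + (g2 a + (g3 a + (g4 a + D * A ^+ 2 * msn_b a))))))).
  apply: Ex_le => a; first exact: pos.
  apply: bigmax_le => [|c _].
    by do 5! (apply: addr_ge0; first exact: pos).
  rewrite fluctE -!addrA; have tc := gpt_tri R c.
  have b0 := gridmax_ge (products ^~ a) c.
  have b1 := gridmax_ge (fun t => bil (kap t) (fun i j => cv i j a + 1 * er i j a) (fun i j => er i j a)) c.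
  have b2 := gridmax_ge (fun t => bil (kapT t) (fun i j => cv i j a + 0 * er i j a) (fun i j => er i j a)) c.
  have b3 := gridmax_ge (fun t => bil (kap t) (fun i j => b i j a) (fun i j => cv i j a + er i j a)) c.
  have b4 := gridmax_ge (fun t => bil (kapT t) (fun i j => b i j a) (fun i j => cv i j a + er i j a)) c.
  apply: le_trans (ler_normD _ _) (lerD b0 _).
  apply: le_trans (ler_normD _ _) (lerD b1 _).
  apply: le_trans (ler_normD _ _) (lerD b2 _).
  apply: le_trans (ler_normD _ _) _; rewrite normrN; apply: (lerD b3).
  apply: le_trans (ler_normD _ _) _; rewrite normrN; apply: (lerD b4).
  exact: form_msn.
have mlast : measurable_fun setT (fun a => D * A ^+ 2 * msn_b a) by meas.
have m4 : measurable_fun setT g4 by exact: mcross.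
have m3 : measurable_fun setT g3 by exact: mcross.
have m2 : measurable_fun setT g2 by exact: mforms.
have m1 : measurable_fun setT g1 by exact: mforms.
have m0' : measurable_fun setT g0 by exact: mproducts.
apply: Ex_add_le => //; [by move=> a; exact: pos|by move=> a; do ! (apply: addr_ge0; first exact: pos)|by meas|exact: Eproducts|].
apply: Ex_add_le => //; [by move=> a; exact: pos|by move=> a; do ! (apply: addr_ge0; first exact: pos)|by meas|exact: (Eerrors _ t1 kapP lt1)|].
apply: Ex_add_le => //; [by move=> a; exact: pos|by move=> a; do ! (apply: addr_ge0; first exact: pos)|by meas|exact: (Eerrors _ t0 kapTP lt0)|].
apply: Ex_add_le => //; [by move=> a; exact: pos|by move=> a; do ! (apply: addr_ge0; first exact: pos)|by meas|exact: (Ecross kapP)|].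
apply: Ex_add_le => //; [by move=> a; exact: pos|exact: (Ecross kapTP)|].
rewrite Ex_scale//; last by move=> a; exact: mean_sqr_norm_ge0.
by rewrite [leRHS]EFinM; apply: lee_wpmul2l; rewrite ?lee_fin.
Qed.

Let tri_design i (j k : 'I_p) : (j < k)%N -> tri (xs i j, xs i k).
Proof.
move=> jk; have /andP[j0 _] := xs01 i j; have /andP[_ k1] := xs01 i k.
by split=> //=; split=> //; exact/ltW/xs_lt.
Qed.

Let GamL : hoelder_class gamma L Gam.
Proof. by have [] := ZP. Qed.

Let bias := D * A ^+ 2 * ((sfloor gamma).+2%:R * (L * h `^ gamma)).

Let bias_le t : tri t ->
  `|n%:R^-1 * \sum_i \sum_j \sum_k kap t i j k * Gam (xs i j, xs i k) - Gam t| <= bias.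
Proof.
move=> tt; have [K1 _ _] := kapP.
have row i : `|\sum_j \sum_k kap t i j k * Gam (xs i j, xs i k) - Gam t| <= bias.
  apply: (kernel_bias gamma0 GamL tt h0 (kernel_mass h0 m0 D0 wc kapP i tt) _ (kap1 i tt)).
    move=> j k nz; split; first exact/tri_design/(kap_lt tt nz).
    by have [e1 e2] := K1 _ _ _ _ tt nz; rewrite /supdist ge_max /= e1.
  by move=> q1 q2; exact: kap_moments.
rewrite (_ : _ - _ = n%:R^-1 * \sum_i (\sum_j \sum_k kap t i j k * Gam (xs i j, xs i k) - Gam t)); last first.
  rewrite sumrB sumr_const card_ord mulrBr -[Gam t *+ n]mulr_natl mulrA mulVf ?mul1r//.
  by rewrite gt_eqF.
rewrite normrM gtr0_norm ?invr_gt0// mulrC ler_pdivrMr//.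
apply: le_trans (ler_norm_sum _ _ _) _.
apply: le_trans (ler_sum _ (fun i _ => row i)) _.
by rewrite sumr_const card_ord mulr_natr.
Qed.

Let msn_e a := mean_sqr_norm (fun i j => e i j a).

Let resid_le N t a : tri t -> exists c : gidx (l0 + N),
  `|fluct t a - fluct (gpt R c) a| <= D * A ^+ 2 * 2^-1 ^+ N * (msn_e a + L).
Proof.
move=> tt; have [c dist] := gpt_approx (l0 + N) tt; exists c.
have tc := gpt_tri R c; have hpos := h0.
have distN : supdist t (gpt R c) <= h * 2^-1 ^+ N.
  by apply: le_trans dist _; rewrite exprD ler_wpM2r// exprn_ge0// invr_ge0.
have N1 : 2^-1 ^+ N <= 1 :> R by rewrite exprn_ile1 ?invr_ge0//; lra.
have disth : supdist t (gpt R c) <= h.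
  by apply: le_trans distN _; rewrite ler_piMr// ltW.
have -> : fluct t a - fluct (gpt R c) a = n%:R^-1 * \sum_i \sum_j \sum_k
    (kap t i j k - kap (gpt R c) i j k) * (e i j a * e i k a - Gam (xs i j, xs i k)).
  rewrite /fluct /bil -!mulrBr; congr (_ * _).
  rewrite -!sumrB; apply: eq_bigr => i _; rewrite -!sumrB; apply: eq_bigr => j _.
  by rewrite -!sumrB; apply: eq_bigr => k _; ring.
rewrite normrM gtr0_norm ?invr_gt0// mulrC ler_pdivrMr//.
apply: le_trans (ler_norm_sum _ _ _) _.
rewrite (_ : _ * n%:R = \sum_i D * A ^+ 2 * 2^-1 ^+ N * (vnorm (e i ^~ a) ^+ 2 + L)); last first.
  rewrite -mulr_sumr big_split /= sumr_const card_ord -[L *+ n]mulr_natl.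
  by rewrite /msn_e /mean_sqr_norm; field; rewrite gt_eqF.
apply: ler_sum => i _.
apply: le_trans (kernel_form_le (s := vnorm (e i ^~ a) ^+ 2 + L) _
    (kernel_increment_mass h0 m0 D0 wc kapP i tt tc disth) _) _.
- by rewrite addr_ge0// sqr_ge0.
- move=> j k nz; have jk : (j < k)%N.
    have [e0|] := eqVneq (kap t i j k) 0; last exact: kap_lt.
    by apply: (kap_lt tc (i := i)); apply: contraNneq nz => ->; rewrite e0 subrr.
  apply: le_trans (ler_normB _ _) _; apply: lerD.
    by rewrite normrM expr2 ler_pM// (vnorm_ge (e i ^~ a)).
  exact: (hoelder_class_sup GamL (tri_design i jk)).
by rewrite ler_wpM2r ?addr_ge0 ?sqr_ge0// ler_wpM2l// ler_pdivrMr// mulrC.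
Qed.

Let estimator_le N t a : tri t ->
  `|bil (kap t) (fun i j => e i j a) (fun i j => e i j a) - Gam t| <=
    gridmax (l0 + N) (fluct ^~ a) + D * A ^+ 2 * 2^-1 ^+ N * (msn_e a + L) + bias.
Proof.
move=> tt; have [c cP] := resid_le N a tt.
have gc := gridmax_ge (fluct ^~ a) c; have bl := bias_le tt.
set I := n%:R^-1 * \sum_i _ in bl.
have fE : fluct t a = bil (kap t) (fun i j => e i j a) (fun i j => e i j a) - I by [].
rewrite (_ : _ - Gam t = fluct (gpt R c) a + (fluct t a - fluct (gpt R c) a) + (I - Gam t)); last first.
  by rewrite fE; ring.
apply: le_trans (ler_normD _ _) _; apply: lerD => //.
by apply: le_trans (ler_normD _ _) _; apply: lerD.
Qed.

Let vnorm_sqr_le (z : 'I_p -> R) : vnorm z ^+ 2 <= \sum_j z j ^+ 2.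
Proof.
rewrite -(@sqr_sqrtr _ (\sum_j z j ^+ 2)); last by rewrite sumr_ge0// => j _; exact: sqr_ge0.
rewrite lerXn2r ?nnegrE ?sqrtr_ge0 ?vnorm_ge0//; apply: bigmax_le => [|j _].
  exact: sqrtr_ge0.
rewrite -sqrtr_sqr ler_wsqrtr// (bigD1 j)//= lerDl sumr_ge0// => k _.
exact: sqr_ge0.
Qed.

Let Emsn_er : (Ex P (fun a => mean_sqr_norm (fun i j => er i j a)) <= (p%:R * tau)%:E)%E.
Proof.
have msq i j : measurable_fun setT (fun a => er i j a ^+ 2).
  by apply: measurable_funX; exact: mer.
apply: (@le_trans _ _ (Ex P (fun a => n%:R^-1 * \sum_i \sum_j er i j a ^+ 2)%R)).
  apply: Ex_le => a; first exact: mean_sqr_norm_ge0.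
  rewrite /mean_sqr_norm ler_wpM2l ?invr_ge0//; apply: ler_sum => i _.
  exact: vnorm_sqr_le.
rewrite Ex_scale ?invr_ge0//; first last.
- by apply: measurable_sum => i; apply: measurable_sum => j; exact: msq.
- by move=> a; do 2! (rewrite sumr_ge0// => ? _); exact: sqr_ge0.
rewrite Ex_sum; first last.
- by move=> i; apply: measurable_sum => j; exact: msq.
- by move=> i a; rewrite sumr_ge0// => ? _; exact: sqr_ge0.
apply: (@le_trans _ _ ((n%:R^-1)%:E * (\sum_(i < n) (p%:R * tau)%:E))%E).
  apply: lee_wpmul2l; first by rewrite lee_fin invr_ge0.
  apply: lee_sum => i _; rewrite Ex_sum; [|by move=> j a; exact: sqr_ge0|by move=> j; exact: msq].
  rewrite (_ : p%:R * tau = \sum_(j < p) tau); last by rewrite sumr_const card_ord mulr_natl.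
  by rewrite -sumEFin; apply: lee_sum => j _; exact: err_sqr.
rewrite sumEFin sumr_const card_ord -EFinM lee_fin -[X in _ * X]mulr_natl mulrA mulVf ?mul1r//.
by rewrite gt_eqF.
Qed.

Let mmsn_gen (z : 'I_n -> 'I_p -> espace E -> R) :
  (forall i j, measurable_fun setT (z i j)) ->
  measurable_fun setT (fun a => mean_sqr_norm (fun i j => z i j a)).
Proof. by move=> mz; rewrite /mean_sqr_norm /vnorm; meas. Qed.

Let Emsn_e : (Ex P msn_e <= (3 * (MB + (p%:R * tau + r2)))%:E)%E.
Proof.
pose g a := mean_sqr_norm (fun i j => cv i j a) +
  (mean_sqr_norm (fun i j => er i j a) + msn_b a).
have pos := @mean_sqr_norm_ge0 R n p.
have g0 a : 0 <= g a by apply: addr_ge0; [|apply: addr_ge0]; exact: pos.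
have m1 : measurable_fun setT (fun a => mean_sqr_norm (fun i j => cv i j a)).
  by apply: mmsn_gen; exact: mcv.
have m2 : measurable_fun setT (fun a => mean_sqr_norm (fun i j => er i j a)).
  by apply: mmsn_gen; exact: mer.
apply: (@le_trans _ _ (Ex P (fun a => 3 * g a))).
  apply: Ex_le => a; first exact: pos.
  rewrite /g /msn_e /msn_b /mean_sqr_norm -!mulrDr mulrCA ler_wpM2l ?invr_ge0//.
  rewrite -!big_split mulr_sumr; apply: ler_sum => i _ /=.
  set u := vnorm (cv i ^~ a); set v := vnorm (er i ^~ a); set w := vnorm (b i ^~ a).
  apply: (@le_trans _ _ ((u + v + w) ^+ 2)); last first.
    by have := sqr_ge0 (u - v); have := sqr_ge0 (u - w); have := sqr_ge0 (v - w); nra.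
  rewrite lerXn2r ?nnegrE ?addr_ge0 ?vnorm_ge0//.
  apply: bigmax_le => [|j _]; first by rewrite !addr_ge0 ?vnorm_ge0.
  apply: le_trans (ler_normB _ _) _; apply: lerD; last exact: (vnorm_ge (b i ^~ a)).
  by apply: le_trans (ler_normD _ _) _; apply: lerD;
    [exact: (vnorm_ge (cv i ^~ a))|exact: (vnorm_ge (er i ^~ a))].
have mg : measurable_fun setT g by rewrite /g; meas.
rewrite Ex_scale// EFinM; apply: lee_wpmul2l; first by rewrite lee_fin.
apply: Ex_add_le => //.
- by move=> a; apply: addr_ge0; exact: pos.
- by meas.
- exact: (mean_sqr_norm_mean beta01 ZP EZ n0 xs01 xs_inj).
by apply: Ex_add_le => // a; exact: pos.
Qed.

(** A measurable majorant of the error at all points of the triangle. The grid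
    of level [l0 + n + p] is so fine that the crude Lipschitz bound for the
    passage from the grid to the triangle costs at most [1 / sqrt n]. *)
Lemma risk_bound : exists g : espace E -> R, [/\ measurable_fun setT g,
  forall a t, tri t ->
     `|bil (kap t) (fun i j => e i j a) (fun i j => e i j a) - Gam t| <= g a &
  (Ex P g <= ((products_const + D * A ^+ 2 * (3 * MB + 3 * tau + L)) / Num.sqrt n%:R +
     errors_const * Num.sqrt (Lam / (n%:R * m)) + 2 * cross + 4 * (D * A ^+ 2) * r2 +
     D * A ^+ 2 * ((sfloor gamma).+2%:R * (L * h `^ gamma)))%:E)%E].
Proof.
pose N := (n + p)%N.
have r20 : 0 <= r2.
  by rewrite -lee_fin; apply: le_trans Eb; apply: Ex_ge0 => a; exact: mean_sqr_norm_ge0.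
pose g a := gridmax (l0 + N) (fluct ^~ a) + D * A ^+ 2 * 2^-1 ^+ N * (msn_e a + L) + bias.
have bias0 : 0 <= bias.
  by rewrite mulr_ge0// mulr_ge0// mulr_ge0// powR_ge0.
have c0 : 0 <= D * A ^+ 2 * 2^-1 ^+ N by rewrite mulr_ge0// exprn_ge0// invr_ge0.
have q0 : 0 < Num.sqrt (n%:R : R) by rewrite sqrtr_gt0.
have mfl : measurable_fun setT (fun a => gridmax (l0 + N) (fluct ^~ a)).
  apply: measurable_bigmax => c; apply: measurable_norm.
  apply: measurable_funB; last exact: measurable_cst.
  rewrite /bil; apply: measurable_funM; first exact: measurable_cst.
  apply: measurable_sum => i; apply: measurable_sum => j; apply: measurable_sum => k.
  apply: measurable_funM; last exact: me.
  by apply: measurable_funM; [exact: measurable_cst|exact: me].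
have mme : measurable_fun setT msn_e by exact: mmsn_gen.
have mse0 a : 0 <= msn_e a by exact: mean_sqr_norm_ge0.
exists g; split.
- by rewrite /g; meas.
- by move=> a t tt; exact: estimator_le.
have small : 2^-1 ^+ N * (3 * (MB + (p%:R * tau + r2)) + L) <=
    (3 * MB + 3 * tau + L) / Num.sqrt n%:R + 3 * r2.
  have two k : k%:R * 2^-1 ^+ k <= 1 :> R.
    rewrite exprVn ler_pdivrMr ?exprn_gt0// mul1r -natrX ler_nat.
    exact/ltnW/ltn_expl.
  have half k : 0 <= (2^-1 : R) ^+ k <= 1.
    by rewrite exprn_ge0 ?invr_ge0//= exprn_ile1 ?invr_ge0//; lra.
  have e1 : 2^-1 ^+ n <= (Num.sqrt (n%:R : R))^-1.
    rewrite -[leRHS]mul1r ler_pdivlMr// mulrC.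
    apply: le_trans (two n); apply: ler_wpM2r; first by case/andP: (half n).
    have q1 : 1 <= Num.sqrt (n%:R : R) by rewrite -[leLHS]sqrtr1 ler_wsqrtr// ler1n.
    by rewrite -[leRHS](sqr_sqrtr (ltW nR)) expr2 ler_peMr ?(ltW q0).
  have e2 : 2^-1 ^+ N * p%:R <= (Num.sqrt (n%:R : R))^-1.
    rewrite /N exprD -mulrA -[leRHS]mulr1; apply: ler_pM.
    - by case/andP: (half n).
    - by apply: mulr_ge0; first by case/andP: (half p).
    - exact: e1.
    - by rewrite mulrC; exact: two.
  have e3 : 2^-1 ^+ N <= (Num.sqrt (n%:R : R))^-1.
    apply: le_trans e2; rewrite ler_peMr ?ler1n//; by case/andP: (half N).
  have /andP[_ e4] := half N.
  have t1 : tau * (2^-1 ^+ N * p%:R) <= tau / Num.sqrt n%:R by rewrite ler_wpM2l// ltW.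
  have ML0 : 0 <= 3 * MB + L by rewrite addr_ge0// mulr_ge0.
  have t2 : (3 * MB + L) * 2^-1 ^+ N <= (3 * MB + L) / Num.sqrt n%:R by rewrite ler_wpM2l.
  have t3 : r2 * 2^-1 ^+ N <= r2 by rewrite ler_piMr.
  rewrite (_ : 2^-1 ^+ N * _ = (3 * MB + L) * 2^-1 ^+ N + 3 * (tau * (2^-1 ^+ N * p%:R)) + 3 * (r2 * 2^-1 ^+ N)); last by ring.
  rewrite (_ : (3 * MB + 3 * tau + L) / _ = (3 * MB + L) / Num.sqrt n%:R + 3 * (tau / Num.sqrt n%:R)); last by ring.
  lra.
have small' := ler_wpM2l DA0 small.
apply: (@le_trans _ _ (products_const / Num.sqrt n%:R + errors_const * s + 2 * cross +
  D * A ^+ 2 * r2 + D * A ^+ 2 * 2^-1 ^+ N * (3 * (MB + (p%:R * tau + r2)) + L) + bias)%:E).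
  rewrite /g; apply: Ex_add_le => //; last by rewrite Ex_cst.
  - move=> a; apply: addr_ge0; first exact: gridmax_ge0.
    by rewrite mulr_ge0// addr_ge0.
  - by meas.
  apply: Ex_add_le => //.
  - by move=> a; exact: gridmax_ge0.
  - by move=> a; rewrite mulr_ge0// addr_ge0.
  - by meas.
  rewrite Ex_scale//; [|by move=> a; rewrite addr_ge0|by meas].
  rewrite [leRHS]EFinM; apply: lee_wpmul2l; first by rewrite lee_fin.
  by apply: Ex_add_le => //; rewrite Ex_cst.
rewrite lee_fin -/bias -/s lerD2r.
set V := (3 * MB + 3 * tau + L) / Num.sqrt n%:R in small'.
rewrite (_ : (products_const + _) / _ = products_const / Num.sqrt n%:R + D * A ^+ 2 * V); last first.
  by rewrite /V; ring.
rewrite mulrA (mulrDr _ V) in small'.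
set W := _ * (3 * _ + L) in small' *.
lra.
Qed.

End Decomposition.

(** * The estimator and its rates *)

Section Estimator.
Context (R : realType) (mu : R -> R) (x : design R) (w : weights R).
Variables (gamma c sigma2 kappa beta0 L CZ C1 C2 C3 : R).
Hypothesis gamma0 : 0 < gamma.
Hypothesis c0 : 0 < c.
Hypothesis kappa1 : 1 <= kappa.
Hypothesis beta01 : 0 < beta0 <= 1.
Hypothesis L0 : 0 < L.
Hypothesis CZ0 : 0 < CZ.
Hypothesis C10 : 0 < C1.
Hypothesis C20 : 0 < C2.
Hypothesis C30 : 0 < C3.
Hypothesis design_x : design_points x.
Hypothesis density_x : forall n p (i : 'I_n) (t h : R), 0 <= t <= 1 -> 0 < h -> p%:R^-1 <= h ->
      #|[pred j : 'I_p | t - h <= x i j <= t + h]|%:R <= C3 * p%:R * h.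
Variables (n p : nat) (h : R).
Hypothesis n0 : (0 < n)%N.
Hypothesis p0 : (0 < p)%N.
Hypothesis ch : c / p%:R < h.
Hypothesis weights_w : forall i : 'I_n, weight_conditions x w (sfloor gamma) C1 C2 p i h.
Variables (Z : process R) (E : experiment R n p).
Hypothesis ZP : process_class gamma L beta0 CZ Z.
Hypothesis EZ : iid_copies E Z.
Hypothesis indE : sources_independent E.
Hypothesis errE : error_conditions E sigma2 kappa.

Let nR : 0 < n%:R :> R. Proof. by rewrite ltr0n. Qed.
Let pR : 0 < p%:R :> R. Proof. by rewrite ltr0n. Qed.
Let h_gt0 : 0 < h. Proof. by apply: le_lt_trans ch; rewrite divr_ge0// ltW. Qed.

Definition window_const : R := C3 * (3 + c^-1).
Definition weight_const : R := C1 + C2.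

Let m : R := p%:R * h.
Let A := window_const.
Let D := weight_const.
Let m0 : 0 < m. Proof. exact: mulr_gt0. Qed.
Let cm : c < m. Proof. by move: ch; rewrite ltr_pdivrMr// mulrC. Qed.
Let A0 : 0 <= A.
Proof. by rewrite mulr_ge0 ?(ltW C30)// addr_ge0// invr_ge0 ltW. Qed.
Let D0 : 0 <= D. Proof. by rewrite addr_ge0// ltW. Qed.

Definition weight_kernel (t : R * R) (i : 'I_n) (j k : 'I_p) : R :=
  if (j < k)%N then w i j k t.1 t.2 h else 0.

Lemma windows_design : windows_card (@x n p) h m A.
Proof.
move=> i u u01; have hpos := h_gt0; set h' := Num.max (3 * h) p%:R^-1.
have h'0 : 0 < h' by rewrite /h' lt_max invr_gt0 pR orbT.
have ph' : p%:R^-1 <= h' by rewrite /h' le_max lexx orbT.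
apply: le_trans (_ : C3 * p%:R * h' <= _).
  apply: le_trans (density_x i u01 h'0 ph'); rewrite ler_nat; apply: subset_leq_card.
  apply/fintype.subsetP => j; rewrite !inE ler_distl => /andP[j1 j2].
  have e : 3 * h <= h' by rewrite /h' le_max lexx.
  by apply/andP; split; lra.
rewrite -mulrA /A /window_const -mulrA ler_pM2l//.
rewrite (_ : (3 + c^-1) * m = p%:R * ((3 + c^-1) * h)); last by rewrite /m; ring.
rewrite ler_pM2l// mulrDl /h' ge_max; apply/andP; split.
  by rewrite lerDl mulr_ge0 ?invr_ge0 ?ltW.
apply: (@le_trans _ _ (c^-1 * h)); last by rewrite lerDr mulr_ge0// ltW.
rewrite ler_pdivlMl//; exact: ltW.
Qed.

Lemma weight_kernel_conditions : kernel_conditions (@x n p) h m D true weight_kernel.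
Proof.
have hpos := h_gt0; have mm : 0 < m ^+ 2 by rewrite exprn_gt0.
have C1D : C1 / m ^+ 2 <= D / m ^+ 2 by rewrite ler_pM2r ?invr_gt0// lerDl ltW.
have C2D : C2 / m ^+ 2 <= D / m ^+ 2 by rewrite ler_pM2r ?invr_gt0// lerDr ltW.
split=> [[u v] i j k tt|[u v] i j k tt|[u v] [u' v'] i j k tt tt'];
    have [_ W2 W3 W4] := weights_w i; rewrite /weight_kernel /=; case: ifP => jk.
- move=> nz; have [out|] := ltP h (Num.max `|x i j - u| `|x i k - v|).
    by move: nz; rewrite (W2 _ _ _ _ tt jk out) eqxx.
  by rewrite ge_max => /andP[].
- by rewrite eqxx.
- by apply: le_trans C1D; exact: W3.
- by rewrite normr0; apply: le_trans C1D; rewrite divr_ge0// ltW.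
- apply: le_trans (W4 _ _ _ _ _ _ tt tt' jk) _; apply: ler_pM => //.
  + by rewrite divr_ge0// ltW.
  + by rewrite le_min ler01 andbT divr_ge0 ?(ltW hpos)// le_max normr_ge0.
  + by rewrite ge_min lexx.
- rewrite subr0 normr0 mulr_ge0//; first by rewrite divr_ge0// ltW.
  by rewrite divr_ge0 ?(ltW hpos)// supdist_ge0.
Qed.

Let sum_ltE (F : 'I_p -> 'I_p -> R) :
  sum_lt F = \sum_(j < p) \sum_(k < p) (if (j < k)%N then F j k else 0).
Proof. by rewrite /sum_lt; apply: eq_bigr => j _; rewrite big_mkcond. Qed.

Lemma weight_kernel_lt t i (j k : 'I_p) : tri t -> weight_kernel t i j k != 0 -> (j < k)%N.
Proof. by move=> _; rewrite /weight_kernel; case: ifP => //; rewrite eqxx. Qed.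

Lemma weight_kernel_sum t i : tri t -> \sum_j \sum_k weight_kernel t i j k = 1.
Proof.
by case: t => u v tt; have [/(_ u v tt)[<- _] _ _ _] := weights_w i; rewrite sum_ltE.
Qed.

Lemma weight_kernel_moments t i (r1 r2 : nat) : tri t ->
  (1 <= r1 + r2 <= sfloor gamma)%N ->
  \sum_j \sum_k (x i j - t.1) ^+ r1 * (x i k - t.2) ^+ r2 * weight_kernel t i j k = 0.
Proof.
case: t => u v tt r12; have [W1 _ _ _] := weights_w i.
have [_ /(_ r1 r2 r12) moment] := W1 u v tt; rewrite -[RHS]moment sum_ltE; apply: eq_bigr => j _; apply: eq_bigr => k _.
by rewrite /weight_kernel; case: ifP; rewrite ?mulr0.
Qed.

Let b (i : 'I_n) (j : 'I_p) a : R := @muhat R n p E i (x i j) a - mu (x i j).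
Let e (i : 'I_n) (j : 'I_p) a : R := @curve R n p E i (x i j) a + @err R n p E i j a - b i j a.

Lemma gamma_hat_triE u v (a : espace E) : gamma_hat_tri mu x w h u v a =
  bil (weight_kernel (u, v)) (fun i j => e i j a) (fun i j => e i j a).
Proof.
rewrite /gamma_hat_tri /bil; congr (_ * _); apply: eq_bigr => i _.
rewrite sum_ltE; apply: eq_bigr => j _; apply: eq_bigr => k _.
rewrite /weight_kernel /=; case: ifP => _; last by rewrite !mul0r.
by rewrite /obs /e /b; ring.
Qed.

Lemma cov_error_le (g : espace E -> R) :
  (forall a t, tri t -> `|bil (weight_kernel t) (fun i j => e i j a) (fun i j => e i j a) -
     cov_kernel Z t| <= g a) ->
  forall a : espace E, (cov_error mu x w h Z a <= (g a)%:E)%E.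
Proof.
move=> gP a; apply/ereal_supP => _ [[u v] /= [/andP[u0 u1] /andP[v0 v1]] <-].
rewrite lee_fin /gamma_hat; have [uv|/ltW vu] := leP u v.
  by rewrite gamma_hat_triE; apply: gP.
rewrite gamma_hat_triE (_ : cov_kernel Z (u, v) = cov_kernel Z (v, u)); first exact: gP.
rewrite /cov_kernel; congr (fine ('E_(plaw Z)[_])).
by apply/funext => a' /=; rewrite mulrC.
Qed.

Lemma cov_error_ge0 (a : espace E) : (0 <= cov_error mu x w h Z a)%E.
Proof.
apply: (@le_trans _ _ `|gamma_hat mu x w h 0 0 a - cov_kernel Z (0, 0)|%:E).
  by rewrite lee_fin.
by apply: ereal_sup_ubound; exists (0, 0) => //=; rewrite lexx ler01.
Qed.

(** The grid of this level is finer than the bandwidth; the factor [2] accounts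
    for [1 / 2 <= ln 2]. *)
Definition start_level : nat := (Num.truncn (2 * Num.max (ln h^-1) 0)).+1.

Let Lam : R := start_level.+1%:R.
Let ell : R := Num.max (ln h^-1) 0.
Let ell0 : 0 <= ell. Proof. by rewrite /ell le_max lexx orbT. Qed.

Lemma start_level_fine : 2^-1 ^+ start_level <= h.
Proof.
have hpos := h_gt0; have ln2 : 2^-1 <= ln (2 : R).
  have := @le_ln1Dx R (- 2^-1).
  rewrite (_ : 1 + - 2^-1 = (2 : R)^-1); last by field.
  by rewrite lnV ?posrE// => H; have := H _; lra.
rewrite exprVn -[leRHS]invrK lef_pV2 ?posrE ?invr_gt0 ?exprn_gt0//.
rewrite -ler_ln ?posrE ?invr_gt0 ?exprn_gt0// lnXn// -[ln 2 *+ _]mulr_natl.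
have t : 2 * ell < start_level%:R.
  by have /andP[_] := truncn_itv (mulr_ge0 (ler0n R 2) ell0).
have le : ln h^-1 <= ell by rewrite /ell le_max lexx.
have : start_level%:R * 2^-1 <= start_level%:R * ln (2 : R) by rewrite ler_wpM2l.
lra.
Qed.

Lemma start_level_le : Lam <= 2 * ell + 2.
Proof.
have /andP[t _] := truncn_itv (mulr_ge0 (ler0n R 2) ell0).
rewrite /Lam /start_level -[_.+2]addn2 natrD.
exact: lerD.
Qed.

(** The entropy is logarithmic in [h^-1], and [m] is at least [c]: this converts
    the entropy terms of the chaining bounds into those of the rates. *)
Lemma sqrt_entropy_le (q : R) : 0 < q -> Num.sqrt (Lam / (q * m)) <=
  2 * Num.sqrt (ln h^-1 / (q * p%:R * h)) + Num.sqrt (2 / c) / Num.sqrt q.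
Proof.
move=> q0; have qm : 0 < q * m by rewrite mulr_gt0.
have l1 : Num.sqrt (2 * ell / (q * m)) <= 2 * Num.sqrt (ln h^-1 / (q * p%:R * h)).
  rewrite -(mulrA q) -/m /ell; case: (leP (ln h^-1) 0) => [l|l].
    by rewrite mulr0 mul0r sqrtr0 mulr_ge0// sqrtr_ge0.
  have l0 : 0 <= ln h^-1 / (q * m) by rewrite divr_ge0// ltW.
  rewrite -mulrA -[X in _ <= X * _](@ger0_norm _ 2)// -sqrtr_sqr -sqrtrM ?sqr_ge0//.
  by rewrite ler_wsqrtr// ler_wpM2r//; lra.
have l2 : Num.sqrt (2 / (q * m)) <= Num.sqrt (2 / c) / Num.sqrt q.
  rewrite -sqrtrV ?(ltW q0)// -sqrtrM ?divr_ge0 ?(ltW c0)//.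
  rewrite ler_wsqrtr// -mulrA -invfM ler_pM2l// lef_pV2 ?posrE ?mulr_gt0//.
  by rewrite [leRHS]mulrC ler_pM2r// ltW.
apply: le_trans (lerD l1 l2).
apply: (@le_trans _ _ (Num.sqrt (2 * ell / (q * m) + 2 / (q * m)))).
  by rewrite ler_wsqrtr// -mulrDl ler_pM2r ?invr_gt0// start_level_le.
have a0 : 0 <= 2 * ell / (q * m) by rewrite divr_ge0 ?mulr_ge0// ltW.
have b0 : 0 <= 2 / (q * m) by rewrite divr_ge0// ltW.
rewrite -(@ler_pXn2r _ 2)// ?nnegrE ?addr_ge0 ?sqrtr_ge0//.
rewrite sqrrD !sqr_sqrtr ?addr_ge0// -addrA lerD2l lerDr.
by rewrite -mulr_natl ?mulr_ge0// sqrtr_ge0.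
Qed.

Definition log_const (B : R) : R := 2 * `|B| + 2 * `|ln c| + 2.

(** The bandwidth exceeds [c / p], so that the entropy is at most of order
    [ln p]. *)
Lemma start_level_log (B y : R) : 1 <= y -> ln p%:R <= B * y -> Lam <= log_const B * y.
Proof.
move=> y1 lp; have hpos := h_gt0; have y0 : 0 <= y by exact: le_trans y1.
have By : B * y <= `|B| * y by rewrite ler_wpM2r// ler_norm.
have cy : `|ln c| <= `|ln c| * y by rewrite ler_peMr.
have l : ln h^-1 <= ln p%:R - ln c.
  rewrite -ln_div ?posrE// ler_ln ?posrE ?invr_gt0 ?divr_gt0//.
  by rewrite -[leRHS]invrK lef_pV2 ?posrE ?invr_gt0 ?divr_gt0// invf_div ltW.
have nc := ler_norm (- ln c); rewrite normrN in nc.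
have ell_le : ell <= `|B| * y + `|ln c| * y.
  rewrite /ell ge_max; apply/andP; split; first by lra.
  by rewrite addr_ge0// mulr_ge0.
by apply: le_trans start_level_le _; rewrite /log_const; lra.
Qed.

Let tau := err_proxy sigma2 kappa.
Let P := elaw E.
Let MB := moment_bound CZ.
Let CC := chain_const (2^-1 : R).
Let cv (i : 'I_n) (j : 'I_p) a : R := @curve R n p E i (x i j) a.
Let er (i : 'I_n) (j : 'I_p) a : R := @err R n p E i j a.
Let x01 (i : 'I_n) (j : 'I_p) : 0 <= x i j <= 1. Proof. by have [+ _] := @design_x n p i; exact. Qed.

Let x_lt (i : 'I_n) (j k : 'I_p) : (j < k)%N -> x i j < x i k.
Proof. by have [_ +] := @design_x n p i; exact. Qed.

Let x_inj (i : 'I_n) : injective (@x n p i).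
Proof.
move=> j k; have [jk|kj|jk] := ltngtP j k; last by move=> _; exact: val_inj.
- by move=> e'; have := x_lt i jk; rewrite e' ltxx.
- by move=> e'; have := x_lt i kj; rewrite e' ltxx.
Qed.

Let DA0 : 0 <= D * A ^+ 2. Proof. by rewrite mulr_ge0// sqr_ge0. Qed.
Let tau0 : 0 < tau. Proof. exact: err_proxy_gt0. Qed.
Let MB0 : 0 <= MB. Proof. exact: moment_bound_ge0. Qed.
Let CC0 : 0 <= CC.
Proof. by rewrite /CC /chain_const addr_ge0// divr_ge0// sqr_ge0. Qed.

Lemma vnorm_le_mean_error i a : ((vnorm (b i ^~ a))%:E <= mean_error mu i a)%E.
Proof.
have le t : 0 <= t <= 1 -> (`|@muhat R n p E i t a - mu t|%:E <= mean_error mu i a)%E.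
  by move=> t01; apply: ereal_sup_ubound; exists t.
have : (0 <= mean_error mu i a)%E.
  by apply: le_trans (le 0 _); rewrite ?lee_fin ?lexx ?ler01.
move: le; case: (mean_error mu i a) => [r||] le; [|by rewrite !leey|by rewrite leeNy_eq].
rewrite !lee_fin => r0; apply: bigmax_le => // j _.
by have := le _ (x01 i j); rewrite lee_fin.
Qed.

(** The supremum over [[0, 1]] may fail to be measurable, but its lower integral
    dominates that of the maximum over the design points. *)
Lemma mean_risk1_ge i : (Ex P (fun a => vnorm (b i ^~ a)) <= mean_risk E mu 1)%E.
Proof.
apply: (@le_trans _ _ (\int[P]_a mean_error mu i a ^+ 1)%E); last first.
  by apply: ereal_sup_ubound; exists i.
apply: lower_integral_le => a; first by rewrite lee_fin vnorm_ge0.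
exact: vnorm_le_mean_error.
Qed.

Lemma mean_risk2_ge i : (Ex P (fun a => vnorm (b i ^~ a) ^+ 2)%R <= mean_risk E mu 2)%E.
Proof.
apply: (@le_trans _ _ (\int[P]_a mean_error mu i a ^+ 2)%E); last first.
  by apply: ereal_sup_ubound; exists i.
apply: lower_integral_le => a; first by rewrite lee_fin sqr_ge0.
rewrite expe2 expr2 EFinM.
by apply: lee_pmul; rewrite ?lee_fin ?vnorm_ge0// vnorm_le_mean_error.
Qed.

Let mean_sqr_norm_pre r2 : (forall i j, measurable_fun setT (b i j)) ->
  (mean_risk E mu 2 <= r2%:E)%E ->
  (Ex P (fun a => mean_sqr_norm (fun i j => b i j a)) <= r2%:E)%E.
Proof.
move=> mb risk2.
have mv i : measurable_fun setT (fun a => vnorm (b i ^~ a) ^+ 2).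
  by apply: measurable_funX; rewrite /vnorm; meas.
rewrite /mean_sqr_norm Ex_scale ?invr_ge0//; first last.
- by meas.
- by move=> a; rewrite sumr_ge0// => i _; exact: sqr_ge0.
rewrite Ex_sum; [|by move=> i a; exact: sqr_ge0|exact: mv].
apply: (@le_trans _ _ ((n%:R^-1)%:E * (\sum_(i < n) r2%:E))%E).
  apply: lee_wpmul2l; first by rewrite lee_fin invr_ge0.
  by apply: lee_sum => i _; apply: le_trans (mean_risk2_ge i) risk2.
rewrite sumEFin sumr_const card_ord -EFinM lee_fin -[X in _ * X]mulr_natl mulrA mulVf ?mul1r//.
by rewrite gt_eqF.
Qed.

Lemma scaled_risk_le (r r2 cross U : R) : 0 < r ->
  (forall i j, measurable_fun setT (b i j)) ->
  (mean_risk E mu 2 <= r2%:E)%E ->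
  (forall bb kap, kernel_conditions (@x n p) h m D bb kap -> forall N,
     (Ex P (fun a => gridmax (start_level + N) (fun t => bil (kap t) (fun i j => b i j a)
        (fun i k => cv i k a + er i k a)))%R <= cross%:E)%E) ->
  Lam / (n%:R * m) <= U ->
  (scaled_risk E mu x w h Z r%:E <= (r^-1 *
    ((products_const beta0 CZ A D + D * A ^+ 2 * (3 * MB + 3 * tau + L)) / Num.sqrt n%:R +
     errors_const CZ sigma2 kappa A D U * Num.sqrt (Lam / (n%:R * m)) + 2 * cross +
     4 * (D * A ^+ 2) * r2 + D * A ^+ 2 * ((sfloor gamma).+2%:R * (L * h `^ gamma))))%:E)%E.
Proof.
move=> r0 mb risk2 crossP LamU.
have [g [mg gP Eg]] := risk_bound gamma0 beta01 CZ0 (ltW L0) kappa1 ZP EZ indE errE n0 p0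
  x01 x_lt h_gt0 m0 A0 D0 start_level_fine windows_design weight_kernel_conditions
  weight_kernel_lt weight_kernel_sum weight_kernel_moments mb
  (mean_sqr_norm_pre mb risk2) crossP LamU.
have tri0 : @tri R (0, 0) by split=> //=; split.
have g0 a : 0 <= g a by apply: le_trans (gP a _ tri0).
rewrite /scaled_risk inver gt_eqF//.
apply: (@le_trans _ _ (Ex P (fun a => r^-1 * g a))).
  apply: lower_integral_le => a.
    by rewrite mule_ge0// ?cov_error_ge0// lee_fin invr_ge0 ltW.
  rewrite EFinM; apply: lee_wpmul2l; first by rewrite lee_fin invr_ge0 ltW.
  exact: cov_error_le.
rewrite Ex_scale ?invr_ge0 ?(ltW r0)// EFinM; apply: lee_wpmul2l => //.
by rewrite lee_fin invr_ge0 ltW.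
Qed.

(** An infinite rate has inverse zero, a finite one dominates all its terms. *)
Lemma scaled_risk_rate (rate : \bar R) (K : R) :
  ((Num.sqrt n%:R)^-1%:E <= rate)%E ->
  (forall r, rate = r%:E -> 0 < r -> (scaled_risk E mu x w h Z r%:E <= K%:E)%E) ->
  (scaled_risk E mu x w h Z rate <= `|K|%:E)%E.
Proof.
case: rate => [r||//] le H.
  have r0 : 0 < r.
    by apply: lt_le_trans (le : (_ <= _)); rewrite invr_gt0 sqrtr_gt0.
  by apply: le_trans (H r erefl r0) _; rewrite lee_fin ler_norm.
rewrite /scaled_risk invey; under eq_integral do rewrite mul0e.
by rewrite integral0 lee_fin.
Qed.

Let S := Num.sqrt (ln h^-1 / (n%:R * p%:R * h)).
Let kc := Num.sqrt (2 / c).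
Let U (B : R) := log_const B / c.
Let y := (Num.sqrt (n%:R : R))^-1.

Let sqn0 : 0 < Num.sqrt (n%:R : R). Proof. by rewrite sqrtr_gt0. Qed.
Let y0 : 0 < y. Proof. by rewrite invr_gt0. Qed.
Let tAD0 : 0 <= tau * A ^+ 3 * D ^+ 2.
Proof. by rewrite mulr_ge0 ?sqr_ge0// mulr_ge0 ?exprn_ge0// ltW. Qed.

Let log_const_ge0 B : 0 <= log_const B.
Proof. by rewrite /log_const !addr_ge0// mulr_ge0. Qed.

Let entropy_bound B : ln p%:R <= B * n%:R -> Lam / (n%:R * m) <= U B.
Proof.
move=> lp; have n1 : 1 <= n%:R :> R by rewrite ler1n.
have LB := start_level_log n1 lp; rewrite -/Lam in LB.
rewrite invfM mulrA; apply: ler_pM; rewrite ?invr_ge0 ?(ltW m0) ?divr_ge0//.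
  by rewrite ler_pdivrMr.
by rewrite lef_pV2 ?posrE// ltW.
Qed.

Let products_const_ge0 : 0 <= products_const beta0 CZ A D.
Proof.
have M0 : 0 <= 2 * MB + 2 * MB ^+ 2 by rewrite addr_ge0 ?mulr_ge0 ?sqr_ge0.
apply: mulr_ge0; first by rewrite /chain_const addr_ge0// divr_ge0// sqr_ge0.
by rewrite addr_ge0// mulr_ge0// mulr_ge0// sqr_ge0.
Qed.

Let errors_const_ge0 B : 0 <= errors_const CZ sigma2 kappa A D (U B).
Proof.
have U0 : 0 <= U B by rewrite divr_ge0// ltW.
have gc0 : 0 <= ln (gauss_const R) by rewrite ln_ge0// gauss_const_ge1.
have t1 : 0 <= A * MB by exact: mulr_ge0.
have t2 : 0 <= 4 * tau * (ln (gauss_const R) * A + 4 * U B).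
  apply: mulr_ge0; first by rewrite mulr_ge0// ltW.
  by rewrite addr_ge0// mulr_ge0.
have t3 : 0 <= tau * A ^+ 2 * D ^+ 2.
  by rewrite mulr_ge0 ?sqr_ge0// mulr_ge0 ?sqr_ge0// ltW.
rewrite /errors_const mulr_ge0//; first exact: (mulr_ge0 _ CC0).
by rewrite addr_ge0// mulr_ge0// addr_ge0.
Qed.

(** The terms common to the two rates, for a rate [r] above each of
    [h `^ gamma], [S] and [1 / sqrt n]. *)
Definition common_const (B : R) : R :=
  products_const beta0 CZ A D + D * A ^+ 2 * (3 * MB + 3 * tau + L) +
  errors_const CZ sigma2 kappa A D (U B) * (2 + kc) +
  4 * (D * A ^+ 2) + D * A ^+ 2 * ((sfloor gamma).+2%:R * L).

Let common_rate (B r kcross : R) : 0 < r -> ln p%:R <= B * n%:R ->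
  (forall i j, measurable_fun setT (b i j)) ->
  (mean_risk E mu 2 <= r%:E)%E -> h `^ gamma <= r -> S <= r -> y <= r ->
  (forall bb kap, kernel_conditions (@x n p) h m D bb kap -> forall N,
     (Ex P (fun a => gridmax (start_level + N) (fun t => bil (kap t) (fun i j => b i j a)
        (fun i k => cv i k a + er i k a)))%R <= (kcross * r)%:E)%E) ->
  (scaled_risk E mu x w h Z r%:E <= (common_const B + 2 * kcross)%:E)%E.
Proof.
move=> r0 lp mb risk2 hr Sr yr crossP.
apply: le_trans (scaled_risk_le r0 mb risk2 crossP (entropy_bound lp)) _.
rewrite lee_fin ler_pdivrMl//.
have Sn : Num.sqrt (Lam / (n%:R * m)) <= (2 + kc) * r.
  have := sqrt_entropy_le nR; rewrite -/S -/kc -/y => H; apply: le_trans H _.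
  have k0 : 0 <= kc by exact: sqrtr_ge0.
  by have := ler_wpM2l k0 yr; lra.
have b1 : (products_const beta0 CZ A D + D * A ^+ 2 * (3 * MB + 3 * tau + L)) / Num.sqrt n%:R <=
    (products_const beta0 CZ A D + D * A ^+ 2 * (3 * MB + 3 * tau + L)) * r.
  apply: ler_wpM2l => //; rewrite addr_ge0// mulr_ge0// !addr_ge0 ?mulr_ge0 ?(ltW L0)//.
  exact: ltW.
have b2 := ler_wpM2l (errors_const_ge0 B) Sn.
have b5 : D * A ^+ 2 * ((sfloor gamma).+2%:R * (L * h `^ gamma)) <=
    D * A ^+ 2 * ((sfloor gamma).+2%:R * (L * r)).
  by do 2! (apply: ler_wpM2l => //); apply: ler_wpM2l => //; exact: ltW.
apply: le_trans (lerD (lerD (lerD (lerD b1 b2) (lexx _)) (lexx _)) b5) _.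
by rewrite /common_const le_eqVlt; apply/orP; left; apply/eqP; ring.
Qed.

Let kc0 : 0 <= kc. Proof. exact: sqrtr_ge0. Qed.

Definition leave_one_out_const : R :=
  CC * (1 + tau * A ^+ 3 * D ^+ 2) * (2 + kc) + D * A ^+ 2 * (1 + MB).

Lemma leave_one_out_rate B : ln p%:R <= B * n%:R -> leave_one_out E mu x ->
  (scaled_risk E mu x w h Z (rate_leave_one_out E mu h gamma) <=
    `|common_const B + 2 * leave_one_out_const|%:E)%E.
Proof.
move=> lp loo; apply: scaled_risk_rate.
  by rewrite /rate_leave_one_out !le_max lexx !orbT.
move=> r rE r0; set M := Num.max (Num.sqrt (ln h^-1 / (p%:R * h))) 1.
have M1 : 1 <= M by rewrite /M le_max lexx orbT.
have M0 : 0 < M by exact: lt_le_trans M1.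
have risk2 : (mean_risk E mu 2 <= r%:E)%E by rewrite -rE /rate_leave_one_out le_max lexx.
have risk1 : (mean_risk E mu 1 <= (r / M)%:E)%E.
  by rewrite EFinM lee_pdivlMr// -rE /rate_leave_one_out !le_max lexx !orbT.
have hr : h `^ gamma <= r by rewrite -lee_fin -rE /rate_leave_one_out !le_max lexx !orbT.
have Sr : S <= r by rewrite -lee_fin -rE /rate_leave_one_out !le_max lexx !orbT.
have yr : y <= r by rewrite -lee_fin -rE /rate_leave_one_out !le_max lexx !orbT.
have mw i j : measurable_wrt (sources (@source R n p E) (other_data p i)) (b i j).
  apply: measurable_funB; last exact: measurable_cst.
  have sub : sigma_gen (fun q : {q : 'I_n * 'I_p | q.1 != i} => obs mu x (sval q).1 (sval q).2)
      `<=` <<s sources (@source R n p E) (other_data p i)>>.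
    apply: smallest_sub; first exact: smallest_sigma_algebra.
    move=> _ [[[i' j'] /= ii'] _ [C mC <-]].
    have mo : measurable_wrt (sources (@source R n p E) (other_data p i)) (obs mu x i' j').
      apply: measurable_funD; last by apply: err_wrt; rewrite inE.
      apply: measurable_funD; first exact: measurable_cst.
      by apply: curve_wrt; rewrite ?inE.
    exact: (mo measurableT C mC).
  by move=> _ C mC; rewrite setTI; apply: sub; exact: loo.
have mb i j : measurable_fun setT (b i j).
  exact: (measurable_wrt_fun (@sources_measurable _ _ _ _ (source_measurable EZ errE) _) (mw i j)).
apply: common_rate => // bb kap kapP N.
have risk1' i : (Ex P (fun a => vnorm (b i ^~ a)) <= (r / M)%:E)%E.
  exact: le_trans (mean_risk1_ge i) risk1.
apply: le_trans (leave_one_out_cross beta01 CZ0 ZP EZ indE errE n0 x01 x_inj h_gt0 m0 A0 D0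
  start_level_fine windows_design kapP mw risk1' N) _.
rewrite lee_fin mulrA ler_pdivrMr//.
rewrite -mulrA (mulrC r) mulrA ler_pM2r// /single_curve_const /leave_one_out_const.
rewrite [leRHS]mulrDl; apply: lerD; last by rewrite ler_peMr// mulr_ge0// addr_ge0.
rewrite -[leRHS]mulrA; apply: ler_wpM2l; first by rewrite mulr_ge0// addr_ge0.
have := sqrt_entropy_le ltr01; rewrite !mul1r sqrtr1 divr1 => H; apply: le_trans H _.
have l1 : Num.sqrt (ln h^-1 / (p%:R * h)) <= M by rewrite /M le_max lexx.
have := ler_wpM2l kc0 M1; rewrite /kc; lra.
Qed.

Definition independent_const (B : R) : R :=
  CC * (log_const B + 8 * ((D * A ^+ 2) ^+ 2 * MB)) +
  CC * ((1 + tau * A ^+ 3 * D ^+ 2) * (2 + 2 * kc)).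

Lemma independent_rate B : ln p%:R <= B * Num.sqrt n%:R -> independent_of_data E mu x ->
  (scaled_risk E mu x w h Z (rate_independent E mu h gamma) <=
    `|common_const `|B| + 2 * independent_const B|%:E)%E.
Proof.
move=> lp [mmu indmu]; apply: scaled_risk_rate.
  by rewrite /rate_independent !le_max lexx !orbT.
move=> r rE r0.
have q1 : 1 <= Num.sqrt (n%:R : R) by rewrite -[leLHS]sqrtr1 ler_wsqrtr// ler1n.
have nE : n%:R = Num.sqrt (n%:R : R) ^+ 2 by rewrite sqr_sqrtr// ltW.
have risk2 : (mean_risk E mu 2 <= r%:E)%E by rewrite -rE /rate_independent le_max lexx.
have hr : h `^ gamma <= r by rewrite -lee_fin -rE /rate_independent !le_max lexx !orbT.
have yr : y <= r by rewrite -lee_fin -rE /rate_independent !le_max lexx !orbT.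
have mr0 : (0 <= mean_risk E mu 2)%E.
  apply: le_trans (mean_risk2_ge (Ordinal n0)); apply: Ex_ge0 => a; exact: sqr_ge0.
pose r2 := fine (mean_risk E mu 2).
have r2E : mean_risk E mu 2 = r2%:E.
  by rewrite /r2 fineK// ge0_fin_numE//; apply: le_lt_trans risk2 (ltry _).
have r20 : 0 <= r2 by rewrite -lee_fin -r2E.
have r2r : r2 <= r by rewrite -lee_fin -r2E.
have sS : (1 + Num.sqrt r2) * S <= r.
  rewrite -lee_fin -rE /rate_independent r2E !le_max.
  by rewrite [X in _ || (_ || (X || _))](_ : _ = true) ?orbT//; exact: lexx.
have sr0 : 0 <= Num.sqrt r2 by exact: sqrtr_ge0.
have S0 : 0 <= S by exact: sqrtr_ge0.
have Sr : S <= r by have := mulr_ge0 sr0 S0; lra.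
have lpn : ln p%:R <= `|B| * n%:R.
  apply: le_trans lp _; apply: (@le_trans _ _ (`|B| * Num.sqrt n%:R)).
    by rewrite ler_wpM2r ?(ltW sqn0)// ler_norm.
  by rewrite ler_wpM2l// [leRHS]nE expr2 ler_peMr// ltW.
pose G := sigma_gens (fun q : 'I_n * {t : R | 0 <= t <= 1} => @muhat R n p E q.1 (sval q.2)).
pose H := sigma_gens (fun q : 'I_n * 'I_p => @obs R n p E mu x q.1 q.2).
have mG : <<s G>> `<=` measurable.
  by apply: sigma_gen_measurable => -[i [t t01]]; exact: mmu.
have mH : <<s H>> `<=` measurable.
  apply: sigma_gen_measurable => -[i j]; rewrite /obs /=.
  apply: measurable_funD; last by have [] := errE i j.
  apply: measurable_funD; first exact: measurable_cst.
  by have [+ _] := EZ i; exact.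
have mw i j : measurable_wrt G (b i j).
  apply: measurable_funB; last exact: measurable_cst.
  exact: (@measurable_sigma_gens R n p E _
    (fun q : 'I_n * {t : R | 0 <= t <= 1} => @muhat R n p E q.1 (sval q.2))
    (i, exist (fun t : R => is_true (0 <= t <= 1)) (x i j) (x01 i j))).
have mW i j : measurable_wrt H (fun a => cv i j a + er i j a).
  rewrite (_ : (fun a => _) = fun a => @obs R n p E mu x i j a - mu (x i j)).
    apply: measurable_funB; last exact: measurable_cst.
    exact: (@measurable_sigma_gens R n p E _
      (fun q : 'I_n * 'I_p => @obs R n p E mu x q.1 q.2) (i, j)).
  by apply/funext => a; rewrite /obs /cv /er; ring.
have mb i j : measurable_fun setT (b i j) by exact: measurable_wrt_fun (mw i j).
apply: common_rate => // bb kap kapP N.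
have risk2' : (Ex P (fun a => mean_sqr_norm (fun i j => b i j a)) <= r2%:E)%E.
  by apply: mean_sqr_norm_pre => //; rewrite r2E.
set s := Num.sqrt (Lam / (n%:R * m)).
have nm0 : 0 < n%:R * m by rewrite mulr_gt0.
have s0 : 0 < s by rewrite sqrtr_gt0 divr_gt0.
have sE : Lam = s ^+ 2 * (n%:R * m).
  rewrite /s sqr_sqrtr; last by rewrite divr_ge0// ltW.
  by rewrite divfK// gt_eqF.
have d0 : 0 < 1 + Num.sqrt r2 by exact: ltr_pwDl.
(* The curves get the parameter [n], which produces the risk itself; the errors
   get the one balancing the entropy against the variance, where [1 +] keeps the
   denominator positive. *)
have lam0 : 0 < s * (n%:R * m) / (1 + Num.sqrt r2) by rewrite divr_gt0// !mulr_gt0.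
apply: le_trans (independent_cross beta01 CZ0 ZP EZ indE errE n0 x01 x_inj h_gt0 m0 A0 D0
  start_level_fine windows_design kapP mG mH indmu mw mW risk2' nR lam0 N) _.
rewrite lee_fin /independent_const [leRHS]mulrDl -/tau -/MB -/CC.
have LB := start_level_log q1 lp; rewrite -/Lam in LB.
apply: lerD; rewrite -[leRHS]mulrA; apply: ler_wpM2l => //.
  rewrite [leRHS]mulrDl; apply: lerD.
    rewrite ler_pdivrMr//; apply: le_trans LB _; rewrite -mulrA ler_wpM2l//.
    apply: (@le_trans _ _ (y * n%:R)); last by rewrite ler_wpM2r// ltW.
    by rewrite /y [X in _ * X]nE expr2 mulrA mulVf ?mul1r// gt_eqF.
  rewrite (_ : n%:R * _ = 8 * ((D * A ^+ 2) ^+ 2 * MB) * r2); last by field; rewrite gt_eqF.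
  by rewrite ler_wpM2l// mulr_ge0// mulr_ge0// sqr_ge0.
have sr : s * (1 + Num.sqrt r2) <= (2 + 2 * kc) * r.
  have := sqrt_entropy_le nR; rewrite -/s -/S -/kc -/y => H1.
  apply: le_trans (ler_wpM2r (ltW d0) H1) _.
  have e2 : kc * (y * (1 + Num.sqrt r2)) <= kc * (2 * r).
    apply: ler_wpM2l => //.
    (* a geometric mean of two terms of the rate, [r2] and [y ^+ 2 <= y] *)
    have e3 : y * Num.sqrt r2 <= r.
      have [le|/ltW le] := leP (Num.sqrt r2) 1.
        by apply: le_trans yr; rewrite ler_piMr// ltW.
      apply: le_trans r2r; rewrite -[leRHS](sqr_sqrtr r20) expr2 ler_wpM2r//.
      by apply: le_trans le; rewrite /y invf_le1.
    lra.
  rewrite mulrDl -!mulrA; lra.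
apply: (@le_trans _ _ ((1 + tau * A ^+ 3 * D ^+ 2) * (s * (1 + Num.sqrt r2)))); last first.
  by rewrite -[leRHS]mulrA ler_wpM2l// addr_ge0.
rewrite [leRHS]mulrDl mul1r; apply: lerD.
  rewrite -/Lam sE le_eqVlt; apply/orP; left; apply/eqP; field.
  by rewrite !gt_eqF.
rewrite (_ : s * _ / _ * _ = tau * A ^+ 3 * D ^+ 2 * (s * (r2 / (1 + Num.sqrt r2)))); last first.
  by field; rewrite !gt_eqF.
rewrite ler_wpM2l// ler_pM2l// ler_pdivrMr//.
by rewrite -{1}(sqr_sqrtr r20); nra.
Qed.

End Estimator.

Theorem theorem6 (R : realType) (mu : R -> R) (x : design R) (w : weights R)
    (gamma c h0 sigma2 kappa beta0 L CZ : R)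
    (gamma_gt0 : 0 < gamma) (c_gt0 : 0 < c) (h0_gt0 : 0 < h0)
    (kappa_ge1 : 1 <= kappa) (beta0_gt0 : 0 < beta0) (beta0_le1 : beta0 <= 1)
    (L_gt0 : 0 < L) (CZ_gt0 : 0 < CZ)
    (design_x : design_points x) (density_x : design_density x)
    (weights_w : admissible_weights x w (sfloor gamma) c h0) :
  (forall B : R, exists (K : R) (n0 p0 : nat), forall n p : nat,
     (n0 <= n)%N -> (p0 <= p)%N -> ln p%:R <= B * n%:R ->
     (ereal_sup [set r | exists (h : R) (Z : process R) (E : experiment R n p),
        [/\ (c / p%:R < h <= h0)%R,
            process_class gamma L beta0 CZ Z,
            [/\ iid_copies E Z, sources_independent E &
                error_conditions E sigma2 kappa],
            leave_one_out E mu x &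
            r = scaled_risk E mu x w h Z (rate_leave_one_out E mu h gamma)]]
      <= K%:E)%E)
  /\
  (forall B : R, exists (K : R) (n0 p0 : nat), forall n p : nat,
     (n0 <= n)%N -> (p0 <= p)%N -> ln p%:R <= B * Num.sqrt n%:R ->
     (ereal_sup [set r | exists (h : R) (Z : process R) (E : experiment R n p),
        [/\ (c / p%:R < h <= h0)%R,
            process_class gamma L beta0 CZ Z,
            [/\ iid_copies E Z, sources_independent E &
                error_conditions E sigma2 kappa],
            independent_of_data E mu x &
            r = scaled_risk E mu x w h Z (rate_independent E mu h gamma)]]
      <= K%:E)%E).
Proof.
have [C3 C30 dens] := density_x.
have [C1 [C2 [p1 [C10 C20 wP]]]] := weights_w.
have b01 : 0 < beta0 <= 1 by rewrite beta0_gt0.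
split=> B.
- exists `|common_const gamma c sigma2 kappa beta0 L CZ C1 C2 C3 B +
      2 * leave_one_out_const c sigma2 kappa CZ C1 C2 C3|, 1%N, (maxn p1 1).
  move=> n p n0; rewrite geq_max => /andP[p1p p0] lp.
  apply/ereal_supP => _ [h [Z [E [/andP[ch hh0] ZP [EZ indE errE] loo ->]]]].
  apply: leave_one_out_rate => //.
  by move=> i; apply: wP => //; rewrite ch.
- exists `|common_const gamma c sigma2 kappa beta0 L CZ C1 C2 C3 `|B| +
      2 * independent_const c sigma2 kappa CZ C1 C2 C3 B|, 1%N, (maxn p1 1).
  move=> n p n0; rewrite geq_max => /andP[p1p p0] lp.
  apply/ereal_supP => _ [h [Z [E [/andP[ch hh0] ZP [EZ indE errE] ind ->]]]].
  apply: independent_rate => //.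
  by move=> i; apply: wP => //; rewrite ch.
Qed.
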